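(* Let $0<t<2$ and let $\mathcal{P}=\{P_i\}_{i=1}^N$ be a collection of open dyadic cubes with pairwise disjoint triples, i.e. $3P_i\cap 3P_j=\emptyset$ for $i\ne j$. Assume further that $\|\mathcal{P}\|_{t\text{-pack}}\le 1$. Then there exists a positive constant $C=C(t)$, depending only on $t$ (in particular not on $\mathcal{P}$), such that $$\|\mathcal{S}(\chi_{\overline{P}}f)\|_{L^2(w_{t,\mathcal{P}})}\le C\,\|f\|_{L^2(w_{t,\mathcal{P}})}$$ for all $f\in L^2(\mathbb{C})$. Moreover, $C(t)$ is an increasing function of $t$.
   Context: Cubes are squares in the plane with sides parallel to the axes; dyadic cubes are those with vertices' coordinates given by products of intervals with endpoints $2^{-k}m_j$, $2^{-k}(m_j+1)$ ($j=1,2$), with $k$ a non-negative integer and $m_1,m_2$ integers. $\ell(Q)$ is the side-length of the cube $Q$; $aQ$ is the cube concentric with $Q$ with side-length $a\,\ell(Q)$. The $t$-Carleson packing norm of a finite collection $\mathcal{P}$ of disjoint dyadic cubes is $$\|\mathcal{P}\|_{t\text{-pack}}=\sup_Q\Bigl[\ell(Q)^{-t}\sum_{P\in\mathcal{P},\,P\subset Q}\ell(P)^t\Bigr]^{1/t},$$ the supremum being over all dyadic cubes $Q$. Put $\overline{P}=\bigcup_{i=1}^N P_i$ and define the weight $$w_{t,\mathcal{P}}(x)=\sum_j\ell(P_j)^{t-2}\chi_{P_j}(x),$$ where $\chi_A$ is the characteristic function of $A$. $L^2(w_{t,\mathcal{P}})$ is the $L^2$ space (seminorm on functions on $\mathbb{C}$)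 with respect to $w_{t,\mathcal{P}}\,dA$, with $dA$ Lebesgue measure on $\mathbb{C}$. $\mathcal{S}$ is the Beurling transform, $(\mathcal{S}f)(z)=-\frac1\pi\,\mathrm{p.v.}\int_{\mathbb{C}}\frac{f(\tau)}{(z-\tau)^2}\,dA(\tau)$. *)

(* Defs.v *)
From HB Require Import structures.
From mathcomp Require Import all_boot all_order all_algebra.
From mathcomp Require Import complex.
From mathcomp Require Import all_classical all_reals all_analysis.
Set Implicit Arguments.
Unset Strict Implicit.
Unset Printing Implicit Defensive.
Import Order.TTheory GRing.Theory Num.Theory.
Import numFieldNormedType.Exports.

Local Open Scope classical_set_scope.
Local Open Scope complex_scope.
Local Open Scope ring_scope.

(* [Dyadic k m1 m2] encodes the dyadic cube
   ]2^-k m1, 2^-k (m1 + 1)[ x ]2^-k m2, 2^-k (m2 + 1)[; since k is a natural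
   number, side lengths are at most 1. *)
Record dyadic := Dyadic { dexp : nat; didx1 : int; didx2 : int }.

(* The complex plane as a domain: x + iy is the pair (x, y), so that the
   product Borel sigma-algebra and Lebesgue measure apply. Values of functions
   are complex numbers R[i]. *)
Notation plane R := (measurableTypeR R * measurableTypeR R)%type.

Section Defs.
Variable R : realType.
Local Notation plane := (plane R).
Local Notation dA := (@lebesgue_measure R \x @lebesgue_measure R)%E.

Definition toC (z : plane) : R[i] := (z.1 : R) +i* (z.2 : R).

Definition cabs (c : R[i]) : R := ComplexField.Normc.normc c.

Definition side (Q : dyadic) : R := 2 ^- dexp Q.

Definition cube (Q : dyadic) : set plane :=
  [set z | [/\ side Q * (didx1 Q)%:~R < z.1,
               z.1 < side Q * (didx1 Q + 1)%:~R,
               side Q * (didx2 Q)%:~R < z.2 &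
               z.2 < side Q * (didx2 Q + 1)%:~R]].

Definition center1 (Q : dyadic) : R := side Q * ((didx1 Q)%:~R + 2^-1).
Definition center2 (Q : dyadic) : R := side Q * ((didx2 Q)%:~R + 2^-1).

Definition dilate (a : R) (Q : dyadic) : set plane :=
  [set z | `|z.1 - center1 Q| < a * side Q / 2 /\
           `|z.2 - center2 Q| < a * side Q / 2].

Definition pack_norm (t : R) (N : nat) (P : 'I_N -> dyadic) : \bar R :=
  ereal_sup
    [set ((side Q `^ (- t) *
           \sum_(i < N | `[< cube (P i) `<=` cube Q >]) side (P i) `^ t)
          `^ t^-1)%:E | Q in [set: dyadic]].

Definition cubes_union (N : nat) (P : 'I_N -> dyadic) : set plane :=
  \bigcup_(i in [set: 'I_N]) cube (P i).

Definition weight (t : R) (N : nat) (P : 'I_N -> dyadic) (z : plane) : R :=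
  \sum_(i < N) side (P i) `^ (t - 2) * \1_(cube (P i)) z.

Definition cmeasurable (f : plane -> R[i]) : Prop :=
  measurable_fun [set: plane] (fun z => complex.Re (f z)) /\
  measurable_fun [set: plane] (fun z => complex.Im (f z)).

Definition l2norm (w : plane -> R) (f : plane -> R[i]) : \bar R :=
  ((\int[dA]_z (cabs (f z) ^+ 2 * w z)%:E) `^ (2^-1)%R)%E.

Definition inL2 (f : plane -> R[i]) : Prop :=
  cmeasurable f /\ (l2norm (cst 1%R) f < +oo)%E.

Definition restrict_to (A : set plane) (f : plane -> R[i]) : plane -> R[i] :=
  fun z => (\1_A z)%:C * f z.

Definition cintegral (D : set plane) (g : plane -> R[i]) : R[i] :=
  Rintegral dA D (fun z => complex.Re (g z)) +i*
  Rintegral dA D (fun z => complex.Im (g z)).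

Definition beurling_trunc (f : plane -> R[i]) (z : plane) (eps : R) : R[i] :=
  cintegral [set tau | eps < cabs (toC z - toC tau)]
            (fun tau => f tau / (toC z - toC tau) ^+ 2).

(* The limit is taken on real and imaginary parts. For f in L^2 it exists for
   almost every z; [lim] takes an arbitrary value on the null set of the other
   points. *)
Definition beurling (f : plane -> R[i]) (z : plane) : R[i] :=
  - (pi%:C)^-1 *
  (lim (complex.Re (beurling_trunc f z eps) @[eps --> 0^'+]) +i*
   lim (complex.Im (beurling_trunc f z eps) @[eps --> 0^'+])).

End Defs.

(* Main.v *)
Require Import Defs.
From HB Require Import structures.
From mathcomp Require Import all_boot all_order all_algebra.
From mathcomp Require Import complex.
From mathcomp Require Import all_classical all_reals all_analysis measurable_realfun.
From mathcomp Require Import ring lra zify.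
Set Implicit Arguments.
Unset Strict Implicit.
Unset Printing Implicit Defensive.
Import Order.TTheory GRing.Theory Num.Theory.
Import numFieldNormedType.Exports.
Local Open Scope classical_set_scope.
Local Open Scope ring_scope.

(** The weight equals l(P_i)^(t-2) on P_i. It is constant on each cube, and it
    is at least one on the union, since cubes have side at most one and t < 2;
    hence the weighted energy of f dominates the plain L^2 energy of f on the
    union. For z in P_i the transform of f restricted to the union is a sum of
    three terms.

    The first is the transform of f restricted to P_i. Since the weight is
    constant on P_i, the unweighted L^2 bound takes care of it.

    The second is F(z'), where F is the transform with the kernel regularized
    at scale one and z' is any point of the unit dyadic square Q_i containing
    P_i. Averaging over z' and summing with the weight gives the sum of
    l(P_i)^(t-2) l(P_i)^2 times the integral of F^2 on Q_i; the packing
    condition for unit squares bounds this by the integral of F^2 over the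
    plane, so that the unweighted L^2 bound applies again.

    The third is an error. Disjointness of the triples makes |z - w| comparable,
    for w in P_j, with the distance D_ij between the two cubes increased by
    their sides, and the error is at most the sum over j of k(D_ij) times the
    integral of |f| on P_j, where k(r) = 1/(r^2 (1 + r)) ([kernel_compare],
    [remainder_kernel_le]). The additional decay of k beyond distance one is the
    purpose of the regularized term: packing controls the family up to scale one
    only, beyond which it may be as spread out as Lebesgue measure, and 1/r^2 is
    not integrable at infinity. The columns of the matrix k(D_ij), weighted by
    l(P_i)^t, sum to at most C l(P_j)^(t-2), through a geometric series of ratio
    2^(t-2) ([column_bound]). This one-sided bound suffices for L^2 because of
    the inequality k(a) k(b) <= 8 (k(a) + k(b)) k(d), valid when d <= a + b
    ([positive_kernel_L2]). The parameter t enters the constant through that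
    geometric series alone, whence the monotonicity.

    The unweighted bound rests on the regularized kernel
    conj(z)^2/(|z|^2 + e^2)^2. Up to sign it is the derivative with respect to z
    of u = conj(z)/(|z|^2 + e^2), whose derivative with respect to conj(z) is
    the positive bump e^2/(|z|^2 + e^2)^2. Both derivatives of a function vanishing
    at infinity have the same L^2 norm, the difference of the integrands being a
    Jacobian determinant, that is, a divergence ([integral_null_lagrangian]).
    Hence convolution with the regularized kernel has the same L^2 norm as
    convolution with the bump, whose integral is bounded uniformly in e. The
    truncated kernels differ from the regularized ones by a multiple of the
    bump ([truncated_smooth_le]). All bounds being uniform in the truncation
    radius, Fatou's lemma passes to the principal value ([beurling_energy]). *)

(** * Integrals and kernel operators *)

Section general.
Context d (T : measurableType d) (R : realType).
Variable mu : {measure set T -> \bar R}.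
Local Open Scope ereal_scope.

(** Monotonicity read off from the definition of the integral as a supremum over
    simple functions, so that it covers principal values, about whose
    measurability nothing is asserted. *)
Lemma ge0_le_integralT (f g : T -> \bar R) :
  (forall x, 0 <= f x) -> (forall x, f x <= g x) ->
  \int[mu]_x f x <= \int[mu]_x g x.
Proof.
move=> f0 fg; have g0 x : 0 <= g x by exact: le_trans (f0 x) (fg x).
rewrite !ge0_integralTE//; apply: le_ereal_sup => _ [h hf <-].
by exists h => // x; exact: le_trans (hf x) (fg x).
Qed.

Lemma integrable_EFinZ (c : R) (f : T -> R) :
  mu.-integrable setT (EFin \o f) ->
  mu.-integrable setT (EFin \o (fun x => c * f x)%R).
Proof.
move=> fi; apply: eq_integrable (integrableZl measurableT c fi) => //.
Qed.

Lemma integrable_EFinD (f g : T -> R) :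
  mu.-integrable setT (EFin \o f) -> mu.-integrable setT (EFin \o g) ->
  mu.-integrable setT (EFin \o (fun x => f x + g x)%R).
Proof.
move=> fi gi; apply: eq_integrable (integrableD measurableT fi gi) => //.
Qed.

(** Cauchy-Schwarz for the measure |k| mu. With Y the integral of |k f|,
    integrating |k| (a - |f|)^2 >= 0 gives 2 a Y <= a^2 B + X, and a = Y / B is
    the optimal choice. *)
Lemma sqr_integral_le (k f : T -> R) (B : R) :
  measurable_fun setT k -> measurable_fun setT f -> (0 < B)%R ->
  \int[mu]_x `|k x|%:E <= B%:E ->
  ((\int[mu]_x (k x * f x))%R ^+ 2)%:E <=
    B%:E * \int[mu]_x (`|k x| * f x ^+ 2)%:E.
Proof.
move=> mk mf B0 kB.
pose ak (x : T) : R := `|k x|%R.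
pose w (x : T) : R := (`|k x| * f x ^+ 2)%R.
pose kf (x : T) : R := (k x * f x)%R.
have X0 : 0 <= \int[mu]_x (`|k x| * f x ^+ 2)%:E.
  by apply: integral_ge0 => x _; rewrite lee_fin mulr_ge0// sqr_ge0.
have mk' : measurable_fun setT (EFin \o ak).
  by apply/measurable_EFinP; exact: measurableT_comp.
have mkf2 : measurable_fun setT (EFin \o w).
  apply/measurable_EFinP; apply: measurable_funM; first exact/measurable_EFinP.
  exact: measurable_funX.
have [Xy|Xfin] := eqVneq (\int[mu]_x (`|k x| * f x ^+ 2)%:E) +oo.
  by rewrite Xy gt0_muley ?leey ?lte_fin.
have Xfn : \int[mu]_x (`|k x| * f x ^+ 2)%:E \is a fin_num.
  by rewrite ge0_fin_numE// ltey.
have Bfn : \int[mu]_x `|k x|%:E \is a fin_num.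
  rewrite ge0_fin_numE; first exact: le_lt_trans kB (ltry _).
  by apply: integral_ge0 => x _; rewrite lee_fin.
have ik : mu.-integrable setT (EFin \o ak).
  apply/integrableP; split => //=; rewrite (eq_integral (fun x => `|k x|%:E)).
    by rewrite -ge0_fin_numE//; apply: integral_ge0 => x _; rewrite lee_fin.
  by move=> x _ /=; rewrite normr_id.
have ikf2 : mu.-integrable setT (EFin \o w).
  apply/integrableP; split => //=.
  rewrite (eq_integral (fun x => (`|k x| * f x ^+ 2)%:E)).
    by rewrite -ge0_fin_numE.
  by move=> x _ /=; rewrite ger0_norm// mulr_ge0// sqr_ge0.
have ikf : mu.-integrable setT (EFin \o kf).
  apply: (le_integrable measurableT _ _ (integrableD measurableT ik ikf2)).
    by apply/measurable_EFinP; exact: measurable_funM.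
  move=> x _ /=; rewrite /kf /ak /w lee_fin normrM [leRHS]ger0_norm; last first.
    by rewrite addr_ge0// mulr_ge0// sqr_ge0.
  rewrite -[X in (_ <= X + _)%R]mulr1 -mulrDr ler_wpM2l//.
  rewrite -(real_normK (num_real (f x))); nra.
have inkf := integrable_norm ikf.
set Y := (\int[mu]_x `|k x * f x|)%R.
have Y0 : (0 <= Y)%R by apply: Rintegral_ge0.
have H : (2 * (Y / B) * Y <= (Y / B) ^+ 2 * B +
           fine (\int[mu]_x (`|k x| * f x ^+ 2)%:E))%R.
  apply: (@le_trans _ _ ((Y / B) ^+ 2 * fine (\int[mu]_x `|k x|%:E) +
           fine (\int[mu]_x (`|k x| * f x ^+ 2)%:E))%R); last first.
    rewrite lerD2r ler_wpM2l ?sqr_ge0//.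
    by rewrite -lee_fin fineK.
  rewrite -/(Rintegral _ _ _) -/(Rintegral mu setT (fun x => `|k x|)%R).
  rewrite -/(Rintegral mu setT (fun x => `|k x| * f x ^+ 2)%R).
  have i1 := integrable_EFinZ ((Y / B) ^+ 2) ik.
  have -> : (2 * (Y / B) * Y = \int[mu]_x (2 * (Y / B) * `|k x * f x|))%R.
    by rewrite RintegralZl.
  rewrite -RintegralZl// -RintegralD//.
  apply: le_Rintegral => //.
  - exact: integrable_EFinZ inkf.
  - exact: integrable_EFinD i1 ikf2.
  - move=> x _; rewrite normrM -/Y -(real_normK (num_real (f x))).
    move: (Y / B)%R (`|f x|%R : R) => a b; rewrite -subr_ge0.
    have -> : (a ^+ 2 * `|k x| + `|k x| * b ^+ 2 - 2 * a * (`|k x| * b) =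
               `|k x| * (a - b) ^+ 2)%R by ring.
    by rewrite mulr_ge0// sqr_ge0.
rewrite -(fineK Xfn) -EFinM lee_fin.
have H2 : (`|\int[mu]_x (k x * f x)| <= Y)%R by apply: le_normr_Rintegral.
rewrite -(real_normK (num_real (\int[mu]_x (k x * f x))%R)).
apply: (@le_trans _ _ (Y ^+ 2)%R); first by rewrite lerXn2r ?nnegrE.
set X := fine _ in H *.
have -> : (Y ^+ 2 = B * (2 * (Y / B) * Y - (Y / B) ^+ 2 * B))%R.
  by field; rewrite gt_eqF.
by rewrite ler_pM2l// lerBlDl.
Qed.

End general.

Section product_sigma_finite.
Context d1 d2 (T1 : measurableType d1) (T2 : measurableType d2) (R : realType).
Variable m1 : {sigma_finite_measure set T1 -> \bar R}.
Variable m2 : {sigma_finite_measure set T2 -> \bar R}.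

Lemma sigma_finite_product : sigma_finite setT (m1 \x m2)%E.
Proof.
have /sigma_finiteP[F [FT ndF Ffin]] := sigma_finiteT m1.
have /sigma_finiteP[G [GT ndG Gfin]] := sigma_finiteT m2.
exists (fun n => F n `*` G n) => [|n].
  apply/seteqP; split=> [[x y] _|//].
  have [i _ Fx] : (\bigcup_n F n) x by rewrite -FT.
  have [j _ Gy] : (\bigcup_n G n) y by rewrite -GT.
  exists (maxn i j) => //; split.
    by have := ndF _ _ (leq_maxl i j); rewrite subsetEset; exact.
  by have := ndG _ _ (leq_maxr i j); rewrite subsetEset; exact.
have [[mF finF] [mG finG]] := (Ffin n, Gfin n).
split; first exact: measurableX.
by rewrite product_measure1E// lte_mul_pinfty// ge0_fin_numE.
Qed.

(** Packaged as a structure so that the product can be a factor of a further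
    product: kernels are integrated over triples of points. *)
Definition product_sigma_finite :
    {sigma_finite_measure set (T1 * T2)%type -> \bar R} :=
  HB.pack (m1 \x m2)%E
    (Measure_isSigmaFinite.Build _ _ _ (m1 \x m2)%E sigma_finite_product).

End product_sigma_finite.

Section kernel_operators.
Context d1 d2 (T1 : measurableType d1) (T2 : measurableType d2) (R : realType).
Variable m1 : {sigma_finite_measure set T1 -> \bar R}.
Variable m2 : {sigma_finite_measure set T2 -> \bar R}.
Local Open Scope ereal_scope.

Definition kernel_op (k : T1 -> T2 -> R) (f : T2 -> R) (z : T1) : R :=
  (\int[m2]_t (k z t * f t))%R.

Definition kernel_measurable (k : T1 -> T2 -> R) :=
  measurable_fun [set: T1 * T2] (fun p => k p.1 p.2).

Lemma kernel_measurable_l (k : T1 -> T2 -> R) t : kernel_measurable k ->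
  measurable_fun setT (k^~ t).
Proof. by move=> mk; exact: (measurableT_comp mk (pair2_measurable t)). Qed.

Lemma kernel_measurable_r (k : T1 -> T2 -> R) z : kernel_measurable k ->
  measurable_fun setT (k z).
Proof. by move=> mk; exact: (measurableT_comp mk (pair1_measurable z)). Qed.

Lemma measurable_kernel_op (k : T1 -> T2 -> R) (f : T2 -> R) :
  kernel_measurable k -> measurable_fun setT f ->
  measurable_fun setT (kernel_op k f).
Proof.
move=> mk mf.
have mkf : measurable_fun [set: T1 * T2]
    (EFin \o (fun p : T1 * T2 => k p.1 p.2 * f p.2)%R).
  apply/measurable_EFinP; apply: measurable_funM => //.
  exact: measurableT_comp.
rewrite (_ : kernel_op k f = fine \o (fun z =>
   (\int[m2]_t (EFin \o (fun p : T1 * T2 => k p.1 p.2 * f p.2)%R)^\+ (z, t)) -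
   (\int[m2]_t (EFin \o (fun p : T1 * T2 => k p.1 p.2 * f p.2)%R)^\- (z, t)))).
  apply: measurableT_comp => //; apply: emeasurable_funB.
  - by apply: measurable_fun_fubini_tonelli_F => //; exact: measurable_funepos.
  - by apply: measurable_fun_fubini_tonelli_F => //; exact: measurable_funeneg.
apply/funext => z.
rewrite /kernel_op /Rintegral integralE /=.
by congr (fine (_ - _)); apply: eq_integral => t _;
  rewrite ?funeposE ?funenegE.
Qed.

Lemma integrable_kernel (k : T1 -> T2 -> R) (f : T2 -> R) (M : R) z :
  kernel_measurable k -> (forall t, `|k z t| <= M)%R ->
  m2.-integrable setT (EFin \o f) ->
  m2.-integrable setT (EFin \o (fun t => k z t * f t)%R).
Proof.
move=> mk kM fi.
have mf : measurable_fun setT f by apply/measurable_EFinP; case/integrableP: fi.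
apply: (le_integrable measurableT _ _ (integrable_EFinZ M fi)).
  apply/measurable_EFinP; apply: measurable_funM => //.
  exact: kernel_measurable_r.
move=> t _ /=; rewrite lee_fin !normrM ler_wpM2r//.
by rewrite (le_trans (kM t))// ler_norm.
Qed.

Lemma kernel_opB (k1 k2 : T1 -> T2 -> R) (f : T2 -> R) (M : R) z :
  kernel_measurable k1 -> kernel_measurable k2 ->
  (forall t, `|k1 z t| <= M)%R -> (forall t, `|k2 z t| <= M)%R ->
  m2.-integrable setT (EFin \o f) ->
  kernel_op (fun z t => k1 z t - k2 z t)%R f z =
  (kernel_op k1 f z - kernel_op k2 f z)%R.
Proof.
move=> mk1 mk2 k1M k2M fi.
rewrite /kernel_op -RintegralB//; [|exact: integrable_kernel k1M fi|
  exact: integrable_kernel k2M fi].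
by apply: eq_Rintegral => t _; rewrite mulrBl.
Qed.

(** Cauchy-Schwarz in the rows, then Tonelli and the bound on the columns. *)
Lemma schur_test (k : T1 -> T2 -> R) (f : T2 -> R) (B : R) :
  kernel_measurable k -> measurable_fun setT f ->
  (0 < B)%R ->
  (forall z, \int[m2]_t `|k z t|%:E <= B%:E) ->
  (forall t, \int[m1]_z `|k z t|%:E <= B%:E) ->
  \int[m1]_z (kernel_op k f z ^+ 2)%:E <= (B ^+ 2)%:E * \int[m2]_t (f t ^+ 2)%:E.
Proof.
move=> mk mf B0 kB1 kB2.
have mak : measurable_fun setT (fun p : T1 * T2 => `|k p.1 p.2| : R)%R.
  exact: measurableT_comp.
have mkf2 : measurable_fun setT
    (EFin \o (fun p : T1 * T2 => `|k p.1 p.2| * f p.2 ^+ 2)%R).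
  apply/measurable_EFinP; apply: measurable_funM => //.
  by apply: measurable_funX; exact: measurableT_comp.
have H z : (kernel_op k f z ^+ 2)%:E <= B%:E * \int[m2]_t (`|k z t| * f t ^+ 2)%:E.
  by apply: sqr_integral_le => //; exact: kernel_measurable_r.
apply: le_trans (ge0_le_integralT _ _ H) _.
  by move=> z; rewrite lee_fin sqr_ge0.
rewrite ge0_integralZl//; last 3 first.
- apply: (measurable_fun_fubini_tonelli_F
    (EFin \o (fun p : T1 * T2 => `|k p.1 p.2| * f p.2 ^+ 2)%R)) => //.
  by move=> p; rewrite lee_fin mulr_ge0// sqr_ge0.
- move=> z _; apply: integral_ge0 => t _.
  by rewrite lee_fin mulr_ge0// sqr_ge0.
- by rewrite lee_fin ltW.
rewrite expr2 EFinM -muleA lee_wpmul2l ?lee_fin ?(ltW B0)//.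
rewrite (fubini_tonelli
  (EFin \o (fun p : T1 * T2 => `|k p.1 p.2| * f p.2 ^+ 2)%R))//=; last first.
  by move=> p; rewrite lee_fin mulr_ge0// sqr_ge0.
rewrite -ge0_integralZl//; last 3 first.
- by apply/measurable_EFinP; exact: measurable_funX.
- by move=> t _; rewrite lee_fin sqr_ge0.
- by rewrite lee_fin ltW.
apply: ge0_le_integralT => t.
  by apply: integral_ge0 => z _; rewrite lee_fin mulr_ge0// sqr_ge0.
under eq_integral do rewrite EFinM.
rewrite ge0_integralZr//; last 2 first.
- apply/measurable_EFinP; apply: measurableT_comp => //.
  exact: kernel_measurable_l.
- by rewrite lee_fin sqr_ge0.
by rewrite lee_wpmul2r// lee_fin sqr_ge0.
Qed.

(** Turns the square of an operator into a double integral, to which Fubini's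
    theorem applies. *)
Lemma tensor_square (g : T2 -> R) : m2.-integrable setT (EFin \o g) ->
  (m2 \x m2).-integrable setT (EFin \o (fun p : T2 * T2 => g p.1 * g p.2)%R) /\
  \int[m2 \x m2]_p (g p.1 * g p.2)%:E = ((\int[m2]_t g t)%R ^+ 2)%:E.
Proof.
move=> ig.
have mg : measurable_fun setT g by apply/measurable_EFinP; case/integrableP: ig.
have mgg : measurable_fun setT (EFin \o (fun p : T2 * T2 => g p.1 * g p.2)%R).
  by apply/measurable_EFinP; apply: measurable_funM; exact: measurableT_comp.
have gfin : \int[m2]_t `|(g t)%:E| < +oo by case/integrableP: ig.
have igg : (m2 \x m2).-integrable setT
    (EFin \o (fun p : T2 * T2 => g p.1 * g p.2)%R).
  apply: (proj2 (integrable12ltyP m2 m2 mgg)) => /=.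
  under eq_integral => x _.
    under eq_integral do rewrite normrM EFinM.
    rewrite ge0_integralZl//; last first.
      by apply/measurable_EFinP; exact: measurableT_comp.
    over.
  rewrite ge0_integralZr//; last 2 first.
  - by apply/measurable_EFinP; exact: measurableT_comp.
  - exact: integral_ge0.
  by apply: lte_mul_pinfty => //; rewrite ?ge0_fin_numE//; exact: integral_ge0.
split=> //.
rewrite -(integral12_prod_meas1 igg) /fubini_F /=.
under eq_integral => x _.
  under eq_integral do rewrite EFinM.
  rewrite integralZl//.
  over.
have gfn : \int[m2]_t (g t)%:E \is a fin_num by exact: integrable_fin_num.
rewrite /Rintegral -(fineK gfn) integralZr//= expr2 EFinM.
by rewrite !fineK.
Qed.

(** Both sides are double integrals of f(t) f(s) against correlations of the
    kernels, and the correlations agree by hypothesis. The bound on the squares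
    makes the triple integral converge absolutely; finiteness of the right-hand
    side allows the difference of the two sides to be formed. *)
Lemma integral_kernel_op_identity (k1 k2 k3 : T1 -> T2 -> R) (f : T2 -> R)
    (M : R) :
  kernel_measurable k1 -> kernel_measurable k2 -> kernel_measurable k3 ->
  (forall z t, [/\ `|k1 z t| <= M, `|k2 z t| <= M & `|k3 z t| <= M]%R) ->
  (forall t, \int[m1]_z (k1 z t ^+ 2 + k2 z t ^+ 2 + k3 z t ^+ 2)%:E <= M%:E) ->
  (forall t s, \int[m1]_z
    (k1 z t * k1 z s + k2 z t * k2 z s - k3 z t * k3 z s)%:E = 0) ->
  m2.-integrable setT (EFin \o f) ->
  \int[m1]_z (kernel_op k3 f z ^+ 2)%:E < +oo ->
  \int[m1]_z (kernel_op k1 f z ^+ 2 + kernel_op k2 f z ^+ 2)%:E =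
  \int[m1]_z (kernel_op k3 f z ^+ 2)%:E.
Proof.
move=> mk1 mk2 mk3 kM kM2 k0 fi op3fin.
have mf : measurable_fun setT f by apply/measurable_EFinP; case/integrableP: fi.
pose g (z : T1) (t s : T2) : R :=
  (k1 z t * k1 z s + k2 z t * k2 z s - k3 z t * k3 z s)%R.
pose S (z : T1) (t : T2) : R := (k1 z t ^+ 2 + k2 z t ^+ 2 + k3 z t ^+ 2)%R.
pose H (q : T1 * (T2 * T2)) : R := (f q.2.1 * f q.2.2 * g q.1 q.2.1 q.2.2)%R.
have S0 z t : (0 <= S z t)%R by rewrite !addr_ge0// sqr_ge0.
have gS z t s : (`|g z t s| <= S z t + S z s)%R.
  have h (a b : R) : (`|a * b| <= (a ^+ 2 + b ^+ 2) / 2)%R.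
    have := sqr_ge0 (a - b); have := sqr_ge0 (a + b).
    by rewrite ler_norml => ? ?; apply/andP; split; nra.
  move: (h (k1 z t) (k1 z s)) (h (k2 z t) (k2 z s)) (h (k3 z t) (k3 z s)).
  have := S0 z t; have := S0 z s; rewrite /S => ? ?.
  rewrite !ler_norml => /andP[? ?] /andP[? ?] /andP[? ?].
  by apply/andP; split; rewrite /g; lra.
have mc (k : T1 -> T2 -> R) : kernel_measurable k ->
    measurable_fun [set: T1 * (T2 * T2)] (fun q => k q.1 q.2.1) /\
    measurable_fun [set: T1 * (T2 * T2)] (fun q => k q.1 q.2.2).
  move=> mk; split.
    apply: (measurableT_comp mk
      (g := (fun q : T1 * (T2 * T2) => (q.1, q.2.1)))).
    apply: measurable_fun_pair => //.
    exact: (measurableT_comp measurable_fst measurable_snd).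
  apply: (measurableT_comp mk
      (g := (fun q : T1 * (T2 * T2) => (q.1, q.2.2)))).
  apply: measurable_fun_pair => //.
  exact: (measurableT_comp measurable_snd measurable_snd).
have mH : measurable_fun setT (EFin \o H).
  apply/measurable_EFinP; apply: measurable_funM.
    apply: measurable_funM; apply: measurableT_comp => //.
      exact: (measurableT_comp measurable_fst measurable_snd).
    exact: (measurableT_comp measurable_snd measurable_snd).
  have [? ?] := mc _ mk1; have [? ?] := mc _ mk2; have [? ?] := mc _ mk3.
  by apply: measurable_funB;
    [apply: measurable_funD|]; exact: measurable_funM.
have mS t : measurable_fun setT (S^~ t).
  by do !apply: measurable_funD;
    apply: measurable_funX; exact: kernel_measurable_l.
have mg t s : measurable_fun setT (fun z => g z t s).
  by apply: measurable_funB; [apply: measurable_funD|];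
    apply: measurable_funM; exact: kernel_measurable_l.
have iS t : m1.-integrable setT (EFin \o S^~ t).
  apply/integrableP; split; first exact/measurable_EFinP.
  apply: le_lt_trans (ltry M); apply: le_trans (kM2 t).
  by apply: ge0_le_integralT => z //=; rewrite ger0_norm.
have ig t s : m1.-integrable setT (EFin \o (fun z => g z t s)).
  apply: (le_integrable measurableT _ _ (integrable_EFinD (iS t) (iS s))).
    exact/measurable_EFinP.
  by move=> z _ /=; rewrite lee_fin (le_trans (gS z t s))// ler_norm.
have [iff _] := tensor_square (integrable_norm fi).
pose m22 : {sigma_finite_measure set (T2 * T2)%type -> \bar R} :=
  product_sigma_finite m2 m2.
have iH : (m1 \x m22).-integrable setT (EFin \o H).
  apply: (proj2 (integrable21ltyP m1 m22 mH)) => /=.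
  have iff' := integrable_EFinZ (M + M) iff.
  apply: le_lt_trans (_ : _ <= \int[m2 \x m2]_p
     `|((M + M) * (`|f p.1| * `|f p.2|))%:E|) _; last first.
    by case/integrableP: iff'.
  apply: ge0_le_integralT => [p|p]; first exact: integral_ge0.
  apply: (@le_trans _ _ (\int[m1]_z ((`|f p.1| * `|f p.2|)%:E *
       ((S z p.1)%:E + (S z p.2)%:E)))).
    apply: ge0_le_integralT => z //.
    by rewrite /H /= -EFinD -EFinM lee_fin !normrM ler_wpM2l// mulr_ge0.
  rewrite ge0_integralZl//; last 2 first.
  - by apply: emeasurable_funD; exact/measurable_EFinP.
  - by move=> z _; rewrite -EFinD lee_fin addr_ge0.
  rewrite ge0_integralD//; last 4 first.
  - by move=> z _; rewrite lee_fin.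
  - exact/measurable_EFinP.
  - by move=> z _; rewrite lee_fin.
  - exact/measurable_EFinP.
  rewrite /= normrM [in leRHS]mulrC [in leRHS]EFinM lee_pmul//=.
  - by apply: adde_ge0; apply: integral_ge0 => z _; rewrite lee_fin.
  - by rewrite lee_fin ler_norm.
  - by rewrite (le_trans (leeD (kM2 _) (kM2 _)))// lee_fin ler_norm.
have opE z : \int[m2 \x m2]_p (H (z, p))%:E =
    (kernel_op k1 f z ^+ 2 + kernel_op k2 f z ^+ 2 - kernel_op k3 f z ^+ 2)%:E.
  have ikf (k : T1 -> T2 -> R) : kernel_measurable k ->
      (forall t, `|k z t| <= M)%R ->
      m2.-integrable setT (EFin \o (fun t => k z t * f t)%R).
    by move=> mk kb; exact: integrable_kernel kb fi.
  have [i1 e1] := tensor_square (ikf _ mk1 (fun t => let: And3 a _ _ := kM z t in a)).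
  have [i2 e2] := tensor_square (ikf _ mk2 (fun t => let: And3 _ a _ := kM z t in a)).
  have [i3 e3] := tensor_square (ikf _ mk3 (fun t => let: And3 _ _ a := kM z t in a)).
  rewrite EFinB EFinD -e1 -e2 -e3 -integralD_EFin// -integralB_EFin//; last first.
    exact: integrable_EFinD i1 i2.
  apply: eq_integral => p _; rewrite /H /g /=.
  by congr EFin; ring.
have iE : m1.-integrable setT (EFin \o (fun z =>
    (kernel_op k1 f z ^+ 2 + kernel_op k2 f z ^+ 2 - kernel_op k3 f z ^+ 2)%R)).
  rewrite [X in m1.-integrable _ X](_ : _ = fubini_F m22 (EFin \o H)).
    exact: integrable_fubini_F.
  by apply/funext => z; rewrite /fubini_F /= -opE.
have i3 : m1.-integrable setT (EFin \o (fun z => kernel_op k3 f z ^+ 2)%R).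
  apply/integrableP; split.
    apply/measurable_EFinP; apply: measurable_funX.
    exact: measurable_kernel_op.
  apply: le_lt_trans op3fin; apply: ge0_le_integralT => z //=.
  by rewrite ger0_norm// sqr_ge0.
transitivity (\int[m1]_z
    ((kernel_op k1 f z ^+ 2 + kernel_op k2 f z ^+ 2 - kernel_op k3 f z ^+ 2)%:E
     + (kernel_op k3 f z ^+ 2)%:E)).
  by apply: eq_integral => z _; rewrite -EFinD subrK.
rewrite integralD_EFin// -[RHS]add0e; congr (_ + _).
transitivity (\int[m1]_z \int[m22]_p (H (z, p))%:E).
  by apply: eq_integral => z _; rewrite opE.
rewrite (Fubini iH) /=; apply: integral0_eq => p _.
rewrite /H /=; under eq_integral do rewrite EFinM.
by rewrite (integralZl measurableT (ig p.1 p.2)) /g/= k0 mule0.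
Qed.

End kernel_operators.

(** * Derivatives and integrals on the line *)
Section derivatives.
Variable R : realType.
Implicit Types f g F : R -> R.

Lemma is_derive_funM f g (x a b : R) :
  is_derive x 1 f a -> is_derive x 1 g b ->
  is_derive x 1 (fun t => f t * g t) (f x * b + g x * a).
Proof. by move=> df dg; apply: is_derive_eq (is_deriveM df dg) _. Qed.

Lemma is_derive_funD f g (x a b : R) :
  is_derive x 1 f a -> is_derive x 1 g b ->
  is_derive x 1 (fun t => f t + g t) (a + b).
Proof. by move=> df dg; apply: is_derive_eq (is_deriveD df dg) _. Qed.

Lemma is_derive_funV f (x a : R) : f x != 0 ->
  is_derive x 1 f a -> is_derive x 1 (fun t => (f t)^-1) (- a / f x ^+ 2).
Proof.
by move=> fx0 df; apply: is_derive_eq (is_deriveV fx0 df) _; rewrite /GRing.scale/= mulNr mulrC mulNr.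
Qed.

Lemma is_derive_sub (a x : R) : is_derive x 1 (fun t : R => t - a) 1.
Proof.
have := is_deriveB (is_derive_id x (1 : R)) (is_derive_cst a x (1 : R)).
by rewrite subr0.
Qed.

Lemma is_derive_fun_comp f g (x a b : R) :
  is_derive (g x) 1 f a -> is_derive x 1 g b ->
  is_derive x 1 (fun t => f (g t)) (a * b).
Proof. exact: is_derive1_comp. Qed.

Lemma is_derive_comp_sub f (a x d : R) : is_derive (x - a) 1 f d ->
  is_derive x 1 (fun t => f (t - a)) d.
Proof.
move=> df; have := @is_derive1_comp _ f (fun t => t - a) _ _ _ df (is_derive_sub a x).
by rewrite mulr1.
Qed.

Lemma FTC2_R F f (a b : R) : a < b -> (forall x : R, is_derive x 1 F (f x)) ->
  continuous f ->
  (\int[lebesgue_measure]_(x in `[a, b]) (f x)%:E = (F b - F a)%:E)%E.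
Proof.
move=> ab dF cf.
have cF x : {for x, continuous F}.
  by apply: differentiable_continuous; apply/derivable1_diffP; case: (dF x).
rewrite (@continuous_FTC2 _ f F)//.
- exact: continuous_subspaceT.
- split=> [x _| |]; first by case: (dF x).
  + exact: cvg_at_right_filter (cF a).
  + exact: cvg_at_left_filter (cF b).
- by move=> x _; rewrite derive1E derive_val.
Qed.

Lemma ge0_integral_setT_le f (M : R) : measurable_fun setT f ->
  (forall x, 0 <= f x) ->
  (forall n : nat, \int[lebesgue_measure]_(x in `[(- n.+1%:R)%R, n.+1%:R%R]) (f x)%:E
     <= M%:E)%E ->
  (\int[lebesgue_measure]_x (f x)%:E <= M%:E)%E.
Proof.
move=> mf f0 fM.
have ndF : nondecreasing_seq (fun n : nat => `[- n.+1%:R, n.+1%:R]%classic : set R).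
  move=> m n mn; rewrite subsetEset => x /=; rewrite !in_itv/= => /andP[h1 h2].
  have : (m.+1%:R <= n.+1%:R :> R) by rewrite ler_nat ltnS.
  by move=> ?; apply/andP; split; lra.
have UT : \bigcup_n (`[- n.+1%:R, n.+1%:R]%classic : set R) = setT.
  apply/seteqP; split=> // x _.
  exists (Num.truncn `|x|) => //=; rewrite in_itv/= -ler_norml.
  exact/ltW/truncnS_gt.
have cv : (\int[lebesgue_measure]_(x in `[(- n.+1%:R)%R, n.+1%:R%R]) (f x)%:E
    @[n --> \oo] --> \int[lebesgue_measure]_x (f x)%:E)%E.
  rewrite -UT; apply: ge0_nondecreasing_set_cvg_integral => //.
  - by move=> i; apply/measurable_EFinP; exact: measurable_funTS.
  - by move=> i x _; rewrite lee_fin.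
rewrite -(cvg_lim _ cv)//; apply: lime_le; first by apply/cvg_ex; eexists; exact: cv.
exact: nearW.
Qed.

(** The fundamental theorem on [-n, n], then dominated convergence. *)
Lemma integral_derivative_eq0 F f : (forall x : R, is_derive x 1 F (f x)) ->
  continuous f -> lebesgue_measure.-integrable setT (EFin \o f) ->
  F n%:R @[n --> \oo] --> 0 -> F (- n%:R) @[n --> \oo] --> 0 ->
  (\int[lebesgue_measure]_x (f x)%:E = 0)%E.
Proof.
move=> dF cf fi F1 F2.
have mf : measurable_fun setT f by exact: continuous_measurable_fun.
pose D (n : nat) : set R := `[- n.+1%:R, n.+1%:R]%classic.
pose g (n : nat) := ((EFin \o f) \_ (D n))%E.
have gE n : (\int[lebesgue_measure]_x g n x = (F n.+1%:R - F (- n.+1%:R))%:E)%E.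
  rewrite -integral_mkcond FTC2_R// -subr_gt0 opprK addr_gt0//.
have c1 : (\int[lebesgue_measure]_x g n x @[n --> \oo] --> 0)%E.
  under eq_fun do rewrite gE.
  apply/cvg_EFin; first exact: nearW.
  rewrite -[X in _ --> X]subr0; apply: cvgB.
  - by rewrite (cvg_shiftS (fun n : nat => F n%:R)).
  - by rewrite (cvg_shiftS (fun n : nat => F (- n%:R))).
have c2 : (\int[lebesgue_measure]_x g n x @[n --> \oo] -->
    \int[lebesgue_measure]_x (f x)%:E)%E.
  apply: (@dominated_cvg _ _ _ lebesgue_measure setT measurableT g (EFin \o f)
     (abse \o (EFin \o f))).
  - move=> n; apply/(measurable_restrictT _ _).1; first exact: measurable_itv.
    by apply: measurable_funTS; exact/measurable_EFinP.
  - move=> x _; apply: cvg_near_cst; near=> n.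
    rewrite /g patchE ifT// inE /D /= in_itv/= -ler_norml.
    near: n; exists (Num.truncn `|x|) => // n /= hn.
    apply: (le_trans (ltW (truncnS_gt _))).
    by rewrite ler_nat.
  - by move=> x _.
  - exact: integrable_abse.
  - move=> n x _; rewrite /g patchE; case: ifPn => // _.
    by rewrite [leLHS](_ : _ = 0%E) ?abse_ge0//=; congr EFin; exact: normr0.
by apply: cvg_unique c2 c1.
Unshelve. all: by end_near.
Qed.

Lemma integral_cauchy_kernel_le (a e : R) : 0 < e ->
  (\int[lebesgue_measure]_x (e / ((x - a) ^+ 2 + e ^+ 2))%:E <= (pi : R)%:E)%E.
Proof.
move=> e0.
have pos x : 0 < (x - a) ^+ 2 + e ^+ 2 by rewrite ltr_wpDl ?sqr_ge0// exprn_gt0.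
have cf : continuous (fun x : R => e / ((x - a) ^+ 2 + e ^+ 2)).
  move=> x; apply: cvgM; first exact: cvg_cst.
  apply: cvgV; first by rewrite gt_eqF.
  apply: cvgD; last exact: cvg_cst.
  apply: (cvg_comp (fun z : R => z - a) (fun z => z ^+ 2)).
    by apply: cvgB; [exact: cvg_id|exact: cvg_cst].
  exact: exprn_continuous.
apply: ge0_integral_setT_le.
- exact: continuous_measurable_fun.
- by move=> x; rewrite divr_ge0 ?ltW.
have dF (x : R) : is_derive x 1 (fun x => atan ((x - a) / e))
    (e / ((x - a) ^+ 2 + e ^+ 2)).
  have d1 : is_derive x 1 (fun t => (t - a) / e) e^-1.
    apply: is_derive_eq
      (is_derive_funM (is_derive_sub a x) (is_derive_cst e^-1 x (1:R))) _.
    by rewrite mulr0 add0r mulr1.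
  have d2 := @is_derive_fun_comp atan _ x _ _ (is_derive1_atan _) d1.
  apply: is_derive_eq d2 _.
  field.
  by rewrite !gt_eqF//= ?andbT addrC.
move=> n; rewrite (FTC2_R _ dF cf); last first.
  by rewrite -subr_gt0 opprK addr_gt0.
rewrite lee_fin; have := atan_ltpi2 ((n.+1%:R - a) / e).
by have := atan_gtNpi2 ((- n.+1%:R - a) / e); lra.
Qed.

End derivatives.

(** * The regularized Beurling kernel *)
Section smooth_kernels.
Variable R : realType.
Implicit Types e x y a b : R.

(** Let z = x + iy, rho = |z|^2 + e^2 and u = conj(z)/rho. Then [rinv] is 1/rho,
    [smooth_re] + i [smooth_im] is conj(z)^2/rho^2 = - du/dz, [bump] is
    du/dconj(z), and [mixed] is the mixed second derivative of Im u. *)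
Definition rinv e x y : R := (x * x + y * y + e * e)^-1.
Definition smooth_re e x y : R := (x * x - y * y) * (rinv e x y * rinv e x y).
Definition smooth_im e x y : R := - (2 * x * y) * (rinv e x y * rinv e x y).
Definition bump e x y : R := e * e * (rinv e x y * rinv e x y).
Definition mixed e x y : R :=
  2 * x * (1 - 4 * (y * y) * rinv e x y) * (rinv e x y * rinv e x y).

Lemma rho_gt0 e x y : 0 < e -> 0 < x * x + y * y + e * e.
Proof. by move=> e0; nra. Qed.

Lemma rinv_gt0 e x y : 0 < e -> 0 < rinv e x y.
Proof. by move=> e0; rewrite invr_gt0 rho_gt0. Qed.

Lemma rinvE e x y : 0 < e -> (x * x + y * y + e * e) * rinv e x y = 1.
Proof. by move=> e0; rewrite mulfV// gt_eqF// rho_gt0. Qed.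

Lemma smooth_re_le e x y : 0 < e -> `|smooth_re e x y| <= rinv e x y.
Proof.
move=> e0; have r0 := rinv_gt0 x y e0; have rE := rinvE x y e0.
rewrite /smooth_re mulrA normrM (gtr0_norm r0) -[leRHS]mul1r ler_pM2r//.
rewrite normrM (gtr0_norm r0) -rE ler_pM2r// ler_norml; nra.
Qed.

Lemma smooth_im_le e x y : 0 < e -> `|smooth_im e x y| <= rinv e x y.
Proof.
move=> e0; have r0 := rinv_gt0 x y e0; have rE := rinvE x y e0.
rewrite /smooth_im mulrA normrM (gtr0_norm r0) -[leRHS]mul1r ler_pM2r//.
rewrite normrM (gtr0_norm r0) -[leRHS]rE ler_pM2r// ler_norml.
have := sqr_ge0 (x - y); have := sqr_ge0 (x + y); rewrite !expr2 => ? ?.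
by apply/andP; split; nra.
Qed.

Lemma bump_ge0 e x y : 0 <= bump e x y.
Proof. by rewrite /bump -!expr2 mulr_ge0// sqr_ge0. Qed.

Lemma bump_le e x y : 0 < e -> `|bump e x y| <= rinv e x y.
Proof.
move=> e0; have r0 := rinv_gt0 x y e0; have rE := rinvE x y e0.
rewrite ger0_norm ?bump_ge0// /bump mulrA -[leRHS]mul1r ler_pM2r//.
by rewrite -rE ler_pM2r//; nra.
Qed.

Lemma is_derive_rinv1 e x y : 0 < e ->
  is_derive x 1 (fun t => rinv e t y) (- (2 * x) * (rinv e x y * rinv e x y)).
Proof.
move=> e0; have r0 := rho_gt0 x y e0.
have d := is_derive_funD (is_derive_funD (is_derive_funM (is_derive_id x (1:R)) (is_derive_id x (1:R)))
  (is_derive_cst (y * y) x (1:R))) (is_derive_cst (e * e) x (1:R)).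
have d2 := @is_derive_funV _ _ _ _ _ d.
apply: is_derive_eq (d2 _) _; first by rewrite gt_eqF.
rewrite /rinv /cst/= !mulr1 !addr0.
by field; rewrite gt_eqF.
Qed.

Lemma rinv_swap e x y : rinv e x y = rinv e y x.
Proof. by rewrite /rinv [y * y + _]addrC. Qed.

Lemma is_derive_rinv2 e x y : 0 < e ->
  is_derive y 1 (fun t => rinv e x t) (- (2 * y) * (rinv e x y * rinv e x y)).
Proof.
move=> e0; have d := is_derive_rinv1 y x e0.
rewrite (_ : (fun t => rinv e x t) = (fun t => rinv e t x)); last first.
  by apply/funext => t; rewrite rinv_swap.
by apply: is_derive_eq d _; rewrite (rinv_swap e y x).
Qed.

(** The four first-order derivatives below are those of Re u = x rinv and of the
    derivatives of Im u = - y rinv, which are - smooth_re - bump in y and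
    - smooth_im in x. *)
Lemma is_derive_p1 e x y : 0 < e ->
  is_derive x 1 (fun t => t * rinv e t y) (bump e x y - smooth_re e x y).
Proof.
move=> e0; have rE := rinvE x y e0.
have d := is_derive_funM (is_derive_id x (1:R)) (is_derive_rinv1 x y e0).
apply: is_derive_eq d _; rewrite mulr1 /bump /smooth_re.
by rewrite -[X in _ + X]mulr1 -[X in _ + _ * X]rE; ring.
Qed.

Lemma is_derive_p2 e x y : 0 < e ->
  is_derive y 1 (fun t => x * rinv e x t) (smooth_im e x y).
Proof.
move=> e0.
have d := is_derive_funM (is_derive_cst x y (1:R)) (is_derive_rinv2 x y e0).
by apply: is_derive_eq d _; rewrite mulr0 addr0 /smooth_im /cst; ring.
Qed.

Lemma is_derive_q1 e x y : 0 < e ->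
  is_derive x 1 (fun t => - smooth_re e t y - bump e t y) (mixed e x y).
Proof.
move=> e0; have rE := rinvE x y e0.
have d1 := is_derive_rinv1 x y e0.
have dn := is_derive_funD (is_derive_cst (y * y - e * e) x (1:R))
  (is_derive_funM (is_derive_funM (is_derive_id x (1:R)) (is_derive_id x (1:R)))
    (is_derive_cst (-1 : R) x (1:R))).
have d := is_derive_funM dn (is_derive_funM d1 d1).
rewrite (_ : (fun t => _) = (fun t => (cst (y * y - e * e) t + id t * id t * cst (-1) t) *
   (rinv e t y * rinv e t y))); last first.
  by apply/funext => t; rewrite /smooth_re /bump /cst/=; ring.
apply: is_derive_eq d _; rewrite /cst/= /mixed.
move: rE; set r := rinv e x y => rE.
have -> : 1 - 4 * (y * y) * r = 2 * ((x * x + y * y + e * e) * r) - 4 * (y * y) * r - 1.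
  by rewrite rE; ring.
ring.
Qed.

Lemma is_derive_q2 e x y : 0 < e ->
  is_derive y 1 (fun t => - smooth_im e x t) (mixed e x y).
Proof.
move=> e0; have rE := rinvE x y e0.
have d1 := is_derive_rinv2 x y e0.
have dn := is_derive_funM (is_derive_cst (2 * x) y (1:R)) (is_derive_id y (1:R)).
have d := is_derive_funM dn (is_derive_funM d1 d1).
rewrite (_ : (fun t => _) = (fun t => (cst (2 * x) t * id t) *
   (rinv e x t * rinv e x t))); last first.
  by apply/funext => t; rewrite /smooth_im /cst/=; ring.
apply: is_derive_eq d _; rewrite /cst/= /mixed.
ring.
Qed.

End smooth_kernels.

Section plane_integrals.
Variable R : realType.
Local Notation plane := (plane R).
Local Notation dA := (@lebesgue_measure R \x @lebesgue_measure R)%E.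
Implicit Types e x y a b : R.

Lemma measurable_funV_ge0 d (T : measurableType d) (f : T -> R) :
  (forall t, 0 <= f t) -> measurable_fun setT f ->
  measurable_fun setT (fun t => (f t)^-1).
Proof.
move=> f0 mf; rewrite (_ : (fun t => _) = (fun t => f t `^ (-1))).
  exact: (measurableT_comp (measurable_powR (-1)) mf).
by apply/funext => t; rewrite powR_inv1.
Qed.

Lemma measurable_fun_opp d (T : measurableType d) (f : T -> R) :
  measurable_fun setT f -> measurable_fun setT (fun t => - f t).
Proof. exact: measurableT_comp. Qed.

Lemma measurable_rinv d (T : measurableType d) (f g : T -> R) e :
  measurable_fun setT f -> measurable_fun setT g ->
  measurable_fun setT (fun t => rinv e (f t) (g t)).
Proof.
move=> mf mg; apply: measurable_funV_ge0.
  by move=> t; rewrite -!expr2 !addr_ge0// sqr_ge0.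
by do !apply: measurable_funD => //; exact: measurable_funM.
Qed.

Lemma measurable_smooth_re d (T : measurableType d) (f g : T -> R) e :
  measurable_fun setT f -> measurable_fun setT g ->
  measurable_fun setT (fun t => smooth_re e (f t) (g t)).
Proof.
move=> mf mg; have mr := measurable_rinv e mf mg.
by apply: measurable_funM; [apply: measurable_funB|]; exact: measurable_funM.
Qed.

Lemma measurable_smooth_im d (T : measurableType d) (f g : T -> R) e :
  measurable_fun setT f -> measurable_fun setT g ->
  measurable_fun setT (fun t => smooth_im e (f t) (g t)).
Proof.
move=> mf mg; have mr := measurable_rinv e mf mg.
apply: measurable_funM; last exact: measurable_funM.
apply: measurableT_comp => //; apply: measurable_funM => //.
exact: measurable_funM.
Qed.

Lemma measurable_bump d (T : measurableType d) (f g : T -> R) e :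
  measurable_fun setT f -> measurable_fun setT g ->
  measurable_fun setT (fun t => bump e (f t) (g t)).
Proof.
move=> mf mg; have mr := measurable_rinv e mf mg.
by apply: measurable_funM => //; exact: measurable_funM.
Qed.

Lemma measurable_mixed d (T : measurableType d) (f g : T -> R) e :
  measurable_fun setT f -> measurable_fun setT g ->
  measurable_fun setT (fun t => mixed e (f t) (g t)).
Proof.
move=> mf mg; have mr := measurable_rinv e mf mg.
apply: measurable_funM; last exact: measurable_funM.
apply: measurable_funM; first exact: measurable_funM.
apply: measurable_funB => //; apply: measurable_funM => //.
by apply: measurable_funM => //; exact: measurable_funM.
Qed.

Lemma measurable_fst_sub a : measurable_fun [set: plane] (fun z => z.1 - a : R).
Proof. exact: measurable_funB. Qed.

Lemma measurable_snd_sub a : measurable_fun [set: plane] (fun z => z.2 - a : R).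
Proof. exact: measurable_funB. Qed.

Definition cauchy_kernel e a x : R := e / ((x - a) ^+ 2 + e ^+ 2).

Lemma measurable_cauchy_kernel e a : measurable_fun setT (cauchy_kernel e a).
Proof.
apply: measurable_funM => //; apply: measurable_funV_ge0.
  by move=> t; rewrite addr_ge0// sqr_ge0.
by apply: measurable_funD => //; apply: measurable_funX; exact: measurable_funB.
Qed.

(** Domination by a product of one-variable kernels, which have explicit
    primitives: (x^2 + e^2) (y^2 + e^2) <= (x^2 + y^2 + e^2)^2. *)
Lemma bump_le_cauchy e x y a b : 0 < e ->
  bump e (x - a) (y - b) <= cauchy_kernel e a x * cauchy_kernel e b y.
Proof.
move=> e0; rewrite /cauchy_kernel /bump /rinv.
move: (x - a) (y - b) => u v; have r0 := rho_gt0 u v e0.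
have u0 : 0 < u ^+ 2 + e ^+ 2 by rewrite ltr_wpDl ?sqr_ge0// exprn_gt0.
have v0 : 0 < v ^+ 2 + e ^+ 2 by rewrite ltr_wpDl ?sqr_ge0// exprn_gt0.
rewrite [leRHS]mulrACA -!invfM; apply: ler_wpM2l; first by rewrite mulr_ge0 ?ltW.
rewrite lef_pV2 ?posrE ?mulr_gt0//.
have := sqr_ge0 (u ^+ 2 - v ^+ 2); have := sqr_ge0 u; have := sqr_ge0 v.
have := sqr_ge0 e; rewrite -!expr2.
move: (u ^+ 2) (v ^+ 2) (e ^+ 2) => U V E ? ? ?; nra.
Qed.

Lemma integral_bump_le e a b : 0 < e ->
  (\int[dA]_z (bump e (z.1 - a) (z.2 - b))%:E <= ((pi : R) ^+ 2)%:E)%E.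
Proof.
move=> e0.
have c0 u x : 0 <= cauchy_kernel e u x.
  by rewrite divr_ge0 ?(ltW e0)// addr_ge0// sqr_ge0.
have mc u := measurable_cauchy_kernel e u.
apply: (@le_trans _ _
   (\int[dA]_z (cauchy_kernel e a z.1 * cauchy_kernel e b z.2)%:E)%E).
  apply: ge0_le_integralT => z; first by rewrite lee_fin bump_ge0.
  by rewrite lee_fin bump_le_cauchy.
rewrite [leLHS](fubini_tonelli1 (m1 := lebesgue_measure) (m2 := lebesgue_measure)
  (fun z : plane => (cauchy_kernel e a z.1 * cauchy_kernel e b z.2)%:E));
  last 2 first.
- apply/measurable_EFinP; apply: measurable_funM.
    exact: (measurableT_comp (mc a) measurable_fst).
  exact: (measurableT_comp (mc b) measurable_snd).
- by move=> z; rewrite lee_fin mulr_ge0.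
rewrite /fubini_F /=.
under eq_integral => x _.
  under eq_integral do rewrite EFinM.
  rewrite ge0_integralZl//; last 3 first.
  - by apply/measurable_EFinP; exact: mc.
  - by move=> y _; rewrite lee_fin.
  - by rewrite lee_fin.
  over.
rewrite ge0_integralZr//; last 3 first.
- by apply/measurable_EFinP; exact: mc.
- by move=> y _; rewrite lee_fin.
- by apply: integral_ge0 => y _; rewrite lee_fin.
rewrite expr2 EFinM lee_pmul//; try by apply: integral_ge0 => y _; rewrite lee_fin.
  exact: integral_cauchy_kernel_le.
exact: integral_cauchy_kernel_le.
Qed.

Lemma integrable_cauchy_kernel e a : 0 < e ->
  lebesgue_measure.-integrable setT (EFin \o cauchy_kernel e a).
Proof.
move=> e0; apply/integrableP; split.
  by apply/measurable_EFinP; exact: measurable_cauchy_kernel.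
apply: le_lt_trans (ltry (pi : R)); apply: le_trans (integral_cauchy_kernel_le a e0).
apply: ge0_le_integralT => x //=; rewrite lee_fin ger0_norm//.
by rewrite divr_ge0 ?(ltW e0)// addr_ge0// sqr_ge0.
Qed.

Lemma integrable_bump e a b : 0 < e ->
  dA.-integrable [set: plane] (EFin \o (fun z => bump e (z.1 - a) (z.2 - b))).
Proof.
move=> e0; apply/integrableP; split.
  apply/measurable_EFinP; apply: measurable_bump.
    exact: measurable_fst_sub.
  exact: measurable_snd_sub.
apply: le_lt_trans (ltry ((pi : R) ^+ 2)); apply: le_trans (integral_bump_le a b e0).
by apply: ge0_le_integralT => x //=; rewrite lee_fin ger0_norm// bump_ge0.
Qed.

End plane_integrals.

Lemma cvg0_of_decay (R : realType) (F : R -> R) (M C : R) :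
  (forall x, `|F x| * (`|x| - M) <= C) ->
  F n%:R @[n --> \oo] --> 0 /\ F (- n%:R) @[n --> \oo] --> 0.
Proof.
move=> FC.
have C0 : 0 <= C.
  have := FC (`|M|); rewrite normr_id => h; apply: le_trans h.
  by rewrite mulr_ge0// subr_ge0 ler_norm.
suff H (s : nat -> R) : (forall n, `|s n| = n%:R) -> F (s n) @[n --> \oo] --> 0.
  by split; apply: H => n; rewrite ?normrN normr_nat.
move=> sE; apply/cvgrPdist_lt => eps eps0; near=> n.
rewrite sub0r normrN.
have hn : M + C / eps < n%:R.
  near: n; exists (Num.truncn `|M + C / eps|).+1 => // n /= hn.
  apply: le_lt_trans (ler_norm _) _; apply: lt_le_trans (truncnS_gt _) _.
  by rewrite ler_nat.
have h1 : C < eps * (n%:R - M).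
  have : C / eps < n%:R - M by lra.
  by rewrite ltr_pdivrMr// mulrC.
have h0 : 0 < n%:R - M.
  have : 0 <= C / eps by rewrite divr_ge0// ltW.
  by lra.
have := FC (s n); rewrite sE => h2.
by rewrite -(ltr_pM2r h0); exact: le_lt_trans h1.
Unshelve. all: by end_near.
Qed.

Lemma continuous_is_derive (R : realType) (F f : R -> R) :
  (forall x : R, is_derive x 1 F (f x)) -> continuous F.
Proof.
move=> dF x.
by apply: differentiable_continuous; apply/derivable1_diffP; case: (dF x).
Qed.

(** * The null Lagrangian *)
Section null_lagrangian.
Variables (R : realType) (e : R).
Hypothesis e0 : 0 < e.
Local Notation plane := (plane R).
Local Notation dA := (@lebesgue_measure R \x @lebesgue_measure R)%E.
Implicit Types x y a b c d : R.

Ltac measurability := repeat match goal with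
  | |- measurable_fun _ (fun t => _ + _) => apply: measurable_funD
  | |- measurable_fun _ (fun t => _ * _) => apply: measurable_funM
  | |- measurable_fun _ (fun t => - _) => apply: measurable_fun_opp
  | H : forall u v, measurable_fun _ _ |- _ => exact: H
  | H : forall u, measurable_fun _ _ |- _ => exact: H
  | |- measurable_fun _ fst => exact: measurable_fst
  | |- measurable_fun _ snd => exact: measurable_snd
  | |- measurable_fun _ (fun t => _) => exact: measurable_cst
  end.

Lemma rinv_xx x y : 0 <= x * x * rinv e x y <= 1.
Proof.
have r0 := rinv_gt0 x y e0; rewrite mulr_ge0 ?(ltW r0)//= -?expr2 ?sqr_ge0//.
rewrite -(rinvE x y e0) ler_pM2r//; nra.
Qed.

Lemma rinv_yy x y : 0 <= y * y * rinv e x y <= 1.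
Proof. by rewrite rinv_swap rinv_xx. Qed.

Lemma rinv_x x y : `|x| * rinv e x y <= e^-1.
Proof.
have r0 := rinv_gt0 x y e0; rewrite -(ler_pM2l e0) mulfV ?gt_eqF//.
rewrite mulrA -(rinvE x y e0) ler_pM2r//.
have h : x * x = `|x| * `|x| by rewrite -!expr2 real_normK// num_real.
by rewrite h; have := sqr_ge0 (e - `|x|); rewrite expr2; nra.
Qed.

Lemma mixed_term_le x y u v :
  `|x * rinv e x y * mixed e u v| <=
    5 * (rinv e x y * rinv e x y + rinv e u v * rinv e u v).
Proof.
have r0 := rinv_gt0 x y e0; have s0 := rinv_gt0 u v e0.
have /andP[_ xr] := rinv_xx x y; have /andP[_ us] := rinv_xx u v.
have /andP[v0 vs] := rinv_yy u v.
rewrite /mixed; move: r0 s0 xr us v0 vs.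
set r := rinv e x y; set s := rinv e u v => r0 s0 xr us v0 vs.
have -> : x * r * (2 * u * (1 - 4 * (v * v) * s) * (s * s)) =
  (2 * s * (1 - 4 * (v * v * s))) * ((x * r) * (u * s)) by ring.
rewrite normrM.
have h1 : `|2 * s * (1 - 4 * (v * v * s))| <= 6 * s.
  by rewrite ler_norml; apply/andP; split; nra.
have h2 : `|(x * r) * (u * s)| <= (r + s) / 2.
  have : (x * r) * (x * r) <= r by nra.
  have : (u * s) * (u * s) <= s by nra.
  move: (x * r) (u * s) => X U ? ?.
  have := sqr_ge0 (X - U); have := sqr_ge0 (X + U); rewrite !expr2 => ? ?.
  by rewrite ler_norml; apply/andP; split; nra.
apply: le_trans (ler_pM (normr_ge0 _) (normr_ge0 _) h1 h2) _.
have := sqr_ge0 (r - s); rewrite expr2; nra.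
Qed.

Lemma prod_term_le (z w r s : R) : 0 <= r -> 0 <= s ->
  `|z| <= 2 * r -> `|w| <= 2 * s -> `|z * w| <= 2 * (r * r + s * s).
Proof.
move=> r0 s0 zr ws; rewrite normrM.
apply: le_trans (ler_pM (normr_ge0 _) (normr_ge0 _) zr ws) _.
have := sqr_ge0 (r - s); rewrite expr2; nra.
Qed.

(** With u_ab(z) = u(z - (a, b)), the vector field ([potx], - [poty]) has
    divergence [divx] - [divy], which is the symmetrization in (a, b) and (c, d)
    of the Jacobian
    (Re u_ab)_x (Im u_cd)_y - (Re u_ab)_y (Im u_cd)_x. *)
Let potx a b c d x y : R :=
  ((x - a) * rinv e (x - a) (y - b) *
     (- smooth_re e (x - c) (y - d) - bump e (x - c) (y - d)) +
   (x - c) * rinv e (x - c) (y - d) *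
     (- smooth_re e (x - a) (y - b) - bump e (x - a) (y - b))) / 2.

Let divx a b c d x y : R :=
  ((x - a) * rinv e (x - a) (y - b) * mixed e (x - c) (y - d) +
   (- smooth_re e (x - c) (y - d) - bump e (x - c) (y - d)) *
     (bump e (x - a) (y - b) - smooth_re e (x - a) (y - b)) +
   ((x - c) * rinv e (x - c) (y - d) * mixed e (x - a) (y - b) +
   (- smooth_re e (x - a) (y - b) - bump e (x - a) (y - b)) *
     (bump e (x - c) (y - d) - smooth_re e (x - c) (y - d)))) / 2.

Let poty a b c d x y : R :=
  ((x - a) * rinv e (x - a) (y - b) * (- smooth_im e (x - c) (y - d)) +
   (x - c) * rinv e (x - c) (y - d) * (- smooth_im e (x - a) (y - b))) / 2.

Let divy a b c d x y : R :=
  ((x - a) * rinv e (x - a) (y - b) * mixed e (x - c) (y - d) +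
   (- smooth_im e (x - c) (y - d)) * smooth_im e (x - a) (y - b) +
   ((x - c) * rinv e (x - c) (y - d) * mixed e (x - a) (y - b) +
   (- smooth_im e (x - a) (y - b)) * smooth_im e (x - c) (y - d))) / 2.

Let is_derive_potx a b c d x y :
  is_derive x 1 (fun t => potx a b c d t y) (divx a b c d x y).
Proof.
have P u v := @is_derive_comp_sub _ (fun t => t * rinv e t (y - v)) u x _
  (is_derive_p1 (x - u) (y - v) e0).
have Q u v := @is_derive_comp_sub _
  (fun t => - smooth_re e t (y - v) - bump e t (y - v)) u x _
  (is_derive_q1 (x - u) (y - v) e0).
have D := is_derive_funM
  (is_derive_funD (is_derive_funM (P a b) (Q c d))
                  (is_derive_funM (P c d) (Q a b)))
  (is_derive_cst (2^-1 : R) x (1 : R)).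
by apply: is_derive_eq D _; rewrite /cst /divx /=; ring.
Qed.

Let is_derive_poty a b c d x y :
  is_derive y 1 (fun t => poty a b c d x t) (divy a b c d x y).
Proof.
have P u v := @is_derive_comp_sub _ (fun t => (x - u) * rinv e (x - u) t) v y _
  (is_derive_p2 (x - u) (y - v) e0).
have Q u v := @is_derive_comp_sub _ (fun t => - smooth_im e (x - u) t) v y _
  (is_derive_q2 (x - u) (y - v) e0).
have D := is_derive_funM
  (is_derive_funD (is_derive_funM (P a b) (Q c d))
                  (is_derive_funM (P c d) (Q a b)))
  (is_derive_cst (2^-1 : R) y (1 : R)).
by apply: is_derive_eq D _; rewrite /cst /divy /=; ring.
Qed.

Let rr a b x y : R := rinv e (x - a) (y - b) * rinv e (x - a) (y - b).

Let divx_le a b c d x y :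
  `|divx a b c d x y| <= 10 * (rr a b x y + rr c d x y).
Proof.
rewrite /divx /rr; move: (x - a) (y - b) (x - c) (y - d) => X Y U V.
have r0 := rinv_gt0 X Y e0; have s0 := rinv_gt0 U V e0.
have h1 := mixed_term_le X Y U V; have h2 := mixed_term_le U V X Y.
have kb u v : `|- smooth_re e u v - bump e u v| <= 2 * rinv e u v.
  rewrite (le_trans (ler_normB _ _))// normrN.
  by have := smooth_re_le u v e0; have := bump_le u v e0; lra.
have bk u v : `|bump e u v - smooth_re e u v| <= 2 * rinv e u v.
  rewrite (le_trans (ler_normB _ _))//.
  by have := smooth_re_le u v e0; have := bump_le u v e0; lra.
have h3 := prod_term_le (ltW s0) (ltW r0) (kb U V) (bk X Y).
have h4 := prod_term_le (ltW r0) (ltW s0) (kb X Y) (bk U V).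
rewrite normrM (@ger0_norm _ 2^-1)//.
rewrite ler_pdivrMr//.
apply: le_trans (ler_normD _ _) _.
apply: le_trans (lerD (ler_normD _ _) (ler_normD _ _)) _.
by have := mulr_gt0 r0 r0; have := mulr_gt0 s0 s0; lra.
Qed.

Let divy_le a b c d x y :
  `|divy a b c d x y| <= 10 * (rr a b x y + rr c d x y).
Proof.
rewrite /divy /rr; move: (x - a) (y - b) (x - c) (y - d) => X Y U V.
have r0 := rinv_gt0 X Y e0; have s0 := rinv_gt0 U V e0.
have h1 := mixed_term_le X Y U V; have h2 := mixed_term_le U V X Y.
have kb u v : `|smooth_im e u v| <= 2 * rinv e u v.
  by have := smooth_im_le u v e0; have := rinv_gt0 u v e0; lra.
have kbN u v : `|- smooth_im e u v| <= 2 * rinv e u v by rewrite normrN.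
have h3 := prod_term_le (ltW s0) (ltW r0) (kbN U V) (kb X Y).
have h4 := prod_term_le (ltW r0) (ltW s0) (kbN X Y) (kb U V).
rewrite normrM (@ger0_norm _ 2^-1)//.
rewrite ler_pdivrMr//.
apply: le_trans (ler_normD _ _) _.
apply: le_trans (lerD (ler_normD _ _) (ler_normD _ _)) _.
by have := mulr_gt0 r0 r0; have := mulr_gt0 s0 s0; lra.
Qed.

(** The products in [potx] and [poty] have a bounded factor and a factor of the
    order of the inverse distance, hence vanish at both ends of each line. *)
Lemma symmetric_product_decay (p P q Q r t da dc s : R) :
  0 <= r -> 0 <= t -> `|p| <= e^-1 -> `|P| <= e^-1 ->
  `|q| <= 2 * r -> `|Q| <= 2 * t -> da * r <= e^-1 -> dc * t <= e^-1 ->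
  s <= da -> s <= dc -> `|(p * Q + P * q) / 2| * s <= 2 * (e^-1 * e^-1).
Proof.
move=> r0 t0 pe Pe qr Qt ar ct sa sc.
have i0 : 0 < e^-1 by rewrite invr_gt0.
have [s0|s0] := leP s 0.
  by rewrite (@le_trans _ _ 0)// ?mulr_ge0_le0// mulr_ge0// mulr_ge0// ltW.
rewrite normrM (@ger0_norm _ 2^-1)// mulrAC ler_pdivrMr//.
have h1 := ler_pM (normr_ge0 p) (normr_ge0 Q) pe Qt.
have h2 := ler_pM (normr_ge0 P) (normr_ge0 q) Pe qr.
have h3 : `|p * Q + P * q| <= e^-1 * (2 * t) + e^-1 * (2 * r).
  by rewrite (le_trans (ler_normD _ _))// !normrM lerD.
apply: le_trans (ler_wpM2r (ltW s0) h3) _.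
have h4 : r * s <= e^-1 by apply: le_trans ar; rewrite mulrC ler_wpM2r.
have h5 : t * s <= e^-1 by apply: le_trans ct; rewrite mulrC ler_wpM2r.
rewrite (_ : _ * s = e^-1 * 2 * (t * s + r * s)); last by ring.
rewrite [leRHS](_ : _ = e^-1 * 2 * (e^-1 + e^-1)); last by ring.
by rewrite ler_wpM2l ?lerD// mulr_ge0// ltW.
Qed.

Lemma rinv_y x y : `|y| * rinv e x y <= e^-1.
Proof. by rewrite rinv_swap rinv_x. Qed.

Let potx_decay a b c d y x :
  `|potx a b c d x y| * (`|x| - (`|a| + `|c|)) <= 2 * (e^-1 * e^-1).
Proof.
have r0 := rinv_gt0 (x - a) (y - b) e0; have t0 := rinv_gt0 (x - c) (y - d) e0.
have p_le u v : `|u * rinv e u v| <= e^-1.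
  by rewrite normrM (gtr0_norm (rinv_gt0 _ _ e0)) rinv_x.
have q_le u v : `|- smooth_re e u v - bump e u v| <= 2 * rinv e u v.
  rewrite (le_trans (ler_normB _ _))// normrN.
  by have := smooth_re_le u v e0; have := bump_le u v e0; lra.
apply: (@symmetric_product_decay _ _ _ _ (rinv e (x - a) (y - b)) (rinv e (x - c) (y - d))
  `|x - a| `|x - c|) => //; try exact: ltW; try exact: rinv_x.
- by have := ler_dist_dist x a; have := normr_ge0 c; rewrite ler_norml => ? /andP[]; lra.
- by have := ler_dist_dist x c; have := normr_ge0 a; rewrite ler_norml => ? /andP[]; lra.
Qed.

Let poty_decay a b c d x y :
  `|poty a b c d x y| * (`|y| - (`|b| + `|d|)) <= 2 * (e^-1 * e^-1).
Proof.
have r0 := rinv_gt0 (x - a) (y - b) e0; have t0 := rinv_gt0 (x - c) (y - d) e0.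
have p_le u v : `|u * rinv e u v| <= e^-1.
  by rewrite normrM (gtr0_norm (rinv_gt0 _ _ e0)) rinv_x.
have q_le u v : `|- smooth_im e u v| <= 2 * rinv e u v.
  rewrite normrN; have := smooth_im_le u v e0; have := rinv_gt0 u v e0; lra.
apply: (@symmetric_product_decay _ _ _ _ (rinv e (x - a) (y - b)) (rinv e (x - c) (y - d))
  `|y - b| `|y - d|) => //; try exact: ltW; try exact: rinv_y.
- by have := ler_dist_dist y b; have := normr_ge0 d; rewrite ler_norml => ? /andP[]; lra.
- by have := ler_dist_dist y d; have := normr_ge0 b; rewrite ler_norml => ? /andP[]; lra.
Qed.

Let continuous_rinvx a b y : continuous (fun x => rinv e (x - a) (y - b)).
Proof.
apply: continuous_is_derive => x.
exact: (@is_derive_comp_sub _ (fun t => rinv e t (y - b)) a x _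
  (is_derive_rinv1 (x - a) (y - b) e0)).
Qed.

Let continuous_rinvy a b x : continuous (fun y => rinv e (x - a) (y - b)).
Proof.
apply: continuous_is_derive => y.
exact: (@is_derive_comp_sub _ (fun t => rinv e (x - a) t) b y _
  (is_derive_rinv2 (x - a) (y - b) e0)).
Qed.

Let cont_add (f g : R -> R) : continuous f -> continuous g ->
  continuous (fun t => f t + g t).
Proof. by move=> cf cg t; apply: cvgD; [exact: cf|exact: cg]. Qed.

Let cont_mul (f g : R -> R) : continuous f -> continuous g ->
  continuous (fun t => f t * g t).
Proof. by move=> cf cg t; apply: cvgM; [exact: cf|exact: cg]. Qed.

Let cont_opp (f : R -> R) : continuous f -> continuous (fun t => - f t).
Proof. by move=> cf t; apply: cvgN; exact: cf. Qed.

Let cont_cst (a : R) : continuous (fun _ : R => a).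
Proof. by move=> t; exact: cvg_cst. Qed.

Let cont_id : continuous (fun t : R => t).
Proof. by move=> t; exact: cvg_id. Qed.

Ltac continuity h := repeat match goal with
  | |- continuous (fun t => rinv _ _ _) => exact: h
  | |- continuous (fun t => _ + _) => apply: cont_add
  | |- continuous (fun t => _ * _) => apply: cont_mul
  | |- continuous (fun t => - _) => apply: cont_opp
  | |- continuous (fun t => t) => exact: cont_id
  | |- continuous (fun t => _) => exact: cont_cst
  end.

Let continuous_divx a b c d y : continuous (fun x => divx a b c d x y).
Proof.
rewrite /divx /smooth_re /bump /mixed.
continuity continuous_rinvx.
Qed.

Let continuous_divy a b c d x : continuous (fun y => divy a b c d x y).
Proof.
rewrite /divy /smooth_im /bump /mixed.
continuity continuous_rinvy.
Qed.

Let rr_bump a b x y : rr a b x y = e ^- 2 * bump e (x - a) (y - b).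
Proof. by rewrite /rr /bump; field; rewrite gt_eqF. Qed.

Lemma rinv_sqr_le x y :
  rinv e x y * rinv e x y <= e ^- 3 * (e / (x ^+ 2 + e ^+ 2)).
Proof.
have u0 : 0 < x ^+ 2 + e ^+ 2 by rewrite ltr_wpDl ?sqr_ge0// exprn_gt0.
have -> : e ^- 3 * (e / (x ^+ 2 + e ^+ 2)) = (e * e)^-1 * (x ^+ 2 + e ^+ 2)^-1.
  by field; rewrite !gt_eqF.
have r0 := rho_gt0 x y e0.
apply: ler_pM; rewrite ?invr_ge0 ?(ltW r0)//; rewrite lef_pV2 ?posrE ?mulr_gt0//.
  by rewrite lerDr -!expr2 addr_ge0// sqr_ge0.
by rewrite !expr2 lerD2r lerDl -expr2 sqr_ge0.
Qed.

Let rr_cauchyx a b x y : rr a b x y <= e ^- 3 * cauchy_kernel e a x.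
Proof. exact: rinv_sqr_le. Qed.

Let rr_cauchyy a b x y : rr a b x y <= e ^- 3 * cauchy_kernel e b y.
Proof. by rewrite /rr rinv_swap; exact: rinv_sqr_le. Qed.

Let integrable_divx1 a b c d y :
  lebesgue_measure.-integrable setT (EFin \o (fun x => divx a b c d x y)).
Proof.
have i1 := integrable_EFinZ (10 * e ^- 3) (integrable_EFinD
  (integrable_cauchy_kernel a e0) (integrable_cauchy_kernel c e0)).
apply: (le_integrable measurableT _ _ i1).
  apply/measurable_EFinP; apply: continuous_measurable_fun.
  exact: continuous_divx.
move=> x _ /=; rewrite lee_fin (le_trans (divx_le _ _ _ _ _ _))//.
rewrite (le_trans _ (ler_norm _))// -mulrA ler_wpM2l// mulrDr.
exact: lerD (rr_cauchyx a b x y) (rr_cauchyx c d x y).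
Qed.

Let integrable_divy1 a b c d x :
  lebesgue_measure.-integrable setT (EFin \o (fun y => divy a b c d x y)).
Proof.
have i1 := integrable_EFinZ (10 * e ^- 3) (integrable_EFinD
  (integrable_cauchy_kernel b e0) (integrable_cauchy_kernel d e0)).
apply: (le_integrable measurableT _ _ i1).
  apply/measurable_EFinP; apply: continuous_measurable_fun.
  exact: continuous_divy.
move=> y _ /=; rewrite lee_fin (le_trans (divy_le _ _ _ _ _ _))//.
rewrite (le_trans _ (ler_norm _))// -mulrA ler_wpM2l// mulrDr.
exact: lerD (rr_cauchyy a b x y) (rr_cauchyy c d x y).
Qed.

Let integral_divx1 a b c d y :
  (\int[lebesgue_measure]_x (divx a b c d x y)%:E = 0)%E.
Proof.
have [c1 c2] := cvg0_of_decay (potx_decay a b c d y).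
apply: (integral_derivative_eq0 (F := fun x => potx a b c d x y)
  (f := fun x => divx a b c d x y)); [|exact: continuous_divx|
  exact: integrable_divx1|exact: c1|exact: c2].
by move=> x; exact: is_derive_potx.
Qed.

Let integral_divy1 a b c d x :
  (\int[lebesgue_measure]_y (divy a b c d x y)%:E = 0)%E.
Proof.
have [c1 c2] := cvg0_of_decay (poty_decay a b c d x).
apply: (integral_derivative_eq0 (F := fun y => poty a b c d x y)
  (f := fun y => divy a b c d x y)); [|exact: continuous_divy|
  exact: integrable_divy1|exact: c1|exact: c2].
by move=> y; exact: is_derive_poty.
Qed.

Let integrable_divx a b c d :
  dA.-integrable [set: plane] (EFin \o (fun z => divx a b c d z.1 z.2)).
Proof.
have i1 := integrable_EFinZ (10 * e ^- 2) (integrable_EFinD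
  (integrable_bump a b e0) (integrable_bump c d e0)).
have m1 u := @measurable_fst_sub R u; have m2 u := @measurable_snd_sub R u.
apply: (le_integrable measurableT _ _ i1).
  have := (fun u v => measurable_rinv e (m1 u) (m2 v)).
  have := (fun u v => measurable_smooth_re e (m1 u) (m2 v)).
  have := (fun u v => measurable_bump e (m1 u) (m2 v)).
  have := (fun u v => measurable_mixed e (m1 u) (m2 v)).
  move=> ? ? ? ?; apply/measurable_EFinP; rewrite /divx.
  measurability.
move=> z _ /=; rewrite lee_fin (le_trans (divx_le _ _ _ _ _ _))//.
by rewrite (le_trans _ (ler_norm _))// -mulrA ler_wpM2l// mulrDr !rr_bump.
Qed.

Let integrable_divy a b c d :
  dA.-integrable [set: plane] (EFin \o (fun z => divy a b c d z.1 z.2)).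
Proof.
have i1 := integrable_EFinZ (10 * e ^- 2) (integrable_EFinD
  (integrable_bump a b e0) (integrable_bump c d e0)).
have m1 u := @measurable_fst_sub R u; have m2 u := @measurable_snd_sub R u.
apply: (le_integrable measurableT _ _ i1).
  have := (fun u v => measurable_rinv e (m1 u) (m2 v)).
  have := (fun u v => measurable_smooth_im e (m1 u) (m2 v)).
  have := (fun u v => measurable_mixed e (m1 u) (m2 v)).
  move=> ? ? ?; apply/measurable_EFinP; rewrite /divy.
  measurability.
move=> z _ /=; rewrite lee_fin (le_trans (divy_le _ _ _ _ _ _))//.
by rewrite (le_trans _ (ler_norm _))// -mulrA ler_wpM2l// mulrDr !rr_bump.
Qed.

(** The integrand is the divergence of a field vanishing at infinity. Its two
    terms are integrated separately, each along the lines of its own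
    variable. *)
Lemma integral_null_lagrangian a b c d :
  (\int[dA]_z
    (smooth_re e (z.1 - a) (z.2 - b) * smooth_re e (z.1 - c) (z.2 - d) +
     smooth_im e (z.1 - a) (z.2 - b) * smooth_im e (z.1 - c) (z.2 - d) -
     bump e (z.1 - a) (z.2 - b) * bump e (z.1 - c) (z.2 - d))%:E = 0)%E.
Proof.
transitivity (\int[dA]_z (divx a b c d z.1 z.2 - divy a b c d z.1 z.2)%:E)%E.
  by apply: eq_integral => z _; congr EFin; rewrite /divx /divy; field.
rewrite integralB_EFin//.
rewrite -(integral21_prod_meas1 (integrable_divx a b c d)) /fubini_G /=.
rewrite -(integral12_prod_meas1 (integrable_divy a b c d)) /fubini_F /=.
under eq_integral do rewrite integral_divx1.
under [X in (_ - X)%E]eq_integral do rewrite integral_divy1.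
by rewrite !integral0 sube0.
Qed.

End null_lagrangian.

(** * Unweighted bounds for the truncated transform *)
Section beurling_L2.
Variable R : realType.
Local Notation plane := (plane R).
Implicit Types (e x y : R) (f : plane -> R).

Definition area : {sigma_finite_measure set plane -> \bar R} :=
  product_sigma_finite (@lebesgue_measure R) (@lebesgue_measure R).

Definition convolution_kernel (k : R -> R -> R) (z t : plane) : R :=
  k (z.1 - t.1) (z.2 - t.2).

Local Notation conv k := (kernel_op area (convolution_kernel k)).

Definition truncated (n : R -> R -> R) e x y : R :=
  if e * e < x * x + y * y
  then n x y * ((x * x + y * y)^-1 * (x * x + y * y)^-1) else 0.

Definition square_re x y : R := x * x - y * y.
Definition square_im x y : R := - (2 * x * y).

Definition truncated_re := truncated square_re.
Definition truncated_im := truncated square_im.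

Let mdiff1 : measurable_fun [set: plane * plane] (fun p => p.1.1 - p.2.1 : R).
Proof.
apply: measurable_funB.
  exact: (measurableT_comp measurable_fst measurable_fst).
exact: (measurableT_comp measurable_fst measurable_snd).
Qed.

Let mdiff2 : measurable_fun [set: plane * plane] (fun p => p.1.2 - p.2.2 : R).
Proof.
apply: measurable_funB.
  exact: (measurableT_comp measurable_snd measurable_fst).
exact: (measurableT_comp measurable_snd measurable_snd).
Qed.

Lemma kernel_measurable_re e :
  kernel_measurable (convolution_kernel (smooth_re e)).
Proof. exact: measurable_smooth_re. Qed.

Lemma kernel_measurable_im e :
  kernel_measurable (convolution_kernel (smooth_im e)).
Proof. exact: measurable_smooth_im. Qed.

Lemma kernel_measurable_bump e :
  kernel_measurable (convolution_kernel (bump e)).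
Proof. exact: measurable_bump. Qed.

Lemma measurable_truncated d (T : measurableType d) (f g : T -> R) n e :
  measurable_fun setT f -> measurable_fun setT g ->
  measurable_fun setT (fun t => n (f t) (g t)) ->
  measurable_fun setT (fun t => truncated n e (f t) (g t)).
Proof.
move=> mf mg mn.
have mr : measurable_fun setT (fun t => f t * f t + g t * g t).
  by apply: measurable_funD; exact: measurable_funM.
have mv : measurable_fun setT (fun t => (f t * f t + g t * g t)^-1).
  apply: measurable_funV_ge0 => // t.
  by rewrite -!expr2 addr_ge0// sqr_ge0.
apply: measurable_fun_ifT => //; first exact: measurable_fun_ltr.
by apply: measurable_funM => //; exact: measurable_funM.
Qed.

Lemma kernel_measurable_truncated_re e :
  kernel_measurable (convolution_kernel (truncated_re e)).
Proof.
apply: measurable_truncated => //.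
by apply: measurable_funB; exact: measurable_funM.
Qed.

Lemma kernel_measurable_truncated_im e :
  kernel_measurable (convolution_kernel (truncated_im e)).
Proof.
apply: measurable_truncated => //.
apply: measurable_fun_opp; apply: measurable_funM => //.
exact: measurable_funM.
Qed.

Lemma rinv_le e x y : 0 < e -> rinv e x y <= (e * e)^-1.
Proof.
move=> e0; rewrite lef_pV2 ?posrE ?rho_gt0 ?mulr_gt0//.
by rewrite lerDr -!expr2 addr_ge0// sqr_ge0.
Qed.

Lemma truncated_le n e x y : 0 < e -> `|n x y| <= x * x + y * y ->
  `|truncated n e x y| <= (e * e)^-1.
Proof.
move=> e0 nle; rewrite /truncated; case: ifPn => [h|_]; last first.
  by rewrite normr0 invr_ge0 mulr_ge0 ?ltW.
have ee : 0 < e * e by rewrite mulr_gt0.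
have s0 := lt_trans ee h.
rewrite mulrA normrM [X in _ * X]gtr0_norm ?invr_gt0//.
rewrite normrM [X in _ * X * _]gtr0_norm ?invr_gt0//.
rewrite -[leRHS]mul1r; apply: ler_pM; rewrite ?mulr_ge0 ?invr_ge0 ?(ltW s0)//.
  by rewrite ler_pdivrMr// mul1r.
by rewrite lef_pV2 ?posrE// ltW.
Qed.

(** Outside the disc of radius e the regularization changes the kernel by
    O(e^2/|z|^4); inside, the regularized kernel alone is O(1/e^2). Both are of
    the order of the bump. *)
Lemma truncated_smooth_le n e x y : 0 < e -> `|n x y| <= x * x + y * y ->
  `|truncated n e x y - n x y * (rinv e x y * rinv e x y)| <= 3 * bump e x y.
Proof.
move=> e0; rewrite /truncated /bump /rinv.
set s := x * x + y * y; have ee : 0 < e * e by rewrite mulr_gt0.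
have s0 : 0 <= s by rewrite /s -!expr2 addr_ge0// sqr_ge0.
move: (n x y) (e * e) ee => m E E0 ms; have sE : 0 < s + E by rewrite ltr_wpDl.
case: ltP => h.
  have sp := lt_trans E0 h.
  have -> : m * (s^-1 / s) - m * ((s + E)^-1 / (s + E)) =
      (m / s) * ((2 * E + E * (E / s)) * ((s + E)^-1 / (s + E))).
    by field; rewrite !gt_eqF.
  have Es : E / s <= 1 by rewrite ler_pdivrMr// mul1r ltW.
  have Es0 : 0 <= E / s by rewrite divr_ge0// ltW.
  have i0 : 0 <= (s + E)^-1 / (s + E) by rewrite divr_ge0 ?invr_ge0 ?ltW.
  have m1 : `|m / s| <= 1.
    by rewrite normrM [X in _ * X]gtr0_norm ?invr_gt0// ler_pdivrMr// mul1r.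
  rewrite normrM -[leRHS]mul1r; apply: ler_pM => //.
  have w0 : 0 <= 2 * E + E * (E / s) by rewrite addr_ge0// mulr_ge0// ltW.
  rewrite ger0_norm; last exact: mulr_ge0.
  by rewrite [leRHS]mulrA ler_wpM2r//; nra.
have i0 : 0 <= (s + E)^-1 / (s + E) by rewrite divr_ge0 ?invr_ge0 ?ltW.
rewrite sub0r normrN normrM [X in _ * X]ger0_norm// mulrA ler_wpM2r//.
by apply: (le_trans ms); lra.
Qed.

Lemma square_re_le x y : `|square_re x y| <= x * x + y * y.
Proof. by rewrite /square_re ler_norml; apply/andP; split; nra. Qed.

Lemma square_im_le x y : `|square_im x y| <= x * x + y * y.
Proof.
rewrite /square_im ler_norml.
have := sqr_ge0 (x - y); have := sqr_ge0 (x + y); rewrite !expr2 => ? ?.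
by apply/andP; split; nra.
Qed.

Lemma integral_bump_r e (z : plane) : 0 < e ->
  (\int[area]_t `|convolution_kernel (bump e) z t|%:E <= (pi ^+ 2)%:E)%E.
Proof.
move=> e0; rewrite (eq_integral
  (fun t : plane => (bump e (t.1 - z.1) (t.2 - z.2))%:E)).
  exact: integral_bump_le.
move=> t _; congr EFin; rewrite ger0_norm ?bump_ge0//.
by rewrite /convolution_kernel /bump /rinv; congr (_ * (_^-1 * _^-1)); ring.
Qed.

Lemma integral_bump_l e (t : plane) : 0 < e ->
  (\int[area]_z `|convolution_kernel (bump e) z t|%:E <= (pi ^+ 2)%:E)%E.
Proof.
move=> e0; rewrite (eq_integral
  (fun z : plane => (bump e (z.1 - t.1) (z.2 - t.2))%:E)).
  exact: integral_bump_le.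
by move=> z _; congr EFin; rewrite ger0_norm ?bump_ge0.
Qed.

Lemma pi2_gt0 : 0 < (pi : R) ^+ 2.
Proof. by rewrite exprn_gt0// pi_gt0. Qed.

Lemma dominated_kernel_L2 (k : plane -> plane -> R) (c e : R) f : 0 < e -> 0 < c ->
  kernel_measurable k -> measurable_fun setT f ->
  (forall z t, `|k z t| <= c * convolution_kernel (bump e) z t) ->
  (\int[area]_z (kernel_op area k f z ^+ 2)%:E <=
   ((c * pi ^+ 2) ^+ 2)%:E * \int[area]_t (f t ^+ 2)%:E)%E.
Proof.
move=> e0 c0 mk mf kb.
have cb z t : ((c * convolution_kernel (bump e) z t)%:E =
               c%:E * `|convolution_kernel (bump e) z t|%:E)%E.
  by rewrite -EFinM ger0_norm// bump_ge0.
have mb := kernel_measurable_bump e.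
apply: schur_test => //; first by rewrite mulr_gt0// pi2_gt0.
- move=> z; apply: (@le_trans _ _
    (\int[area]_t (c%:E * `|convolution_kernel (bump e) z t|%:E))%E).
    apply: ge0_le_integralT => t; first by rewrite lee_fin.
    by rewrite -cb lee_fin.
  rewrite ge0_integralZl//; last 2 first.
  + apply/measurable_EFinP; apply: measurableT_comp => //.
    exact: kernel_measurable_r.
  + by rewrite lee_fin ltW.
  by rewrite EFinM lee_wpmul2l ?lee_fin ?(ltW c0)// integral_bump_r.
- move=> t; apply: (@le_trans _ _
    (\int[area]_z (c%:E * `|convolution_kernel (bump e) z t|%:E))%E).
    apply: ge0_le_integralT => z; first by rewrite lee_fin.
    by rewrite -cb lee_fin.
  rewrite ge0_integralZl//; last 2 first.
  + apply/measurable_EFinP; apply: measurableT_comp => //.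
    exact: kernel_measurable_l.
  + by rewrite lee_fin ltW.
  by rewrite EFinM lee_wpmul2l ?lee_fin ?(ltW c0)// integral_bump_l.
Qed.

(** The regularized kernel and the bump have equal correlations, and the bump is
    integrable uniformly in e. *)
Lemma smooth_L2 e f : 0 < e -> area.-integrable setT (EFin \o f) ->
  (\int[area]_z (conv (smooth_re e) f z ^+ 2 + conv (smooth_im e) f z ^+ 2)%:E <=
   ((pi ^+ 2) ^+ 2)%:E * \int[area]_t (f t ^+ 2)%:E)%E.
Proof.
move=> e0 fi.
have mf : measurable_fun setT f by apply/measurable_EFinP; case/integrableP: fi.
have bL2 : (\int[area]_z (conv (bump e) f z ^+ 2)%:E <=
     ((pi ^+ 2) ^+ 2)%:E * \int[area]_t (f t ^+ 2)%:E)%E.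
  rewrite -[X in (X ^+ 2)%:E]mul1r.
  apply: (@dominated_kernel_L2 _ 1 e) => //; first exact: kernel_measurable_bump.
  by move=> z t; rewrite mul1r ger0_norm// bump_ge0.
have [fy|fy] := eqVneq (\int[area]_t (f t ^+ 2)%:E)%E +oo%E.
  by rewrite fy gt0_muley ?leey// lte_fin exprn_gt0// pi2_gt0.
have ee : 0 < e * e by rewrite mulr_gt0.
rewrite (@integral_kernel_op_identity _ _ _ _ R area area _ _
  (convolution_kernel (bump e)) f ((e * e)^-1 * (1 + 3 * pi ^+ 2)))//.
- exact: kernel_measurable_re.
- exact: kernel_measurable_im.
- exact: kernel_measurable_bump.
- move=> z t; have rb := rinv_le (z.1 - t.1) (z.2 - t.2) e0.
  have ie : (e * e)^-1 <= (e * e)^-1 * (1 + 3 * pi ^+ 2).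
    rewrite ler_peMr// ?invr_ge0 ?(ltW ee)// lerDl mulr_ge0//.
    by rewrite ltW// pi2_gt0.
  by split; [have := smooth_re_le (z.1 - t.1) (z.2 - t.2) e0|
    have := smooth_im_le (z.1 - t.1) (z.2 - t.2) e0|
    have := bump_le (z.1 - t.1) (z.2 - t.2) e0];
    rewrite /convolution_kernel; lra.
- move=> t; apply: (@le_trans _ _ (\int[area]_z ((3 * (e * e)^-1)%:E *
     (bump e (z.1 - t.1) (z.2 - t.2))%:E))%E).
    apply: ge0_le_integralT => z.
      by rewrite lee_fin !addr_ge0// sqr_ge0.
    rewrite -EFinM lee_fin /convolution_kernel.
    move: (z.1 - t.1) (z.2 - t.2) => x y.
    have r0 := rinv_gt0 x y e0.
    have sq u : `|u| <= rinv e x y -> u ^+ 2 <= rinv e x y * rinv e x y.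
      move=> h; rewrite -(real_normK (num_real u)) expr2.
      by apply: ler_pM.
    have := sq _ (smooth_re_le x y e0); have := sq _ (smooth_im_le x y e0).
    have := sq _ (bump_le x y e0).
    have -> : 3 / (e * e) * bump e x y = 3 * (rinv e x y * rinv e x y).
      by rewrite /bump; field; rewrite gt_eqF.
    lra.
  rewrite ge0_integralZl//; last 3 first.
  + apply/measurable_EFinP; apply: measurable_bump.
      exact: measurable_fst_sub.
    exact: measurable_snd_sub.
  + by move=> z _; rewrite lee_fin bump_ge0.
  + by rewrite lee_fin mulr_ge0// invr_ge0 ltW.
  apply: (@le_trans _ _ ((3 / (e * e))%:E * (pi ^+ 2)%:E)%E).
    by rewrite lee_wpmul2l ?integral_bump_le// lee_fin mulr_ge0// invr_ge0 ltW.
  rewrite -EFinM lee_fin mulrDr mulr1.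
  have : 0 < (e * e)^-1 by rewrite invr_gt0.
  lra.
- by move=> t u; exact: integral_null_lagrangian.
- apply: le_lt_trans bL2 _; apply: lte_mul_pinfty => //.
    by rewrite lee_fin sqr_ge0.
  by rewrite ltey.
Qed.

Lemma truncated_L2 (n : R -> R -> R) e f : 0 < e ->
  let smooth x y := n x y * (rinv e x y * rinv e x y) in
  (forall x y, `|n x y| <= x * x + y * y) ->
  kernel_measurable (convolution_kernel (truncated n e)) ->
  kernel_measurable (convolution_kernel smooth) ->
  area.-integrable setT (EFin \o f) ->
  (\int[area]_z (conv smooth f z ^+ 2)%:E <=
     ((pi ^+ 2) ^+ 2)%:E * \int[area]_t (f t ^+ 2)%:E)%E ->
  (\int[area]_z (conv (truncated n e) f z ^+ 2)%:E <=
     (20 * (pi ^+ 2) ^+ 2)%:E * \int[area]_t (f t ^+ 2)%:E)%E.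
Proof.
move=> e0 smooth nle mt ms fi sL2.
have mf : measurable_fun setT f by apply/measurable_EFinP; case/integrableP: fi.
pose k z t : R :=
  convolution_kernel (truncated n e) z t - convolution_kernel smooth z t.
have mk : kernel_measurable k by exact: measurable_funB.
have smooth_le x y : `|smooth x y| <= (e * e)^-1.
  have r0 := rinv_gt0 x y e0; have rE := rinvE x y e0.
  apply: le_trans (rinv_le x y e0).
  rewrite /smooth mulrA normrM (gtr0_norm r0) -[leRHS]mul1r ler_pM2r//.
  rewrite normrM (gtr0_norm r0) -[leRHS]rE ler_pM2r// (le_trans (nle x y))//.
  by rewrite lerDl -expr2 sqr_ge0.
have kE z : kernel_op area k f z =
    conv (truncated n e) f z - conv smooth f z.
  apply: (@kernel_opB _ _ _ _ _ _ _ _ _ (e * e)^-1) => // t.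
    exact: truncated_le.
  exact: smooth_le.
have kL2 := @dominated_kernel_L2 k 3 e f e0 (ltr0Sn _ 2) mk mf
  (fun z t => truncated_smooth_le e0 (nle _ _)).
have m1 := measurable_kernel_op area mk mf.
have m2 := measurable_kernel_op area ms mf.
apply: (@le_trans _ _ (\int[area]_z (2%:E * (conv smooth f z ^+ 2)%:E +
   2%:E * (kernel_op area k f z ^+ 2)%:E))%E).
  apply: ge0_le_integralT => z; first by rewrite lee_fin sqr_ge0.
  rewrite -!EFinM -EFinD lee_fin kE.
  move: (conv _ f z) (conv smooth f z) => a b.
  by have := sqr_ge0 (a - 2 * b); rewrite !expr2; nra.
have p2 (g : plane -> R) : measurable_fun setT g ->
    measurable_fun setT (fun z => 2%:E * (g z ^+ 2)%:E)%E.
  move=> mg; apply: emeasurable_funM => //.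
  by apply/measurable_EFinP; exact: measurable_funX.
rewrite ge0_integralD//; last 4 first.
- by move=> z _; rewrite -EFinM lee_fin mulr_ge0// sqr_ge0.
- exact: p2.
- by move=> z _; rewrite -EFinM lee_fin mulr_ge0// sqr_ge0.
- exact: p2.
rewrite !ge0_integralZl//; last 4 first.
- by apply/measurable_EFinP; exact: measurable_funX.
- by move=> z _; rewrite lee_fin sqr_ge0.
- by apply/measurable_EFinP; exact: measurable_funX.
- by move=> z _; rewrite lee_fin sqr_ge0.
apply: (@le_trans _ _ (2%:E * (((pi ^+ 2) ^+ 2)%:E * \int[area]_t (f t ^+ 2)%:E) +
  2%:E * (((3 * pi ^+ 2) ^+ 2)%:E * \int[area]_t (f t ^+ 2)%:E))%E).
  by apply: leeD; rewrite lee_wpmul2l// lee_fin.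
rewrite !muleA -ge0_muleDl ?mule_ge0 ?lee_fin ?sqr_ge0//.
rewrite -!EFinM -EFinD lee_wpmul2r//.
  by apply: integral_ge0 => z _; rewrite lee_fin sqr_ge0.
by rewrite lee_fin !expr2; lra.
Qed.

Lemma smooth_re_L2 e f : 0 < e -> area.-integrable setT (EFin \o f) ->
  (\int[area]_z (conv (smooth_re e) f z ^+ 2)%:E <=
   ((pi ^+ 2) ^+ 2)%:E * \int[area]_t (f t ^+ 2)%:E)%E.
Proof.
move=> e0 fi; apply: le_trans (smooth_L2 e0 fi).
apply: ge0_le_integralT => z; first by rewrite lee_fin sqr_ge0.
by rewrite lee_fin lerDl sqr_ge0.
Qed.

Lemma smooth_im_L2 e f : 0 < e -> area.-integrable setT (EFin \o f) ->
  (\int[area]_z (conv (smooth_im e) f z ^+ 2)%:E <=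
   ((pi ^+ 2) ^+ 2)%:E * \int[area]_t (f t ^+ 2)%:E)%E.
Proof.
move=> e0 fi; apply: le_trans (smooth_L2 e0 fi).
apply: ge0_le_integralT => z; first by rewrite lee_fin sqr_ge0.
by rewrite lee_fin lerDr sqr_ge0.
Qed.

Lemma truncated_re_L2 e f : 0 < e -> area.-integrable setT (EFin \o f) ->
  (\int[area]_z (conv (truncated_re e) f z ^+ 2)%:E <=
   (20 * (pi ^+ 2) ^+ 2)%:E * \int[area]_t (f t ^+ 2)%:E)%E.
Proof.
move=> e0 fi; apply: truncated_L2 => //.
- exact: square_re_le.
- exact: kernel_measurable_truncated_re.
- exact: kernel_measurable_re.
- exact: smooth_re_L2.
Qed.

Lemma truncated_im_L2 e f : 0 < e -> area.-integrable setT (EFin \o f) ->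
  (\int[area]_z (conv (truncated_im e) f z ^+ 2)%:E <=
   (20 * (pi ^+ 2) ^+ 2)%:E * \int[area]_t (f t ^+ 2)%:E)%E.
Proof.
move=> e0 fi; apply: truncated_L2 => //.
- exact: square_im_le.
- exact: kernel_measurable_truncated_im.
- exact: kernel_measurable_im.
- exact: smooth_im_L2.
Qed.

End beurling_L2.

(** * Positive matrices satisfying a three-point inequality *)
Section positive_kernels.
Variables (R : realType) (N : nat).
Variables (K : 'I_N -> 'I_N -> R) (w u a : 'I_N -> R) (c C : R).
Hypothesis K0 : forall i j, 0 <= K i j.
Hypothesis Ksym : forall i j, K i j = K j i.
Hypothesis K3 : forall i j k, K i j * K i k <= c * ((K i j + K i k) * K j k).
Hypothesis w0 : forall i, 0 < w i.
Hypothesis a0 : forall i, 0 <= a i.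
Hypothesis c0 : 0 <= c.
Hypothesis C0 : 0 <= C.
Hypothesis column : forall j, \sum_(i < N) w i * K i j <= C * u j.

Let T j := \sum_(k < N) K j k * a k.

Let T0 j : 0 <= T j.
Proof. by apply: sumr_ge0 => k _; rewrite mulr_ge0. Qed.

(** Expanding the square, the three-point inequality replaces K i j K i k by
    terms in which K j k is separated from the sum over i, and that sum is then
    a column sum. *)
Let square_le_linear :
  \sum_(i < N) w i * T i ^+ 2 <= 2 * c * C * \sum_(j < N) u j * a j * T j.
Proof.
pose F i j k := w i * (c * (K i j * K j k)) * (a j * a k).
have symF : \sum_(i < N) \sum_(j < N) \sum_(k < N)
     w i * (c * (K i k * K j k)) * (a j * a k) =
   \sum_(i < N) \sum_(j < N) \sum_(k < N) F i j k.
  apply: eq_bigr => i _; rewrite exchange_big /=.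
  apply: eq_bigr => k _; apply: eq_bigr => j _.
  by rewrite /F (Ksym j k) [a j * _]mulrC.
have FE : \sum_(i < N) \sum_(j < N) \sum_(k < N) F i j k =
    c * \sum_(j < N) (\sum_(i < N) w i * K i j) * (a j * T j).
  rewrite exchange_big mulr_sumr; apply: eq_bigr => j _ /=.
  rewrite mulr_suml mulr_sumr; apply: eq_bigr => i _.
  rewrite /T !mulr_sumr; apply: eq_bigr => k _; rewrite /F; ring.
apply: (@le_trans _ _ (\sum_(i < N) \sum_(j < N) \sum_(k < N)
   (F i j k + w i * (c * (K i k * K j k)) * (a j * a k)))).
  apply: ler_sum => i _; rewrite expr2 /T mulr_suml mulr_sumr.
  apply: ler_sum => j _; rewrite !mulr_sumr; apply: ler_sum => k _.
  rewrite /F -mulrDl -mulrDr -mulrDr -mulrDl.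
  rewrite [leLHS](_ : _ = w i * (K i j * K i k) * (a j * a k)); last by ring.
  by rewrite ler_wpM2r ?mulr_ge0// ler_wpM2l// ltW.
under eq_bigr => i _ do under eq_bigr => j _ do rewrite big_split.
under eq_bigr => i _ do rewrite big_split.
rewrite big_split /= symF FE -mulr2n -[_ *+ 2]mulr_natl.
rewrite -!mulrA ler_wpM2l// ler_wpM2l// mulr_sumr.
apply: ler_sum => j _.
apply: le_trans (ler_wpM2r _ (column j)) _; first by rewrite mulr_ge0.
by rewrite !mulrA.
Qed.

(** The square of the operator is controlled by the operator itself, and the
    Cauchy-Schwarz inequality absorbs the latter; this takes the place of a
    bound on the rows. *)
Lemma positive_kernel_L2 :
  \sum_(i < N) w i * (\sum_(j < N) K i j * a j) ^+ 2 <=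
  (2 * c * C) ^+ 2 * \sum_(j < N) u j ^+ 2 / w j * a j ^+ 2.
Proof.
set L := 2 * c * C; set A := \sum_(j < N) _ / _ * _.
have L0 : 0 <= L by rewrite !mulr_ge0.
have H := square_le_linear; rewrite -/L in H.
rewrite -/(T _); set S := (X in X <= _).
have SE : S = \sum_(i < N) w i * T i ^+ 2 by [].
have H2 : L * \sum_(j < N) u j * a j * T j <= (L ^+ 2 * A + S) / 2.
  rewrite SE /A mulr_sumr mulr_sumr -big_split mulr_suml /=.
  apply: ler_sum => j _; have wj := w0 j.
  rewrite ler_pdivlMr//.
  have -> : L ^+ 2 * (u j ^+ 2 / w j * a j ^+ 2) + w j * T j ^+ 2 =
     L * (u j * a j * T j) * 2 + (L * u j * a j - w j * T j) ^+ 2 / w j.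
    by field; rewrite gt_eqF.
  by rewrite lerDl divr_ge0 ?sqr_ge0// ltW.
rewrite -SE in H; lra.
Qed.

End positive_kernels.

(** * The error kernel *)
Section decay_profile.
Variable R : realType.

(** The size 1/r^2 of the Beurling kernel, with the power of the distance gained
    at large scales by comparison with the regularized kernel. *)
Definition decay (r : R) : R := (r * r * (1 + r))^-1.

Lemma decay_gt0 r : 0 < r -> 0 < decay r.
Proof. by move=> r0; rewrite invr_gt0 !mulr_gt0// addr_gt0. Qed.

Lemma decay_le_double r s : 0 < r -> 0 < s -> s <= 2 * r ->
  decay r <= 8 * decay s.
Proof.
move=> r0 s0 sr; have sr1 : 0 < s * s * (1 + s) by rewrite !mulr_gt0// addr_gt0.
have rr1 : 0 < r * r * (1 + r) by rewrite !mulr_gt0// addr_gt0.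
rewrite /decay ler_pdivlMr// mulrC ler_pdivrMr//.
have h1 : s * s <= 4 * (r * r) by nra.
have h2 : 1 + s <= 2 * (1 + r) by lra.
have : s * s * (1 + s) <= 4 * (r * r) * (2 * (1 + r)).
  by apply: ler_pM => //; rewrite ?mulr_ge0 ?addr_ge0 ?ltW.
lra.
Qed.

(** One of r, s is at least d / 2, and the profile is doubling. *)
Lemma decay_three_points r s d : 0 < r -> 0 < s -> 0 < d -> d <= r + s ->
  decay r * decay s <= 8 * ((decay r + decay s) * decay d).
Proof.
move=> r0 s0 d0 drs.
have dr := decay_gt0 r0; have ds := decay_gt0 s0; have dd := decay_gt0 d0.
have [rs|sr] := leP r s.
  have := @decay_le_double s d s0 d0 ltac:(lra).
  move: (decay r) (decay s) (decay d) dr ds dd => x y z *; nra.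
have := @decay_le_double r d r0 d0 ltac:(lra).
move: (decay r) (decay s) (decay d) dr ds dd => x y z *; nra.
Qed.

(** Decomposition into balls of radius 2^-g, for which the packing condition
    gives the scaling 2^(-gt); the shells stop at the generation k of the cube
    at the center. *)
Lemma decay_near (r : R) (k : nat) : 0 < r -> r <= 1 -> 2 ^- k.+1 < r ->
  decay r <= \sum_(g < k.+1) 4 ^+ g.+1 * (r <= 2 ^- g)%R%:R.
Proof.
move=> r0 r1; elim: k => [|k IH] kr.
  rewrite big_ord1 expr0 invr1 r1 mulr1 expr1 /decay.
  have h : 2^-1 < r by rewrite expr1 in kr.
  by rewrite invf_ple ?posrE ?mulr_gt0 ?addr_gt0//; nra.
rewrite big_ord_recr /=; have [rk|rk] := leP r (2 ^- k.+1).
  rewrite mulr1 ler_wpDl//.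
    by apply: sumr_ge0 => g _; rewrite mulr_ge0// exprn_ge0.
  have pk : 0 < (2 : R) ^- k.+2 by rewrite invr_gt0 exprn_gt0.
  have p4 : 0 < (4 : R) ^+ k.+2 by rewrite exprn_gt0.
  have rr1 : 0 < r * r * (1 + r) by rewrite !mulr_gt0// addr_gt0.
  rewrite /decay invf_ple ?posrE//.
  have -> : (4 ^+ k.+2)^-1 = (2 : R) ^- k.+2 * 2 ^- k.+2.
    by rewrite -invfM -exprMn -natrM.
  have := kr; move: (2 ^- k.+2 : R) pk => q *; nra.
by rewrite mulr0 addr0; exact: IH.
Qed.

(** Beyond distance one a ball of radius 2^h is only covered by unit squares,
    whose number grows like 4^h; the factor 8^-h leaves a convergent series. *)
Lemma decay_far (r : R) (H : nat) : 1 < r -> r <= 2 ^+ H ->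
  decay r <= \sum_(h < H) 8 ^- h * (r <= 2 ^+ h.+1)%R%:R.
Proof.
move=> r1; elim: H => [|H IH] rH; first by rewrite expr0 in rH; lra.
rewrite big_ord_recr /= rH mulr1.
have [rh|hr] := leP r (2 ^+ H).
  by rewrite (le_trans (IH rh))// lerDl invr_ge0 exprn_ge0.
rewrite ler_wpDl//.
  by apply: sumr_ge0 => g _; rewrite mulr_ge0// invr_ge0 exprn_ge0.
have r0 : 0 < r by lra.
have q0 : 0 < (2 : R) ^+ H by rewrite exprn_gt0.
rewrite /decay lef_pV2 ?posrE ?mulr_gt0 ?addr_gt0 ?exprn_gt0//.
have -> : (8 : R) ^+ H = 2 ^+ H * 2 ^+ H * 2 ^+ H by rewrite -!exprMn -!natrM.
move: (2 ^+ H : R) q0 hr => q q0 hr.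
have qq : q * q <= r * r by nra.
have qr : q <= 1 + r by lra.
by apply: ler_pM => //; rewrite ?mulr_ge0 ?ltW.
Qed.

End decay_profile.

(** * Dyadic cubes and the packing condition *)
Section dyadic_cubes.
Variable R : realType.
Implicit Types (Q : dyadic) (x y : R) (g M : nat).

Lemma side_gt0 Q : 0 < side R Q.
Proof. by rewrite invr_gt0 exprn_gt0. Qed.

Lemma side_le1 Q : side R Q <= 1.
Proof. by rewrite invf_le1 ?exprn_gt0// exprn_ege1// ler1n. Qed.

(** The endpoints of the ancestor are multiples of 2^(k-g) in units of 2^-k, so
    that comparing them with the midpoint of an interval of length one decides
    the inclusion. *)
Lemma dyadic_ancestor_itv g (k : nat) (m : int) x : (g <= k)%N ->
  let l := (2 : R) ^- k in
  let a := Num.floor (2 ^+ g * (l * (m%:~R + 2^-1))) in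
  l * m%:~R < x -> x < l * (m + 1)%:~R ->
  2 ^- g * a%:~R < x /\ x < 2 ^- g * (a + 1)%:~R.
Proof.
move=> gk l a mx xm.
have pn n : 0 < (2 : R) ^+ n by rewrite exprn_gt0.
pose d := (k - g)%N; have kE : k = (g + d)%N by rewrite subnKC.
have gl : 2 ^+ g * l = 2 ^- d.
  by rewrite /l kE exprD invfM mulrA mulfV ?mul1r// gt_eqF.
have /andP[a1 a2] := floor_itv (2 ^+ g * (l * (m%:~R + 2^-1))).
rewrite -/a mulrA gl in a1 a2.
have aZ (b : int) : b%:~R * (2 : R) ^+ d = (b * 2 ^+ d)%:~R.
  by rewrite intrM rmorphXn.
have b1 : a * 2 ^+ d <= m.
  rewrite -ltzD1 -(@ltr_int R) -aZ.
  have : a%:~R * 2 ^+ d <= m%:~R + 2^-1 :> R.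
    by rewrite -ler_pdivlMr// mulrC.
  rewrite intrD; lra.
have b2 : m + 1 <= (a + 1) * 2 ^+ d.
  rewrite lezD1 -(@ltr_int R) -aZ.
  have : m%:~R + 2^-1 < (a + 1)%:~R * 2 ^+ d :> R.
    by rewrite -ltr_pdivrMr// mulrC.
  lra.
have lg : l = 2 ^- g * 2 ^- d by rewrite /l kE exprD invfM.
have c1 : (a%:~R : R) <= 2 ^- d * m%:~R.
  by rewrite mulrC ler_pdivlMr// aZ ler_int.
have c2 : 2 ^- d * (m + 1)%:~R <= ((a + 1)%:~R : R).
  by rewrite mulrC ler_pdivrMr// aZ ler_int.
split.
  apply: le_lt_trans mx; rewrite lg -mulrA ler_wpM2l// invr_ge0 ltW//.
apply: lt_le_trans xm _; rewrite lg -mulrA ler_wpM2l// invr_ge0 ltW//.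
Qed.

Definition dyadic_at g x y : dyadic :=
  Dyadic g (Num.floor (2 ^+ g * x)) (Num.floor (2 ^+ g * y)).

Lemma cube_sub_ancestor g Q : (g <= dexp Q)%N ->
  @cube R Q `<=` cube (dyadic_at g (center1 R Q) (center2 R Q)).
Proof.
case: Q => k m1 m2 /= gk z [h1 h2 h3 h4].
have [a1 a2] := dyadic_ancestor_itv gk h1 h2.
by have [b1 b2] := dyadic_ancestor_itv gk h3 h4.
Qed.

Lemma floor_dist x y M : `|x - y| <= M%:R ->
  exists p : 'I_(2 * M).+1, Num.floor x = Num.floor y - M%:Z + p%:Z.
Proof.
rewrite ler_norml => /andP[h1 h2].
have /andP[x1 x2] := floor_itv x; have /andP[y1 y2] := floor_itv y.
have f1 : Num.floor x <= Num.floor y + M%:Z.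
  rewrite -ltzD1 -(@ltr_int R) !intrD -pmulrn.
  rewrite intrD in y2; lra.
have f2 : Num.floor y - M%:Z <= Num.floor x.
  rewrite -ltzD1 -(@ltr_int R) !intrD mulrNz -pmulrn.
  rewrite intrD in x2; lra.
have hp : (`|(Num.floor x - (Num.floor y - M%:Z))%R| < (2 * M).+1)%N by lia.
exists (Ordinal hp) => /=; lia.
Qed.

Variables (t : R) (N : nat) (P : 'I_N -> dyadic).
Hypothesis t0 : 0 < t.
Hypothesis pack : (pack_norm t P <= 1)%E.

Lemma packing_le Q :
  \sum_(i < N | `[< @cube R (P i) `<=` cube Q >]) side R (P i) `^ t <=
  side R Q `^ t.
Proof.
set S := \sum_(i < N | _) _.
have S0 : 0 <= S by apply: sumr_ge0 => i _; exact: powR_ge0.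
have : ((side R Q `^ (- t) * S) `^ t^-1 <= 1)%R.
  rewrite -lee_fin; apply: le_trans pack.
  by apply: ereal_sup_ubound; exists Q.
have sQ := side_gt0 Q.
have p0 : 0 < side R Q `^ t by exact: powR_gt0.
rewrite powRN => h; rewrite -[leRHS]mul1r -ler_pdivrMr//; apply: contraTT h.
rewrite mulrC -!ltNge => h.
have -> : 1 = (1 : R) `^ t^-1 by rewrite powR1.
rewrite gt0_ltr_powR ?invr_gt0// ?nnegrE ?ler01//.
by rewrite mulr_ge0// invr_ge0 ltW.
Qed.

(** The dyadic squares of generation [g] within M steps of the one containing
    (x, y) are (2M + 1)^2 in number and cover all these cubes. *)
Lemma packing_box g M x y :
  \sum_(i < N | [&& (g <= dexp (P i))%N, `|center1 R (P i) - x| <= M%:R * 2 ^- g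
                  & `|center2 R (P i) - y| <= M%:R * 2 ^- g])
     side R (P i) `^ t <= ((2 * M).+1 ^ 2)%:R * (2 ^- g) `^ t.
Proof.
have pg : 0 < (2 : R) ^+ g by rewrite exprn_gt0.
pose Q (p : 'I_(2 * M).+1 * 'I_(2 * M).+1) : dyadic :=
  Dyadic g (Num.floor (2 ^+ g * x) - M%:Z + p.1%:Z)
           (Num.floor (2 ^+ g * y) - M%:Z + p.2%:Z).
pose S := \sum_p \sum_(i < N | `[< @cube R (P i) `<=` cube (Q p) >])
   side R (P i) `^ t.
apply: (@le_trans _ _ S); last first.
  apply: (@le_trans _ _ (\sum_(p : 'I_(2 * M).+1 * 'I_(2 * M).+1) (2 ^- g) `^ t)).
    by apply: ler_sum => p _; exact: packing_le.
  by rewrite sumr_const card_prod !card_ord mulr_natl expnS expn1.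
rewrite /S big_mkcond /=.
under [leRHS]eq_bigr do rewrite big_mkcond.
rewrite exchange_big /=; apply: ler_sum => i _.
have sum0 p : 0 <= (if `[< @cube R (P i) `<=` cube (Q p) >]
    then side R (P i) `^ t else 0).
  by case: ifP => // _; exact: powR_ge0.
case: ifP => [/and3P[gi h1 h2]|_]; last exact: sumr_ge0.
have scale (u v : R) : `|u - v| <= M%:R * 2 ^- g ->
    `|2 ^+ g * u - 2 ^+ g * v| <= M%:R.
  by move=> h; rewrite -mulrBr normrM gtr0_norm// mulrC -ler_pdivlMr.
have [p1 e1] := floor_dist (scale _ _ h1).
have [p2 e2] := floor_dist (scale _ _ h2).
rewrite (bigD1 (p1, p2))//= ifT; first by rewrite lerDl sumr_ge0.
apply/asboolP; rewrite /Q /= -e1 -e2.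
exact: cube_sub_ancestor.
Qed.

(** Adding the sides makes this positive on the diagonal and, for cubes with
    disjoint triples, comparable with the distance between any two points of
    the cubes. *)
Definition cube_dist (Q S : dyadic) : R :=
  Num.max `|center1 R Q - center1 R S| `|center2 R Q - center2 R S| +
  (side R Q + side R S).

Lemma cube_dist_gt0 Q S : 0 < cube_dist Q S.
Proof.
by rewrite ltr_wpDl ?addr_gt0 ?side_gt0// le_max normr_ge0.
Qed.

Lemma cube_distC Q S : cube_dist Q S = cube_dist S Q.
Proof.
by rewrite /cube_dist distrC [X in Num.max _ X]distrC [side R Q + _]addrC.
Qed.

Lemma cube_dist_triangle Q S U : cube_dist S U <= cube_dist Q S + cube_dist Q U.
Proof.
rewrite /cube_dist; have := side_gt0 Q => q0.
set m1 := Num.max _ _; set m2 := Num.max _ _; set m3 := Num.max _ _.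
suff : m1 <= m2 + m3 by lra.
rewrite /m1 ge_max; apply/andP; split.
  rewrite (le_trans (ler_distD (center1 R Q) _ _))// distrC lerD//.
    by rewrite le_max lexx.
  by rewrite le_max lexx.
rewrite (le_trans (ler_distD (center2 R Q) _ _))// distrC lerD//.
  by rewrite le_max lexx orbT.
by rewrite le_max lexx orbT.
Qed.

Lemma dexp_side g Q : side R Q <= 2 ^- g -> (g <= dexp Q)%N.
Proof.
rewrite /side lef_pV2 ?posrE ?exprn_gt0// => h.
by rewrite -(ler_eXn2l (x := (2 : R))) ?ltr1n.
Qed.

(** A cube close to P_j at scale 2^-g has side at most 2^-g, hence generation at
    least g, when M = 1; for the larger radii M only g = 0 occurs, and the
    generation imposes nothing. *)
Lemma packing_ball j g M : (2 ^- g <= (1 : R)) -> (0 < M)%N ->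
  (g = 0 \/ M = 1)%N ->
  \sum_(i < N) side R (P i) `^ t *
     (cube_dist (P i) (P j) <= M%:R * 2 ^- g)%R%:R <=
  ((2 * M).+1 ^ 2)%:R * (2 ^- g) `^ t.
Proof.
move=> g1 M0 gM.
apply: le_trans (packing_box g M (center1 R (P j)) (center2 R (P j))).
rewrite [leRHS]big_mkcond /=; apply: ler_sum => i _.
case: (boolP (cube_dist _ _ <= _)) => h; last first.
  by rewrite mulr0; case: ifP => // _; exact: powR_ge0.
rewrite mulr1 ifT//.
have si := side_gt0 (P i); have sj := side_gt0 (P j).
move: h; rewrite /cube_dist; set m := Num.max _ _ => h.
have m0 : 0 <= m by rewrite le_max normr_ge0.
have hm : m <= M%:R * 2 ^- g by lra.
have := hm; rewrite /m ge_max => /andP[-> ->]; rewrite !andbT.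
case: gM => [->|M1]; first by [].
by apply: dexp_side; rewrite M1 mul1r in h; lra.
Qed.

(** The t-dimensional mass of the family integrates the kernel as it would
    integrate 1/r^2: shell g contributes 4^g 2^(-gt) = 2^(g(2-t)), a geometric
    series dominated by its last term g = k, where 2^-k is the side of P_j.
    Distances beyond one add a bounded amount. The constant is 86 = 36 + 50,
    with 36 = 4 * 3^2 from the shells and 50 from the far part. *)
Lemma column_bound j : t < 2 ->
  \sum_(i < N) side R (P i) `^ t * decay (cube_dist (P i) (P j)) <=
  86 / (1 - 2 `^ (t - 2)) * side R (P j) `^ (t - 2).
Proof.
move=> t2.
pose D i := cube_dist (P i) (P j).
pose k := dexp (P j).
have [H hH] : exists H, forall i, D i <= 2 ^+ H.
  exists (Num.truncn (\sum_i D i)).+1 => i.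
  apply: (@le_trans _ _ (\sum_i D i)).
    rewrite (bigD1 i)//= lerDl sumr_ge0// => i' _.
    exact/ltW/cube_dist_gt0.
  apply: (le_trans (ltW (truncnS_gt _))).
  by rewrite -natrX ler_nat ltnW// ltn_expl.
have dec i : decay (D i) <=
    \sum_(g < k.+1) 4 ^+ g.+1 * (D i <= 2 ^- g)%R%:R +
    \sum_(h < H) 8 ^- h * (D i <= 2 ^+ h.+1)%R%:R.
  have D0 : 0 < D i by exact: cube_dist_gt0.
  have n1 : 0 <= \sum_(g < k.+1) (4 : R) ^+ g.+1 * (D i <= 2 ^- g)%R%:R.
    by apply: sumr_ge0 => g _; rewrite mulr_ge0// exprn_ge0.
  have n2 : 0 <= \sum_(h < H) (8 : R) ^- h * (D i <= 2 ^+ h.+1)%R%:R.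
    by apply: sumr_ge0 => g _; rewrite mulr_ge0// invr_ge0 exprn_ge0.
  have [D1|D1] := leP (D i) 1.
    rewrite ler_wpDr//; apply: decay_near => //.
    have sj : side R (P j) = 2 ^- k by [].
    have m0 : 0 <= Num.max `|center1 R (P i) - center1 R (P j)|
        `|center2 R (P i) - center2 R (P j)| by rewrite le_max normr_ge0.
    have := side_gt0 (P i); rewrite /D /cube_dist sj => si.
    have : (2 : R) ^- k.+1 <= 2 ^- k.
      by rewrite lef_pV2 ?posrE ?exprn_gt0// ler_eXn2l ?ltr1n.
    lra.
  by rewrite ler_wpDl//; exact: decay_far.
pose q : R := 2 `^ (2 - t).
have qV : 2 `^ (t - 2) = q^-1 by rewrite /q -powRN opprB.
have q1 : 1 < q.
  have -> : 1 = (1 : R) `^ (2 - t) by rewrite powR1.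
  by rewrite gt0_ltr_powR ?nnegrE// ?ltr1n//; lra.
have q0 : 0 < q by lra.
have p2 n u : (2 ^- n) `^ u = (2 : R) `^ (- u) ^+ n.
  rewrite -powR_mulrn ?powR_ge0// -powRrM.
  by rewrite -powR_invn// -powRrM; congr (_ `^ _); ring.
have fourq n : (4 : R) ^+ n * (2 ^- n) `^ t = q ^+ n.
  rewrite p2 -exprMn; congr (_ ^+ n).
  have -> : (4 : R) = 2 `^ 2 by rewrite powR_mulrn// -natrX.
  by rewrite -powRD ?pnatr_eq0 ?implybT.
have near : \sum_(i < N) side R (P i) `^ t *
     \sum_(g < k.+1) 4 ^+ g.+1 * (D i <= 2 ^- g)%R%:R <=
   36 / (1 - q^-1) * q ^+ k.
  under eq_bigr do rewrite mulr_sumr.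
  rewrite exchange_big /=.
  apply: (@le_trans _ _ (\sum_(g < k.+1) 36 * q ^+ g)).
    apply: ler_sum => g _.
    have g1 : (2 : R) ^- g <= 1.
      by rewrite invf_le1 ?exprn_gt0// exprn_ege1// ler1n.
    have := packing_ball j g1 (ltn0Sn 0) (or_intror erefl).
    rewrite mul1r => h.
    rewrite -fourq mulrA.
    apply: (@le_trans _ _ (4 ^+ g.+1 * \sum_(i < N) side R (P i) `^ t *
       (cube_dist (P i) (P j) <= 2 ^- g)%R%:R)).
      by rewrite mulr_sumr; apply: ler_sum => i _; rewrite mulrCA.
    apply: le_trans (ler_wpM2l _ h) _; first by rewrite exprn_ge0.
    by rewrite le_eqVlt; apply/orP; left; apply/eqP; rewrite exprS; ring.
  rewrite -mulr_sumr -mulrA ler_wpM2l// mulrC ler_pdivlMr; last first.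
    by rewrite subr_gt0 invf_lt1.
  have := subrX1 q k.+1; rewrite exprS => gs.
  rewrite -(ler_pM2l q0) mulrCA [q * (_ - _)]mulrBr mulr1 mulfV ?gt_eqF//.
  rewrite mulrC -gs; lra.
have half n : \sum_(h < n) (2 : R) ^- h <= 2 - 2 * 2 ^- n.
  elim: n => [|n IH]; first by rewrite big_ord0 expr0 invr1 mulr1 subrr.
  rewrite big_ord_recr /= (le_trans (lerD IH (lexx _)))//.
  by rewrite exprS invfM mulrA mulfV// mul1r; lra.
have far : \sum_(i < N) side R (P i) `^ t *
     \sum_(h < H) 8 ^- h * (D i <= 2 ^+ h.+1)%R%:R <= 50.
  under eq_bigr do rewrite mulr_sumr.
  rewrite exchange_big /=.
  apply: (@le_trans _ _ (\sum_(h < H) 25 * 2 ^- h)); last first.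
    have h2 : \sum_(h < H) (2 : R) ^- h <= 2.
      by rewrite (le_trans (half H))// gerBl mulr_ge0// invr_ge0 exprn_ge0.
    by rewrite -mulr_sumr (le_trans (ler_wpM2l _ h2))//; lra.
  apply: ler_sum => h _.
  have M0 : (0 < 2 ^ h.+1)%N by rewrite expn_gt0.
  have g1 : (2 : R) ^- 0 <= 1 by rewrite expr0 invr1.
  have := packing_ball j g1 M0 (or_introl erefl).
  rewrite expr0 invr1 mulr1 powR1 mulr1 natrX => hb.
  apply: (@le_trans _ _ (8 ^- h * \sum_(i < N) side R (P i) `^ t *
       (cube_dist (P i) (P j) <= 2 ^+ h.+1)%R%:R)).
    by rewrite mulr_sumr; apply: ler_sum => i _; rewrite mulrCA.
  have h8 : 0 < (8 : R) ^+ h by rewrite exprn_gt0.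
  have h2 : 0 < (2 : R) ^+ h by rewrite exprn_gt0.
  have e8 : (8 : R) ^+ h = 2 ^+ h * (2 ^+ h * 2 ^+ h).
    by rewrite -!exprMn -!natrM.
  rewrite ler_pdivrMl//; apply: le_trans hb _.
  rewrite e8 (_ : _ * (25 * _) = (5 * 2 ^+ h) ^+ 2); last first.
    by field; rewrite gt_eqF.
  rewrite natrX lerXn2r ?nnegrE ?mulr_ge0 ?(ltW h2)//.
  rewrite -natr1 natrM natrX exprS.
  have : 1 <= (2 : R) ^+ h by rewrite exprn_ege1// ler1n.
  lra.
apply: (@le_trans _ _ (36 / (1 - q^-1) * q ^+ k + 50)).
  apply: le_trans (lerD near far).
  rewrite -big_split /=; apply: ler_sum => i _.
  rewrite -[leRHS]mulrDr; apply: ler_wpM2l; first exact: powR_ge0.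
  exact: dec.
have sj : side R (P j) `^ (t - 2) = q ^+ k by rewrite /side p2 opprB.
rewrite sj qV.
have qk : 1 <= q ^+ k by rewrite exprn_ege1// ltW.
have c1 : 1 <= (1 - q^-1)^-1.
  rewrite invf_ge1 ?subr_gt0 ?invf_lt1// lerBlDr lerDl invr_ge0 ltW//.
have : 1 <= (1 - q^-1)^-1 * q ^+ k by nra.
rewrite -!mulrA; move: (_^-1 * _) => X; lra.
Qed.

End dyadic_cubes.

(** * Comparison with the kernel regularized at scale one *)
Section kernel_comparison.
Variable R : realType.
Implicit Types x y u v r D : R.

Lemma square_le_of_sum x y : (1 + `|x| + `|y|) ^+ 2 <= 3 * (x * x + y * y + 1 * 1).
Proof.
have hx : x * x = `|x| * `|x| by rewrite -!expr2 real_normK// num_real.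
have hy : y * y = `|y| * `|y| by rewrite -!expr2 real_normK// num_real.
rewrite hx hy; move: `|x| `|y| => a b.
have := sqr_ge0 (a - b); have := sqr_ge0 (a - 1); have := sqr_ge0 (b - 1).
rewrite !expr2; lra.
Qed.

Lemma rinv1_le x y : rinv 1 x y <= 3 / (1 + `|x| + `|y|) ^+ 2.
Proof.
have n0 : 0 < (1 + `|x| + `|y|) ^+ 2 by rewrite exprn_gt0// !ltr_wpDr.
rewrite ler_pdivlMr// -ler_pdivlMl ?rinv_gt0// mulrC.
by rewrite /rinv invrK square_le_of_sum.
Qed.

Lemma cauchy_component_le x y : `|x * rinv 1 x y| <= 3 / (1 + `|x| + `|y|).
Proof.
have n0 : 0 < 1 + `|x| + `|y| by rewrite !ltr_wpDr.
have r0 := rinv_gt0 x y (@ltr01 R).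
rewrite normrM (gtr0_norm r0); apply: le_trans (ler_wpM2l _ (rinv1_le x y)) _ => //.
rewrite ler_pdivlMr// expr2 -[leLHS]mulrA invfM -!mulrA mulVf ?gt_eqF// mulr1.
rewrite mulrCA -[leRHS]mulr1 ler_wpM2l// ler_pdivrMr// mul1r.
by have := normr_ge0 y; lra.
Qed.

Lemma cauchy_component_osc x y u v : `|u - x| <= 1 -> `|v - y| <= 1 ->
  `|x * rinv 1 x y - u * rinv 1 u v| <=
  18 / ((1 + `|x| + `|y|) * (1 + `|u| + `|v|)).
Proof.
move=> ux vy.
have n0 : 0 < 1 + `|x| + `|y| by rewrite !ltr_wpDr.
have m0 : 0 < 1 + `|u| + `|v| by rewrite !ltr_wpDr.
have r0 := rinv_gt0 x y (@ltr01 R); have s0 := rinv_gt0 u v (@ltr01 R).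
have rE := rinvE x y (@ltr01 R); have sE := rinvE u v (@ltr01 R).
have rl := rinv1_le x y; have sl := rinv1_le u v.
pose num := (x * u - y * v) * (u - x) + (x * v + y * u) * (v - y) - (u - x).
have -> : x * rinv 1 x y - u * rinv 1 u v = num * (rinv 1 x y * rinv 1 u v).
  transitivity (x * rinv 1 x y * ((u * u + v * v + 1 * 1) * rinv 1 u v) -
    u * rinv 1 u v * ((x * x + y * y + 1 * 1) * rinv 1 x y)).
    by rewrite rE sE !mulr1.
  by rewrite /num; ring.
set n := 1 + `|x| + `|y| in n0 rl *; set m := 1 + `|u| + `|v| in m0 sl *.
have nn : `|num| <= 2 * (n * m).
  have a1 : `|x * u - y * v| <= `|x| * `|u| + `|y| * `|v|.
    by rewrite (le_trans (ler_normB _ _))// !normrM.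
  have a2 : `|x * v + y * u| <= `|x| * `|v| + `|y| * `|u|.
    by rewrite (le_trans (ler_normD _ _))// !normrM.
  have b1 : `|(x * u - y * v) * (u - x)| <= `|x| * `|u| + `|y| * `|v|.
    rewrite normrM -[leRHS]mulr1; exact: ler_pM.
  have b2 : `|(x * v + y * u) * (v - y)| <= `|x| * `|v| + `|y| * `|u|.
    rewrite normrM -[leRHS]mulr1; exact: ler_pM.
  rewrite /num (le_trans (ler_normB _ _))//.
  apply: le_trans (lerD (ler_normD _ _) (lexx _)) _.
  rewrite /n /m; move: b1 b2 ux; have := normr_ge0 x; have := normr_ge0 y.
  have := normr_ge0 u; have := normr_ge0 v.
  move: `|x| `|y| `|u| `|v| `|_ * (u - x)| `|_ * (v - y)| `|u - x|
    => A B U V c1 c2 c3 V0 U0 B0 A0 h1 h2 h3.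
  have := mulr_ge0 A0 U0; have := mulr_ge0 B0 V0; have := mulr_ge0 A0 V0.
  have := mulr_ge0 B0 U0; lra.
rewrite normrM [X in _ * X]gtr0_norm ?mulr_gt0//.
have h := ler_pM (normr_ge0 _) (ltW (mulr_gt0 r0 s0)) nn
  (ler_pM (ltW r0) (ltW s0) rl sl).
apply: le_trans h _; rewrite le_eqVlt; apply/orP; left; apply/eqP.
by field; rewrite !gt_eqF.
Qed.

(** The regularized kernel is quadratic in the components x/rho and y/rho of the
    regularized Cauchy kernel. These are O(1/|z|) and vary by O(1/|z|^2) on a
    unit square. *)
Lemma smooth_osc x y u v : `|u - x| <= 1 -> `|v - y| <= 1 ->
  `|smooth_re 1 x y - smooth_re 1 u v| <= 1296 / (1 + `|x| + `|y|) ^+ 3 /\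
  `|smooth_im 1 x y - smooth_im 1 u v| <= 1296 / (1 + `|x| + `|y|) ^+ 3.
Proof.
move=> ux vy.
have n0 : 0 < 1 + `|x| + `|y| by rewrite !ltr_wpDr.
have m0 : 0 < 1 + `|u| + `|v| by rewrite !ltr_wpDr.
have p1 := cauchy_component_le x y; have p2 := cauchy_component_le u v.
have q1 := cauchy_component_le y x; have q2 := cauchy_component_le v u.
have op := cauchy_component_osc ux vy; have oq := cauchy_component_osc vy ux.
rewrite ![1 + `|y| + `|x|]addrAC ![1 + `|v| + `|u|]addrAC ![rinv 1 y x]rinv_swap
  ![rinv 1 v u]rinv_swap in q1 q2 oq.
have mn : (1 + `|u| + `|v|)^-1 <= 3 / (1 + `|x| + `|y|).
  rewrite invf_ple ?posrE ?divr_gt0// invf_div ler_pdivrMr//.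
  have : `|x| <= `|u| + `|u - x| by rewrite -[X in `|X| <= _](subKr u) ler_normB.
  have : `|y| <= `|v| + `|v - y| by rewrite -[X in `|X| <= _](subKr v) ler_normB.
  by have := normr_ge0 u; have := normr_ge0 v; lra.
rewrite !invfM !mulrA in op oq.
move: mn p1 p2 q1 q2 op oq; rewrite /smooth_re /smooth_im -exprVn.
set n := (1 + `|x| + `|y|)^-1; set m := (1 + `|u| + `|v|)^-1.
have nn : 0 < n by rewrite invr_gt0.
have mm : 0 < m by rewrite invr_gt0.
set r := rinv 1 x y; set s := rinv 1 u v => mn p1 p2 q1 q2 op oq.
have prodle (a b a' b' : R) : `|a| <= 3 * n -> `|a'| <= 3 * m ->
    `|b| <= 3 * n -> `|b'| <= 3 * m ->
    `|a - a'| <= 18 * n * m -> `|b - b'| <= 18 * n * m ->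
    `|a * b - a' * b'| <= 648 * n ^+ 3.
  move=> ha ha' hb hb' hab hab'.
  have -> : a * b - a' * b' = (a - a') * b + a' * (b - b') by ring.
  rewrite (le_trans (ler_normD _ _))// !normrM.
  have h1 := ler_pM (normr_ge0 _) (normr_ge0 _) hab hb.
  have h2 := ler_pM (normr_ge0 _) (normr_ge0 _) ha' hab'.
  apply: le_trans (lerD h1 h2) _.
  have k1 : n * n * m <= 3 * (n * n * n).
    by rewrite mulrCA ler_wpM2l// ?mulr_ge0 ?ltW.
  have k2 : n * (m * m) <= n * (9 * (n * n)).
    rewrite ler_wpM2l ?(ltW nn)//.
    by have := ler_pM (ltW mm) (ltW mm) mn mn; lra.
  by rewrite !exprS expr0; lra.
have A := prodle _ _ _ _ p1 p2 p1 p2 op op.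
have B := prodle _ _ _ _ q1 q2 q1 q2 oq oq.
have Cc := prodle _ _ _ _ p1 p2 q1 q2 op oq.
split.
  have -> : (x * x - y * y) * (r * r) - (u * u - v * v) * (s * s) =
    (x * r * (x * r) - u * s * (u * s)) - (y * r * (y * r) - v * s * (v * s)).
    by ring.
  by rewrite (le_trans (ler_normB _ _))//; lra.
have -> : - (2 * x * y) * (r * r) - - (2 * u * v) * (s * s) =
  - 2 * (x * r * (y * r) - u * s * (v * s)) by ring.
by rewrite normrM normrN (@ger0_norm _ 2)//; lra.
Qed.

Lemma regularization_error (n : R -> R -> R) x y :
  `|n x y| <= x * x + y * y -> 0 < x * x + y * y ->
  `|n x y * ((x * x + y * y)^-1 * (x * x + y * y)^-1) -
    n x y * (rinv 1 x y * rinv 1 x y)| <=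
  2 / ((x * x + y * y) * (1 + (x * x + y * y))).
Proof.
rewrite /rinv mulr1; set s := x * x + y * y; move: (n x y) => m ms s0.
have s1 : 0 < s + 1 by rewrite addr_gt0.
have -> : m * (s^-1 / s) - m * ((s + 1)^-1 / (s + 1)) =
  (m / s) * ((2 * s + 1) / (s * (s + 1) ^+ 2)).
  by field; rewrite !gt_eqF.
rewrite normrM -[leRHS]mul1r; apply: ler_pM => //.
  by rewrite normrM [X in _ * X]gtr0_norm ?invr_gt0// ler_pdivrMr// mul1r.
rewrite ger0_norm; last first.
  by rewrite divr_ge0 ?addr_ge0 ?mulr_ge0 ?sqr_ge0 ?ltW.
rewrite ler_pdivrMr ?mulr_gt0 ?exprn_gt0//.
rewrite [leRHS](_ : _ = 2 * (s + 1)); first by lra.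
by field; rewrite !gt_eqF// addrC.
Qed.

Let kernel_compare_explicit (x y u v D : R) : 0 < D ->
  D <= 5 / 2 * Num.max `|x| `|y| -> `|u - x| <= 1 -> `|v - y| <= 1 ->
  `|square_re x y * ((x * x + y * y)^-1 * (x * x + y * y)^-1) -
      smooth_re 1 u v| <= 20300 * decay D /\
  `|square_im x y * ((x * x + y * y)^-1 * (x * x + y * y)^-1) -
      smooth_im 1 u v| <= 20300 * decay D.
Proof.
move=> D0 Dm ux vy.
have dd := decay_gt0 D0.
set m := Num.max _ _ in Dm.
have m0 : 0 < m by lra.
have sm : m * m <= x * x + y * y.
  have hx : x * x = `|x| * `|x| by rewrite -!expr2 real_normK// num_real.
  have hy : y * y = `|y| * `|y| by rewrite -!expr2 real_normK// num_real.
  rewrite hx hy /m; case: (leP `|x| `|y|) => _.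
    by rewrite lerDr mulr_ge0.
  by rewrite lerDl mulr_ge0.
have nm : 1 + m <= 1 + `|x| + `|y|.
  rewrite /m; case: (leP `|x| `|y|) => _; have := normr_ge0 x; have := normr_ge0 y; lra.
have DD : 0 < D * D * (1 + D) by rewrite !mulr_gt0// addr_gt0.
have DE : D * D * (1 + D) * decay D = 1 by rewrite mulfV// gt_eqF.
have sD : 4 / 25 * (D * D) <= x * x + y * y by nra.
move: sm sD; set s := x * x + y * y => sm sD.
have s0 : 0 < s by nra.
have err : 2 / (s * (1 + s)) <= 50 * decay D.
  rewrite ler_pdivrMr; last by rewrite mulr_gt0// addr_gt0.
  have : D * D * (1 + D) <= 25 * (s * (1 + s)).
    have h1 : D * D <= 25 / 4 * s by lra.
    have h2 : 1 + D <= 4 * (1 + s).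
      by have := sqr_ge0 (D - 2); rewrite expr2; nra.
    have D0' : 0 <= D * D by rewrite mulr_ge0// ltW.
    have D1' : 0 <= 1 + D by rewrite addr_ge0// ltW.
    by have := ler_pM D0' D1' h1 h2; lra.
  by move=> h; have := ler_wpM2l (ltW dd) h; rewrite mulrC DE; lra.
have osc : 1296 / (1 + `|x| + `|y|) ^+ 3 <= 20250 * decay D.
  rewrite ler_pdivrMr; last by rewrite exprn_gt0// !ltr_wpDr.
  have h : 2 / 5 * (1 + D) <= 1 + `|x| + `|y| by lra.
  have h3 : (2 / 5 * (1 + D)) ^+ 3 <= (1 + `|x| + `|y|) ^+ 3.
    by rewrite lerXn2r ?nnegrE ?mulr_ge0 ?addr_ge0// ltW.
  have : 8 / 125 * (D * D * (1 + D)) <= (1 + `|x| + `|y|) ^+ 3.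
    apply: le_trans h3; rewrite !exprS expr0; nra.
  by move=> k; have := ler_wpM2l (ltW dd) k; rewrite mulrCA [decay D * _]mulrC DE; lra.
have [osc_re osc_im] := smooth_osc ux vy.
have e1 := regularization_error (square_re_le x y) s0.
have e2 := regularization_error (square_im_le x y) s0.
rewrite -/s in e1 e2.
split.
  apply: le_trans (ler_distD (smooth_re 1 x y) _ _) _.
  apply: le_trans (lerD (le_trans e1 err) (le_trans osc_re osc)) _.
  by clear; lra.
apply: le_trans (ler_distD (smooth_im 1 x y) _ _) _.
apply: le_trans (lerD (le_trans e2 err) (le_trans osc_im osc)) _.
by clear; lra.
Qed.

(** Regularizing at scale one costs O(1/|z|^4) at large distances, and moving to
    another point of a unit square costs O(1/|z|^3); for small distances the
    size of the kernel is all that is used. *)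
Lemma kernel_compare : exists2 c : R, 12 <= c &
  forall x y u v D : R, 0 < D ->
  D <= 5 / 2 * Num.max `|x| `|y| -> `|u - x| <= 1 -> `|v - y| <= 1 ->
  `|square_re x y * ((x * x + y * y)^-1 * (x * x + y * y)^-1) -
      smooth_re 1 u v| <= c * decay D /\
  `|square_im x y * ((x * x + y * y)^-1 * (x * x + y * y)^-1) -
      smooth_im 1 u v| <= c * decay D.
Proof.
by exists 20300; [lra|exact: kernel_compare_explicit].
Qed.

End kernel_comparison.

Lemma sqr_lt_of_max (R : realType) (e x y : R) : 0 < e ->
  e < Num.max `|x| `|y| -> e * e < x * x + y * y.
Proof.
move=> e0 em.
have hx : x * x = `|x| * `|x| by rewrite -!expr2 real_normK// num_real.
have hy : y * y = `|y| * `|y| by rewrite -!expr2 real_normK// num_real.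
rewrite hx hy; move: em; have := normr_ge0 x; have := normr_ge0 y.
move: `|x| `|y| => a b b0 a0; rewrite lt_max => /orP[] h; nra.
Qed.

(** * Geometry of cubes with disjoint triples *)
Section cube_geometry.
Variable R : realType.
Local Notation plane := (plane R).
Implicit Types (Q S : dyadic) (z : plane).

Lemma cubeE Q : @cube R Q =
  `]side R Q * (didx1 Q)%:~R, side R Q * (didx1 Q + 1)%:~R[%classic `*`
  `]side R Q * (didx2 Q)%:~R, side R Q * (didx2 Q + 1)%:~R[%classic.
Proof.
apply/seteqP; split=> z /=; rewrite !in_itv /=.
  by case=> -> -> -> ->.
by case=> /andP[? ?] /andP[? ?]; split.
Qed.

Lemma measurable_cube Q : measurable (@cube R Q).
Proof. by rewrite cubeE; apply: measurableX; exact: measurable_itv. Qed.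

Lemma area_cube Q : area R (@cube R Q) = (side R Q ^+ 2)%:E.
Proof.
have s0 := side_gt0 R Q.
rewrite cubeE /area /= product_measure1E; try exact: measurable_itv.
transitivity (@lebesgue_measure R
    [set` `](side R Q * (didx1 Q)%:~R)%R, (side R Q * (didx1 Q + 1)%:~R)%R[] *
  @lebesgue_measure R
    [set` `](side R Q * (didx2 Q)%:~R)%R, (side R Q * (didx2 Q + 1)%:~R)%R[])%E.
  by [].
rewrite !lebesgue_measure_itv /= !lte_fin !ltr_pM2l// !ltr_int !ltzD1 !lexx.
rewrite -!EFinB -EFinM !intrD; congr EFin; ring.
Qed.

Lemma cube_center Q z : cube Q z ->
  `|z.1 - center1 R Q| < side R Q / 2 /\ `|z.2 - center2 R Q| < side R Q / 2.
Proof.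
case; rewrite !intrD /center1 /center2 => *.
by split; rewrite ltr_norml; apply/andP; split; lra.
Qed.

Lemma cube_diameter Q z z' : cube Q z -> cube Q z' ->
  `|z'.1 - z.1| <= side R Q /\ `|z'.2 - z.2| <= side R Q.
Proof.
case; rewrite !intrD => ? ? ? ? []; rewrite !intrD => ? ? ? ?.
by split; rewrite ler_norml; apply/andP; split; lra.
Qed.

(** Otherwise the point dividing the segment between the centers in the ratio of
    the side lengths would lie in both triples. *)
Lemma disjoint_triples Q S : dilate (3 : R) Q `&` dilate (3 : R) S = set0 ->
  3 / 2 * (side R Q + side R S) <=
  Num.max `|center1 R Q - center1 R S| `|center2 R Q - center2 R S|.
Proof.
move=> dis; rewrite leNgt; apply/negP; rewrite gt_max => /andP[h1 h2].
have q0 := side_gt0 R Q; have s0 := side_gt0 R S.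
have qs : 0 < side R Q + side R S by rewrite addr_gt0.
pose a := side R Q / (side R Q + side R S).
pose b := side R S / (side R Q + side R S).
have ab : a + b = 1 by rewrite -mulrDl mulfV// gt_eqF.
have a0 : 0 < a by rewrite divr_gt0.
have b0 : 0 < b by rewrite divr_gt0.
have ha (d : R) : `|d| < 3 / 2 * (side R Q + side R S) ->
    `|a * d| < 3 * side R Q / 2 /\ `|b * d| < 3 * side R S / 2.
  move=> hd; rewrite (normrM a) (normrM b) (gtr0_norm a0) (gtr0_norm b0).
  have -> : 3 * side R Q / 2 = a * (3 / 2 * (side R Q + side R S)).
    by rewrite /a; field; rewrite gt_eqF.
  have -> : 3 * side R S / 2 = b * (3 / 2 * (side R Q + side R S)).
    by rewrite /b; field; rewrite gt_eqF.
  by rewrite !ltr_pM2l.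
have [a1 b1] := ha _ h1; have [a2 b2] := ha _ h2.
pose z : plane := (center1 R Q - a * (center1 R Q - center1 R S),
                   center2 R Q - a * (center2 R Q - center2 R S)).
suff : (dilate (3 : R) Q `&` dilate (3 : R) S) z by rewrite dis.
have bE (u v : R) : u - a * (u - v) - v = b * (u - v).
  by rewrite -[b](addKr a) ab; ring.
split; split => /=; rewrite ?bE//.
  by rewrite addrAC subrr sub0r normrN.
by rewrite addrAC subrr sub0r normrN.
Qed.

Lemma separated_points Q S z w :
  dilate (3 : R) Q `&` dilate (3 : R) S = set0 -> cube Q z -> cube S w ->
  cube_dist R Q S <= 5 / 2 * Num.max `|z.1 - w.1| `|z.2 - w.2| /\
  side R Q + side R S <= Num.max `|z.1 - w.1| `|z.2 - w.2|.
Proof.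
move=> /disjoint_triples; rewrite /cube_dist; set m := Num.max _ _ => hm.
move=> /cube_center[z1 z2] /cube_center[w1 w2].
set d := Num.max _ _.
suff : m <= d + (side R Q + side R S) / 2 by move=> h; split; lra.
have step (p q c e : R) : `|p - c| < side R Q / 2 -> `|q - e| < side R S / 2 ->
    `|c - e| <= `|p - q| + (side R Q + side R S) / 2.
  move=> h1 h2; have -> : c - e = (p - q) - (p - c) + (q - e) by ring.
  apply: le_trans (ler_normD _ _) _.
  by apply: le_trans (lerD (ler_normB _ _) (lexx _)) _; lra.
rewrite /m ge_max; apply/andP; split.
  by apply: le_trans (step _ _ _ _ z1 w1) _; rewrite lerD2r le_max lexx.
by apply: le_trans (step _ _ _ _ z2 w2) _; rewrite lerD2r le_max lexx orbT.
Qed.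

End cube_geometry.

(** * The weighted bound for one real kernel *)
Section family_of_cubes.
Variables (R : realType) (t : R) (N : nat) (P : 'I_N -> dyadic).
Local Notation plane := (plane R).
Local Notation mu := (area R).
Local Notation l i := (side R (P i)).
Local Notation D i j := (cube_dist R (P i) (P j)).
Local Notation ind Q := (\1_(@cube R Q) : plane -> R).
Local Notation A := (@cubes_union R N P).
Local Notation unit_cell i :=
  (dyadic_at 0 (center1 R (P i)) (center2 R (P i))).
Local Notation conv k := (kernel_op mu (convolution_kernel k)).
Implicit Types (f : plane -> R) (z : plane).

Hypothesis t0 : 0 < t.
Hypothesis t2 : t < 2.
Hypothesis disjoint : forall i j : 'I_N, i != j ->
  dilate (3 : R) (P i) `&` dilate (3 : R) (P j) = set0.
Hypothesis pack : (pack_norm t P <= 1)%E.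

Lemma measurable_ind Q : measurable_fun setT (ind Q).
Proof. by apply: measurable_indic; exact: measurable_cube. Qed.

Lemma ind_ge0 Q z : 0 <= ind Q z.
Proof. by rewrite indicE. Qed.

Lemma ind1 Q z : cube Q z -> ind Q z = 1.
Proof. by move=> Qz; rewrite indicE mem_set. Qed.

Lemma ind0 Q z : ~ cube Q z -> ind Q z = 0.
Proof. by move=> Qz; rewrite indicE memNset. Qed.

Lemma measurable_union : measurable A.
Proof. by apply: fin_bigcup_measurable => // i _; exact: measurable_cube. Qed.

Lemma unit_cell_sub i z : cube (P i) z -> cube (unit_cell i) z.
Proof. exact: cube_sub_ancestor. Qed.

Lemma integral_ind Q : (\int[mu]_z (ind Q z)%:E = (side R Q ^+ 2)%:E)%E.
Proof.
rewrite -area_cube integral_indic ?setIT//; exact: measurable_cube.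
Qed.

Lemma integrable_ind Q : mu.-integrable setT (EFin \o ind Q).
Proof.
apply/integrableP; split; first by apply/measurable_EFinP; exact: measurable_ind.
rewrite (eq_integral (fun z => (ind Q z)%:E)); last first.
  by move=> z _ /=; rewrite ger0_norm// ind_ge0.
by rewrite integral_ind ltry.
Qed.

Lemma integral_weight (F : plane -> R) : measurable_fun setT F ->
  (forall z, 0 <= F z) ->
  (\int[mu]_z (F z * weight t P z)%:E =
   \sum_(i < N) (l i `^ (t - 2))%:E * \int[mu]_z (ind (P i) z * F z)%:E)%E.
Proof.
move=> mF F0.
have mi i : measurable_fun setT (fun z => (ind (P i) z * F z)%:E).
  apply/measurable_EFinP; apply: measurable_funM => //; exact: measurable_ind.
have i0 i z : 0 <= ind (P i) z * F z by rewrite mulr_ge0 ?ind_ge0.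
transitivity (\int[mu]_z (\sum_(i <- enum 'I_N)
    (l i `^ (t - 2))%:E * (ind (P i) z * F z)%:E))%E.
  apply: eq_integral => z _; rewrite big_enum /= /weight mulr_sumr -sumEFin.
  by apply: eq_bigr => i _; rewrite -EFinM; congr EFin; ring.
rewrite ge0_integral_sum//; last 2 first.
- by move=> i; apply: emeasurable_funM.
- by move=> i z _; rewrite -EFinM lee_fin mulr_ge0 ?powR_ge0.
rewrite big_enum /=; apply: eq_bigr => i _.
rewrite (ge0_integralZl_EFin _ measurableT _ (mi i)) ?powR_ge0//.
by move=> z _; rewrite lee_fin.
Qed.

Section one_function.
Variable f : plane -> R.
Hypothesis mf : measurable_fun setT f.
Hypothesis f2 : (\int[mu]_z (f z ^+ 2)%:E < +oo)%E.

Let if2 : mu.-integrable setT (EFin \o (fun z => f z ^+ 2)).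
Proof.
apply/integrableP; split; first by apply/measurable_EFinP; exact: measurable_funX.
rewrite (eq_integral (fun z => (f z ^+ 2)%:E))//.
by move=> z _ /=; rewrite ger0_norm// sqr_ge0.
Qed.

Lemma integrable_restrict_L2 (h : plane -> R) :
  mu.-integrable setT (EFin \o h) -> (forall z, 0 <= h z <= 1) ->
  mu.-integrable setT (EFin \o (fun z => h z * f z)).
Proof.
move=> ih h01.
have mh : measurable_fun setT h by apply/measurable_EFinP; case/integrableP: ih.
apply: (le_integrable measurableT _ _ (integrable_EFinD ih if2)).
  by apply/measurable_EFinP; exact: measurable_funM.
move=> z _ /=; rewrite lee_fin normrM; have /andP[h0 h1] := h01 z.
rewrite (ger0_norm h0) [leRHS]ger0_norm ?addr_ge0 ?sqr_ge0//.
by rewrite -(real_normK (num_real (f z))); have := normr_ge0 (f z); nra.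
Qed.

Lemma integrable_ind_union : mu.-integrable setT (EFin \o (\1_A : plane -> R)).
Proof.
have isum := @integrable_sum _ _ R mu setT measurableT _ (enum 'I_N) xpredT
  (fun i => EFin \o ind (P i)) (fun i _ => integrable_ind (P i)).
apply: (le_integrable measurableT _ _ isum).
  by apply/measurable_EFinP; apply: measurable_indic; exact: measurable_union.
move=> z _ /=; rewrite sumEFin big_enum /= lee_fin.
rewrite [leRHS]ger0_norm; last by apply: sumr_ge0 => i _; exact: ind_ge0.
have [[i _ Pz]|nA] := pselect (A z); last first.
  by rewrite indicE memNset// normr0; apply: sumr_ge0 => i _; exact: ind_ge0.
rewrite indicE mem_set; last by exists i.
rewrite normr1 (bigD1 i)//= ind1// lerDl sumr_ge0// => j _; exact: ind_ge0.
Qed.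

Let g z : R := \1_A z * f z.
Let fi i z : R := ind (P i) z * f z.

Let integrable_g : mu.-integrable setT (EFin \o g).
Proof.
apply: integrable_restrict_L2; first exact: integrable_ind_union.
by move=> z; rewrite indicE ler0n lern1 leq_b1.
Qed.

Let integrable_fi i : mu.-integrable setT (EFin \o fi i).
Proof.
apply: integrable_restrict_L2; first exact: integrable_ind.
by move=> z; rewrite indicE ler0n lern1 leq_b1.
Qed.

Definition mass i : R := \int[mu]_z (ind (P i) z * f z ^+ 2).

Lemma massE i : (\int[mu]_z (ind (P i) z * f z ^+ 2)%:E = (mass i)%:E)%E.
Proof.
rewrite /mass /Rintegral fineK//; apply: integrable_fin_num => //.
apply: (le_integrable measurableT _ _ if2).
  apply/measurable_EFinP; apply: measurable_funM; first exact: measurable_ind.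
  exact: measurable_funX.
move=> z _ /=; rewrite lee_fin normrM ler_piMl//.
by rewrite indicE ger0_norm// lern1 leq_b1.
Qed.

Lemma mass_ge0 i : 0 <= mass i.
Proof. by apply: Rintegral_ge0 => z _; rewrite mulr_ge0 ?ind_ge0 ?sqr_ge0. Qed.

Let first_moment i : R := \int[mu]_z (ind (P i) z * `|f z|).

Let first_moment_ge0 i : 0 <= first_moment i.
Proof. by apply: Rintegral_ge0 => z _; rewrite mulr_ge0 ?ind_ge0. Qed.

Let first_moment_sqr i : first_moment i ^+ 2 <= l i ^+ 2 * mass i.
Proof.
rewrite -lee_fin [leRHS]EFinM -massE.
have maf : measurable_fun setT (fun z => `|f z| : R) by exact: measurableT_comp.
have l0 := side_gt0 R (P i).
have := @sqr_integral_le _ _ R mu (ind (P i)) (fun z => `|f z|) (l i ^+ 2)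
  (measurable_ind (P i)) maf.
rewrite exprn_gt0// => /(_ erefl) H.
apply: le_trans (H _) _; first by rewrite -integral_ind; apply: ge0_le_integralT => z;
  rewrite ?lee_fin// ger0_norm// ind_ge0.
rewrite lee_wpmul2l ?lee_fin ?sqr_ge0//.
apply: ge0_le_integralT => z; rewrite lee_fin.
  by rewrite mulr_ge0// sqr_ge0.
by rewrite ger0_norm ?ind_ge0// real_normK// num_real.
Qed.

Let fi_sqr i : (\int[mu]_z (fi i z ^+ 2)%:E = (mass i)%:E)%E.
Proof.
rewrite -massE; apply: eq_integral => z _; congr EFin.
by rewrite /fi exprMn indicE; case: (_ \in _); rewrite ?expr1n// expr0n/= !mul0r.
Qed.

Let g_sqr_le : (\int[mu]_z (g z ^+ 2)%:E <= (\sum_i mass i)%:E)%E.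
Proof.
rewrite -sumEFin; under eq_bigr do rewrite -massE.
rewrite -[X in (_ <= X)%E]big_enum /= -ge0_integral_sum//; last 2 first.
- move=> i; apply/measurable_EFinP; apply: measurable_funM.
    exact: measurable_ind.
  exact: measurable_funX.
- by move=> i z _; rewrite lee_fin mulr_ge0 ?ind_ge0 ?sqr_ge0.
apply: ge0_le_integralT => z; first by rewrite lee_fin sqr_ge0.
rewrite sumEFin big_enum /= lee_fin /g exprMn.
have s0 (j : 'I_N) : 0 <= ind (P j) z * f z ^+ 2.
  by rewrite mulr_ge0 ?ind_ge0 ?sqr_ge0.
have [[i _ Pz]|nA] := pselect (A z); last first.
  by rewrite indicE memNset// expr0n/= mul0r sumr_ge0.
rewrite indicE mem_set; last by exists i.
by rewrite expr1n (bigD1 i)//= ind1// lerDl sumr_ge0.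
Qed.

(** The real and the imaginary part of the Beurling kernel satisfy the same
    estimates: n / |z|^4 is one of them and sm its regularization at scale
    one. *)
Section one_kernel.
Variables (n sm : R -> R -> R) (e c : R).
Hypothesis c12 : 12 <= c.
Hypothesis n_le : forall x y, `|n x y| <= x * x + y * y.
Hypothesis sm_le : forall x y, `|sm x y| <= 1.
Hypothesis mtr : kernel_measurable (convolution_kernel (truncated n e)).
Hypothesis msm : kernel_measurable (convolution_kernel sm).
Hypothesis trL2 : forall h : plane -> R, mu.-integrable setT (EFin \o h) ->
  (\int[mu]_z (conv (truncated n e) h z ^+ 2)%:E <=
   (20 * (pi ^+ 2) ^+ 2)%:E * \int[mu]_z (h z ^+ 2)%:E)%E.
Hypothesis smL2 : forall h : plane -> R, mu.-integrable setT (EFin \o h) ->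
  (\int[mu]_z (conv sm h z ^+ 2)%:E <=
   ((pi ^+ 2) ^+ 2)%:E * \int[mu]_z (h z ^+ 2)%:E)%E.
Hypothesis compare : forall x y u v d : R, 0 < d ->
  d <= 5 / 2 * Num.max `|x| `|y| -> `|u - x| <= 1 -> `|v - y| <= 1 ->
  `|n x y * ((x * x + y * y)^-1 * (x * x + y * y)^-1) - sm u v| <=
  c * decay d.
Hypothesis e0 : 0 < e.
Hypothesis e_small : forall i, e < l i.

Let tr z w : R := convolution_kernel (truncated n e) z w.
Let smk z w : R := convolution_kernel sm z w.

(** For w in another cube P_j this is the comparison of kernels; truncation does
    not interfere, the distance from z to w exceeding e. For w in P_i the
    truncated kernel cancels, and the bound one of the regularized kernel is at
    most 12 times the diagonal entry of the error kernel, D_ii being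
    2 l(P_i) <= 2. *)
Let remainder_kernel_le i z z' w : cube (P i) z -> cube (unit_cell i) z' ->
  `|(tr z w * (1 - ind (P i) w) - smk z' w) * \1_A w| <=
  c * \sum_(j < N) decay (D i j) * ind (P j) w.
Proof.
move=> Pz Qz'.
have dec_ge0 j : 0 <= decay (D i j) * ind (P j) w.
  by rewrite mulr_ge0 ?ind_ge0// ltW// decay_gt0// cube_dist_gt0.
have c0 : 0 <= c by apply: le_trans c12.
have single j : cube (P j) w ->
    decay (D i j) <= \sum_(k < N) decay (D i k) * ind (P k) w.
  by move=> Pw; rewrite (bigD1 j)//= ind1// mulr1 lerDl sumr_ge0.
have [[j _ Pjw]|nA] := pselect (A w); last first.
  have -> : (\1_A : plane -> R) w = 0 by rewrite indicE memNset.
  rewrite mulr0 normr0; apply: mulr_ge0 => //; exact: sumr_ge0.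
have -> : (\1_A : plane -> R) w = 1 by rewrite indicE mem_set//; exists j.
rewrite mulr1.
have [Piw|nPiw] := pselect (cube (P i) w).
  rewrite ind1// subrr mulr0 sub0r normrN.
  apply: (le_trans (sm_le _ _)).
  apply: (@le_trans _ _ (12 * decay (D i i))); last first.
    apply: ler_pM => //; last exact: single.
    by rewrite ltW// decay_gt0// cube_dist_gt0.
  have l1 := side_le1 R (P i); have l0 := side_gt0 R (P i).
  have Dii : D i i = 2 * l i.
    by rewrite /cube_dist !subrr normr0 maxxx add0r; ring.
  rewrite /decay Dii ler_pdivlMr ?mul1r; last by rewrite !mulr_gt0 ?addr_gt0 ?mulr_gt0.
  have h1 : 2 * l i * (2 * l i) <= 4 by nra.
  have h2 : 1 + 2 * l i <= 3 by lra.
  rewrite (_ : 12 = 4 * 3 :> R); last by rewrite -natrM.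
  by apply: ler_pM => //; rewrite ?addr_ge0 ?mulr_ge0 ?(ltW l0).
have ji : i != j by apply/eqP => ij; move: Pjw; rewrite -ij.
have [h1 h2] := separated_points (disjoint ji) Pz Pjw.
rewrite ind0// subr0 mulr1.
apply: (@le_trans _ _ (c * decay (D i j))); last first.
  by rewrite ler_wpM2l// single.
have m1 := cube_diameter (unit_cell_sub Pz) Qz'.
have s1 : side R (unit_cell i) = 1 by rewrite /side /= expr0 invr1.
rewrite s1 in m1; case: m1 => m1 m2.
have -> : tr z w = n (z.1 - w.1) (z.2 - w.2) *
    (((z.1 - w.1) * (z.1 - w.1) + (z.2 - w.2) * (z.2 - w.2))^-1 *
     ((z.1 - w.1) * (z.1 - w.1) + (z.2 - w.2) * (z.2 - w.2))^-1).
  rewrite /tr /convolution_kernel /truncated ifT//.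
  move: h2; move: (z.1 - w.1) (z.2 - w.2) => x y h2.
  have li := e_small i; have lj := side_gt0 R (P j).
  by apply: sqr_lt_of_max => //; apply: lt_le_trans h2; rewrite ltr_wpDr// ltW.
apply: compare => //; first exact: cube_dist_gt0.
  by rewrite (_ : _ - _ = z'.1 - z.1)//; ring.
by rewrite (_ : _ - _ = z'.2 - z.2)//; ring.
Qed.

Let tr_le z w : `|tr z w| <= (e * e)^-1.
Proof. exact: truncated_le. Qed.

Let tail i : R := \sum_(j < N) decay (D i j) * first_moment j.

Let integrable_first_moment j :
  mu.-integrable setT (EFin \o (fun w => ind (P j) w * `|f w|)).
Proof.
have := integrable_norm (integrable_fi j).
apply: eq_integrable => // w _ /=.
by rewrite /fi normrM (ger0_norm (ind_ge0 _ _)).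
Qed.

Let integral_tail i :
  (\int[mu]_w (\sum_(j < N) (decay (D i j) * (ind (P j) w * `|f w|))%:E) =
   (tail i)%:E)%E.
Proof.
transitivity (\int[mu]_w (\sum_(j <- enum 'I_N)
    (decay (D i j) * (ind (P j) w * `|f w|))%:E))%E.
  by apply: eq_integral => w _; rewrite big_enum.
rewrite (integral_sum measurableT (fun j => integrable_EFinZ (decay (D i j))
  (integrable_first_moment j))) /= big_enum /= /tail -sumEFin.
apply: eq_bigr => j _.
rewrite EFinM /first_moment /Rintegral fineK; last first.
  by apply: integrable_fin_num => //; exact: integrable_first_moment.
rewrite -integralZl//; exact: integrable_first_moment.
Qed.

Let remainder_le i z z' : cube (P i) z -> cube (unit_cell i) z' ->
  `|conv (truncated n e) g z - conv (truncated n e) (fi i) z - conv sm g z'| <=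
  c * tail i.
Proof.
move=> Pz Qz'.
have i1 := integrable_kernel mtr (tr_le z) integrable_g.
have i2 := integrable_kernel mtr (tr_le z) (integrable_fi i).
have sm1 w : `|convolution_kernel sm z' w| <= 1 by exact: sm_le.
have i3 := integrable_kernel msm sm1 integrable_g.
rewrite /kernel_op -RintegralB// -RintegralB//; last first.
  exact: eq_integrable (integrableB measurableT i1 i2).
set h := fun w => _ - _ - _.
have hE w : h w = ((tr z w * (1 - ind (P i) w) - smk z' w) * \1_A w) * f w.
  rewrite /h /fi /g /tr /smk.
  have -> : ind (P i) w = ind (P i) w * \1_A w :> R.
    have [Pw|nPw] := pselect (cube (P i) w); last by rewrite ind0// mul0r.
    by rewrite [\1_A w]indicE mem_set ?mulr1//; exists i.
  have [Aw|nAw] := pselect (A w).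
    by rewrite [\1_A w]indicE mem_set//=; ring.
  by rewrite [\1_A w]indicE memNset//=; ring.
have h_le w : `|h w| <= c *
    \sum_(j < N) decay (D i j) * (ind (P j) w * `|f w|).
  rewrite hE normrM; under eq_bigr do rewrite mulrA.
  by rewrite -mulr_suml mulrA ler_wpM2r// remainder_kernel_le.
have ih : mu.-integrable setT (EFin \o h).
  exact: eq_integrable (integrableB measurableT
    (integrableB measurableT i1 i2) i3).
have n0 : 0 <= \int[mu]_w `|h w| by exact: Rintegral_ge0.
apply: le_trans (le_normr_Rintegral measurableT ih) _.
rewrite -lee_fin /Rintegral fineK; last first.
  by apply: integrable_fin_num => //; exact: integrable_norm ih.
rewrite EFinM -integral_tail -ge0_integralZl//; last 3 first.
- rewrite (_ : (fun w => _) = (fun w =>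
    \sum_(j <- enum 'I_N) (decay (D i j) * (ind (P j) w * `|f w|))%:E)%E).
    apply: emeasurable_sum => j; apply: measurable_int.
    exact: integrable_EFinZ (integrable_first_moment j).
  by apply/funext => w; rewrite big_enum.
- move=> w _; rewrite sumEFin lee_fin; apply: sumr_ge0 => j _.
  by rewrite !mulr_ge0 ?ind_ge0// ltW// decay_gt0// cube_dist_gt0.
- by rewrite lee_fin; apply: le_trans c12.
apply: ge0_le_integralT => w; first by rewrite lee_fin.
by rewrite sumEFin -EFinM lee_fin.
Qed.

Let T := conv (truncated n e) g.
Let F := conv sm g.
Let loc i := conv (truncated n e) (fi i).

Let mT : measurable_fun setT T.
Proof.
apply: measurable_kernel_op => //; apply/measurable_EFinP.
exact: measurable_int integrable_g.
Qed.

Let mF : measurable_fun setT F.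
Proof.
apply: measurable_kernel_op => //; apply/measurable_EFinP.
exact: measurable_int integrable_g.
Qed.

Let mloc i : measurable_fun setT (loc i).
Proof.
apply: measurable_kernel_op => //; apply/measurable_EFinP.
exact: measurable_int (integrable_fi i).
Qed.

Let integral_F2_le :
  (\int[mu]_z (F z ^+ 2)%:E <= ((pi ^+ 2) ^+ 2 * \sum_i mass i)%:E)%E.
Proof.
apply: le_trans (smL2 integrable_g) _.
by rewrite [leRHS]EFinM lee_wpmul2l// lee_fin sqr_ge0.
Qed.

Let iF2 : mu.-integrable setT (EFin \o (fun z => F z ^+ 2)).
Proof.
apply/integrableP; split.
  by apply/measurable_EFinP; exact: measurable_funX.
rewrite (eq_integral (fun z => (F z ^+ 2)%:E)).
  exact: le_lt_trans integral_F2_le (ltry _).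
by move=> z _ /=; rewrite ger0_norm// sqr_ge0.
Qed.

Let integrable_ind_F2 Q :
  mu.-integrable setT (EFin \o (fun z => ind Q z * F z ^+ 2)).
Proof.
apply: (le_integrable measurableT _ _ iF2).
  apply/measurable_EFinP; apply: measurable_funM; first exact: measurable_ind.
  exact: measurable_funX.
move=> z _ /=; rewrite lee_fin normrM ler_piMl//.
by rewrite indicE ger0_norm// lern1 leq_b1.
Qed.

Let cell_mass i : R := \int[mu]_z (ind (unit_cell i) z * F z ^+ 2).

Let cell_mass_ge0 i : 0 <= cell_mass i.
Proof. by apply: Rintegral_ge0 => z _; rewrite mulr_ge0 ?ind_ge0 ?sqr_ge0. Qed.

Let Rintegral_unit_cell i : \int[mu]_z ind (unit_cell i) z = 1.
Proof.
by rewrite /Rintegral integral_ind /side /= expr0 invr1 expr1n.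
Qed.

(** The estimate holds for every point of the unit square, so the term in F can
    be replaced by its average: a pointwise value of F could not be controlled
    by the L^2 norm of F. *)
Let pointwise_bound i z : cube (P i) z ->
  T z ^+ 2 <= 3 * loc i z ^+ 2 + (3 * cell_mass i + 3 * (c * tail i) ^+ 2).
Proof.
move=> Pz.
set a := T z ^+ 2; set b := 3 * loc i z ^+ 2 + 3 * (c * tail i) ^+ 2.
have i1 := integrable_ind (unit_cell i).
have i2 := integrable_ind_F2 (unit_cell i).
have -> : a = \int[mu]_w (a * ind (unit_cell i) w).
  by rewrite RintegralZl// Rintegral_unit_cell mulr1.
have -> : 3 * loc i z ^+ 2 + (3 * cell_mass i + 3 * (c * tail i) ^+ 2) =
   \int[mu]_w (b * ind (unit_cell i) w + 3 * (ind (unit_cell i) w * F w ^+ 2)).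
  rewrite RintegralD//; [|exact: integrable_EFinZ i1|exact: integrable_EFinZ i2].
  rewrite !RintegralZl// Rintegral_unit_cell -/(cell_mass i) /b; ring.
apply: le_Rintegral => //.
- exact: integrable_EFinZ i1.
- exact: integrable_EFinD (integrable_EFinZ b i1) (integrable_EFinZ 3 i2).
move=> w _; have [Qw|nQw] := pselect (cube (unit_cell i) w); last first.
  by rewrite ind0// !mulr0 mul0r mulr0 addr0.
rewrite ind1// !mulr1 mul1r.
have := remainder_le Pz Qw; rewrite -/(T z) -/(loc i z) -/(F w).
rewrite /a /b; move: (T z) (loc i z) (F w) (c * tail i) => p q r s h.
have s0 : 0 <= s by exact: le_trans (normr_ge0 _) h.
have h2 : (p - q - r) ^+ 2 <= s ^+ 2.
  by rewrite -(real_normK (num_real (p - q - r))) lerXn2r ?nnegrE.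
have -> : p = q + r + (p - q - r) by ring.
move: (p - q - r) h2 => v h2.
have := sqr_ge0 (q - r); have := sqr_ge0 (q - v); have := sqr_ge0 (r - v).
rewrite !expr2 in h2 *; lra.
Qed.

Let cube_bound i : (\int[mu]_z (ind (P i) z * T z ^+ 2)%:E <=
  (60 * (pi ^+ 2) ^+ 2 * mass i +
   l i ^+ 2 * (3 * cell_mass i + 3 * (c * tail i) ^+ 2))%:E)%E.
Proof.
set K := 3 * cell_mass i + _.
have K0 : 0 <= K.
  by apply: addr_ge0; apply: mulr_ge0 => //; exact: sqr_ge0.
apply: (@le_trans _ _ (\int[mu]_z (3%:E * (loc i z ^+ 2)%:E +
    K%:E * (ind (P i) z)%:E))%E).
  apply: ge0_le_integralT => z.
    by rewrite lee_fin mulr_ge0 ?ind_ge0 ?sqr_ge0.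
  rewrite -!EFinM -EFinD lee_fin.
  have [Pz|nPz] := pselect (cube (P i) z).
    by rewrite ind1// mul1r mulr1 pointwise_bound.
  by rewrite ind0// mul0r mulr0 addr0 mulr_ge0 ?sqr_ge0.
have ml2 : measurable_fun setT (fun z => (loc i z ^+ 2)%:E).
  by apply/measurable_EFinP; exact: measurable_funX.
have mi : measurable_fun setT (fun z => (ind (P i) z)%:E).
  by apply/measurable_EFinP; exact: measurable_ind.
rewrite ge0_integralD//; last 4 first.
- by move=> z _; rewrite -EFinM lee_fin mulr_ge0 ?sqr_ge0.
- by apply: emeasurable_funM.
- by move=> z _; rewrite -EFinM lee_fin mulr_ge0 ?ind_ge0.
- by apply: emeasurable_funM.
rewrite (ge0_integralZl_EFin _ measurableT _ ml2)//; last first.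
  by move=> z _; rewrite lee_fin sqr_ge0.
rewrite (ge0_integralZl_EFin _ measurableT _ mi)//.
rewrite integral_ind [leRHS]EFinD; apply: leeD; last by rewrite -EFinM mulrC.
apply: le_trans (lee_wpmul2l _ (trL2 (integrable_fi i))) _ => //.
rewrite fi_sqr -!EFinM lee_fin; lra.
Qed.

(** The packing condition for the unit square containing z. *)
Let weight_cells z : \sum_(i < N) l i `^ t * ind (unit_cell i) z <= 1.
Proof.
have := packing_le t0 pack (dyadic_at 0 z.1 z.2).
rewrite [side R (dyadic_at _ _ _)]/side /= expr0 invr1 powR1.
apply: le_trans; rewrite [leRHS]big_mkcond /=; apply: ler_sum => i _.
have [Qz|nQz] := pselect (cube (unit_cell i) z); last first.
  by rewrite ind0// mulr0; case: ifP => // _; exact: powR_ge0.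
rewrite ind1// mulr1 ifT//; apply/asboolP.
suff -> : dyadic_at 0 z.1 z.2 = unit_cell i by exact: unit_cell_sub.
case: Qz; rewrite /side /= expr0 invr1 !mul1r => h1 h2 h3 h4.
by congr Dyadic; rewrite expr0 !mul1r; apply: floor_def;
  apply/andP; split=> //; exact: ltW.
Qed.

(** The factor l(P_i)^t is the weight l(P_i)^(t-2) times the area of P_i. By
    packing, the unit squares carrying these masses have bounded overlap. *)
Let sum_cell_mass : \sum_(i < N) l i `^ t * cell_mass i <=
  (pi ^+ 2) ^+ 2 * \sum_i mass i.
Proof.
rewrite -lee_fin; apply: le_trans integral_F2_le.
have E i : (l i `^ t * cell_mass i)%:E =
    (\int[mu]_z (l i `^ t * (ind (unit_cell i) z * F z ^+ 2))%:E)%E.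
  rewrite EFinM /cell_mass /Rintegral fineK; last first.
    exact: integrable_fin_num (integrable_ind_F2 _).
  by rewrite -(integralZl measurableT (integrable_ind_F2 (unit_cell i))).
rewrite -sumEFin; under eq_bigr do rewrite E.
rewrite -[leLHS]big_enum /= -ge0_integral_sum//; last 2 first.
- move=> i; apply: measurable_int.
  exact: integrable_EFinZ (integrable_ind_F2 (unit_cell i)).
- move=> i z _; rewrite lee_fin mulr_ge0 ?powR_ge0// mulr_ge0 ?ind_ge0//.
  exact: sqr_ge0.
apply: ge0_le_integralT => z.
  rewrite sumEFin lee_fin; apply: sumr_ge0 => i _.
  by rewrite mulr_ge0 ?powR_ge0// mulr_ge0 ?ind_ge0 ?sqr_ge0.
rewrite sumEFin big_enum /= lee_fin.
under eq_bigr do rewrite mulrA.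
by rewrite -mulr_suml ler_piMl ?sqr_ge0.
Qed.

Definition column_constant (u : R) : R := 86 / (1 - 2 `^ (u - 2)).

Lemma column_constant_ge0 : 0 <= column_constant t.
Proof.
rewrite /column_constant divr_ge0// subr_ge0.
rewrite -[t - 2]opprB powRN invf_le1 ?powR_gt0//.
apply: (@le_trans _ _ (2 `^ 0)); first by rewrite powRr0.
by apply: ler_powR; rewrite ?ler1n// subr_ge0 ltW.
Qed.

(** The error term: the first moments are turned into masses by the
    Cauchy-Schwarz inequality on each cube. *)
Let sum_tail : \sum_(i < N) l i `^ t * tail i ^+ 2 <=
  (16 * column_constant t) ^+ 2 * \sum_(i < N) l i `^ (t - 2) * mass i.
Proof.
have lp i : 0 < l i by exact: side_gt0.
have := @positive_kernel_L2 R N (fun i j => decay (D i j)) (fun i => l i `^ t)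
  (fun i => l i `^ (t - 2)) first_moment 8 (column_constant t).
rewrite (_ : 2 * 8 = 16 :> R); last by rewrite -natrM.
move=> H; apply: (le_trans (H _ _ _ _ _ _ _ _)) => {H} //.
- by move=> i j; rewrite ltW// decay_gt0// cube_dist_gt0.
- by move=> i j; rewrite cube_distC.
- move=> i j k; apply: decay_three_points; try exact: cube_dist_gt0.
  exact: cube_dist_triangle.
- by move=> i; exact: powR_gt0.
- exact: column_constant_ge0.
- by move=> j; exact: column_bound.
rewrite ler_wpM2l ?sqr_ge0//; apply: ler_sum => j _.
have pj : 0 < l j `^ t by exact: powR_gt0.
have e2 : l j `^ (t - 2) = l j `^ t / l j ^+ 2.
  rewrite powRB; last by rewrite (gt_eqF (lp j)) implybT.
  by rewrite powR_mulrn// ltW.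
rewrite e2 expr2 (_ : _ / _ * _ / _ = l j `^ t / l j ^+ 2 / l j ^+ 2); last first.
  by field; rewrite !gt_eqF.
rewrite -mulrA ler_wpM2l//.
  by rewrite divr_ge0 ?sqr_ge0// ltW.
by rewrite ler_pdivrMl ?exprn_gt0// first_moment_sqr.
Qed.

(** The factor 3 comes from the square of a sum of three terms; the local term has
    the constant 20 pi^4 of the truncated transform, the regularized one pi^4. *)
Definition weighted_constant (u : R) : R :=
  63 * (pi ^+ 2) ^+ 2 + 3 * c ^+ 2 * (16 * column_constant u) ^+ 2.

Lemma weighted_sum_bound :
  (\sum_(i < N) (l i `^ (t - 2))%:E * \int[mu]_z (ind (P i) z * T z ^+ 2)%:E <=
   (weighted_constant t * \sum_(i < N) l i `^ (t - 2) * mass i)%:E)%E.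
Proof.
have lp i : 0 < l i by exact: side_gt0.
set S := \sum_(i < N) l i `^ (t - 2) * mass i.
have mS : \sum_i mass i <= S.
  apply: ler_sum => i _; rewrite ler_peMl ?mass_ge0//.
  rewrite -[t - 2]opprB powRN invf_ge1 ?powR_gt0//.
  apply: (@le_trans _ _ (1 `^ (2 - t))); last by rewrite powR1.
  by apply: ge0_ler_powR; rewrite ?nnegrE ?side_le1 ?(ltW (lp i)) ?subr_ge0 ?ltW.
apply: (@le_trans _ _ (\sum_(i < N) (l i `^ (t - 2) *
  (60 * (pi ^+ 2) ^+ 2 * mass i +
   l i ^+ 2 * (3 * cell_mass i + 3 * (c * tail i) ^+ 2)))%:E)%E).
  apply: lee_sum => i _; rewrite EFinM lee_wpmul2l ?lee_fin ?powR_ge0//.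
rewrite sumEFin lee_fin.
have e2 i : l i `^ (t - 2) * l i ^+ 2 = l i `^ t.
  rewrite powRB; last by rewrite (gt_eqF (lp i)) implybT.
  by rewrite powR_mulrn ?(ltW (lp i))// divfK// gt_eqF// exprn_gt0.
rewrite (eq_bigr (fun i => 60 * (pi ^+ 2) ^+ 2 * (l i `^ (t - 2) * mass i) +
    (3 * (l i `^ t * cell_mass i) + 3 * c ^+ 2 * (l i `^ t * tail i ^+ 2))));
  last by move=> i _; rewrite -e2; ring.
rewrite !big_split /= -!mulr_sumr -/S.
have h1 := sum_cell_mass; have h2 := sum_tail.
have p0 : 0 <= ((pi : R) ^+ 2) ^+ 2 by rewrite sqr_ge0.
have h3 := le_trans h1 (ler_wpM2l p0 mS).
have c2 : 0 <= c ^+ 2 by rewrite sqr_ge0.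
have h4 := ler_wpM2l c2 h2.
rewrite /weighted_constant -/S in h4 *.
apply: (@le_trans _ _ (60 * (pi ^+ 2) ^+ 2 * S +
  (3 * ((pi ^+ 2) ^+ 2 * S) +
   3 * (c ^+ 2 * ((16 * column_constant t) ^+ 2 * S))))); last first.
  rewrite le_eqVlt; apply/orP; left; apply/eqP; ring.
rewrite lerD2l; apply: lerD; first by rewrite ler_wpM2l.
by rewrite -[leLHS]mulrA ler_wpM2l.
Qed.

Lemma weighted_truncated_L2 :
  (\int[mu]_z (conv (truncated n e) (fun w => \1_A w * f w)%R z ^+ 2 *
                weight t P z)%:E <=
   (weighted_constant t)%:E * \int[mu]_z (f z ^+ 2 * weight t P z)%:E)%E.
Proof.
rewrite !integral_weight//; last 4 first.
- exact: measurable_funX.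
- by move=> z; exact: sqr_ge0.
- exact: measurable_funX.
- by move=> z; exact: sqr_ge0.
apply: le_trans weighted_sum_bound _; rewrite EFinM -sumEFin.
by under eq_bigr do rewrite EFinM -massE.
Qed.

End one_kernel.

End one_function.
End family_of_cubes.

(** * Passing to the principal value *)
Section principal_value.
Variable R : realType.
Local Open Scope ereal_scope.

Lemma limn_einf_ge0 (u : (\bar R)^nat) : (forall k, 0 <= u k) -> 0 <= limn_einf u.
Proof.
move=> u0; rewrite limn_einf_lim; apply: lime_ge; first exact: is_cvg_einfs.
by apply: nearW => k; apply: le_ereal_inf_tmp => _ [m /= _ <-].
Qed.

(** If the limit does not exist then [lim] is the default value zero, and the
    inequality is trivial. *)
Lemma sqr_lim_le (F : R -> R) (w : R) (eps : R^nat) : (0 <= w)%R ->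
  (forall k, 0 < eps k)%R -> (eps k @[k --> \oo] --> 0%R) ->
  ((lim (F x @[x --> 0%R^'+]) ^+ 2 * w)%R)%:E <=
  limn_einf (fun k => (F (eps k) ^+ 2 * w)%:E).
Proof.
move=> w0 eps0 epsl; have [Fc|Fd] := pselect (cvg (F x @[x --> 0%R^'+])).
  have Fe : F (eps k) @[k --> \oo] --> lim (F x @[x --> 0%R^'+]).
    exact: (cvg_at_rightP F 0%R _).1.
  have H : (F (eps k) ^+ 2 * w)%R @[k --> \oo] -->
      (lim (F x @[x --> 0%R^'+]) ^+ 2 * w)%R.
    by apply: cvgMl; exact: cvgM.
  have /cvg_limn_einf_sup[-> _] // :
    (F (eps k) ^+ 2 * w)%:E @[k --> \oo] -->
      (lim (F x @[x --> 0%R^'+]) ^+ 2 * w)%:E.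
  by apply: cvg_EFin => //; exact: nearW.
rewrite (dvgP Fd) (_ : point = 0%R :> R)// expr0n /= mul0r.
by apply: limn_einf_ge0 => k; rewrite lee_fin mulr_ge0// sqr_ge0.
Qed.

Lemma fatou_bound d (T : measurableType d) (mu : {measure set T -> \bar R})
    (f : (T -> \bar R)^nat) (B : \bar R) :
  (forall k, measurable_fun setT (f k)) -> (forall k x, 0 <= f k x) ->
  (forall k, \int[mu]_x f k x <= B) ->
  \int[mu]_x limn_einf (f ^~ x) <= B.
Proof.
move=> mf f0 fB.
apply: le_trans (fatou mu measurableT mf (fun k x _ => f0 k x)) _.
rewrite limn_einf_lim; apply: lime_le; first exact: is_cvg_einfs.
apply: nearW => k; apply: le_trans (fB k).
by apply: ereal_inf_lbound; exists k => /=.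
Qed.

Lemma measurable_limn_einf d (T : measurableType d) (f : (T -> \bar R)^nat) :
  (forall k, measurable_fun setT (f k)) ->
  measurable_fun setT (fun x => limn_einf (f ^~ x)).
Proof.
move=> mf; apply: measurableT_comp => //.
apply: measurable_fun_limn_esup => k.
exact: measurableT_comp.
Qed.

End principal_value.

(** * Real and imaginary parts of the truncated transform *)
Section complex_kernel.
Variable R : realType.
Local Notation plane := (plane R).
Local Notation mu := (area R).
Local Notation conv k := (kernel_op mu (convolution_kernel k)).
Local Open Scope complex_scope.

Lemma cabsE (c : R[i]) :
  cabs c ^+ 2 = complex.Re c ^+ 2 + complex.Im c ^+ 2.
Proof. by case: c => a b; rewrite /cabs /= sqr_sqrtr// addr_ge0// sqr_ge0. Qed.

Lemma sqr_cabs_scale (x a b : R) : x != 0 ->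
  cabs (- (x%:C)^-1 * (a +i* b)) ^+ 2 = (x ^+ 2)^-1 * (a ^+ 2 + b ^+ 2).
Proof.
move=> x0; rewrite cabsE /= expr0n /= addr0 mul0r !oppr0 !mul0r addr0 subr0.
by field.
Qed.

Lemma lt_cabs (e : R) (c : R[i]) : 0 < e ->
  (e < cabs c) = (e * e < complex.Re c * complex.Re c + complex.Im c * complex.Im c).
Proof.
move=> e0; have c0 : 0 <= cabs c by case: c => a b; rewrite /cabs /= sqrtr_ge0.
by rewrite -[_ + _ * _]/(_ * _ + _) -!expr2 -cabsE ltr_pXn2r// nnegrE ltW.
Qed.

Lemma re_div_sqr (a b x y : R) : x * x + y * y != 0 ->
  complex.Re ((a +i* b) / (x +i* y) ^+ 2) =
  square_re x y * ((x * x + y * y)^-1 * (x * x + y * y)^-1) * a -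
  square_im x y * ((x * x + y * y)^-1 * (x * x + y * y)^-1) * b.
Proof.
move=> s0; rewrite /square_re /square_im expr2 /=.
have s1 : (x * x - y * y) ^+ 2 + (x * y + y * x) ^+ 2 != 0.
  rewrite (_ : _ + _ = (x * x + y * y) ^+ 2); last by ring.
  by rewrite expf_neq0.
by field; rewrite s0 s1.
Qed.

Lemma im_div_sqr (a b x y : R) : x * x + y * y != 0 ->
  complex.Im ((a +i* b) / (x +i* y) ^+ 2) =
  square_re x y * ((x * x + y * y)^-1 * (x * x + y * y)^-1) * b +
  square_im x y * ((x * x + y * y)^-1 * (x * x + y * y)^-1) * a.
Proof.
move=> s0; rewrite /square_re /square_im expr2 /=.
have s1 : (x * x - y * y) ^+ 2 + (x * y + y * x) ^+ 2 != 0.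
  rewrite (_ : _ + _ = (x * x + y * y) ^+ 2); last by ring.
  by rewrite expf_neq0.
by field; rewrite s0 s1.
Qed.

Variable f : plane -> R[i].
Local Notation fr := (fun w => complex.Re (f w)).
Local Notation fm := (fun w => complex.Im (f w)).
Hypothesis fr_int : mu.-integrable setT (EFin \o fr).
Hypothesis fm_int : mu.-integrable setT (EFin \o fm).

Let integrable_tr_re h e z : 0 < e -> mu.-integrable setT (EFin \o h) ->
  mu.-integrable setT
    (EFin \o (fun w => convolution_kernel (truncated_re e) z w * h w)).
Proof.
move=> e0; apply: (@integrable_kernel _ _ _ _ _ _ _ _ (e * e)^-1).
  exact: kernel_measurable_truncated_re.
by move=> w; apply: truncated_le => //; exact: square_re_le.
Qed.

Let integrable_tr_im h e z : 0 < e -> mu.-integrable setT (EFin \o h) ->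
  mu.-integrable setT
    (EFin \o (fun w => convolution_kernel (truncated_im e) z w * h w)).
Proof.
move=> e0; apply: (@integrable_kernel _ _ _ _ _ _ _ _ (e * e)^-1).
  exact: kernel_measurable_truncated_im.
by move=> w; apply: truncated_le => //; exact: square_im_le.
Qed.

Lemma re_beurling_trunc e z : 0 < e ->
  complex.Re (beurling_trunc f z e) =
  conv (truncated_re e) fr z - conv (truncated_im e) fm z.
Proof.
move=> e0; rewrite /kernel_op -RintegralB//; last 2 first.
- exact: integrable_tr_re.
- exact: integrable_tr_im.
transitivity (\int[mu]_(w in [set w | e < cabs (toC z - toC w)])
  complex.Re (f w / (toC z - toC w) ^+ 2)) => //.
rewrite Rintegral_mkcond; apply: eq_Rintegral => w _.
rewrite patchE /convolution_kernel /truncated_re /truncated_im /truncated.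
rewrite (_ : (w \in _) = (e * e < (z.1 - w.1) * (z.1 - w.1) +
    (z.2 - w.2) * (z.2 - w.2))); last first.
  by rewrite -[RHS](lt_cabs (toC z - toC w) e0); apply/idP/idP; rewrite in_setE.
case: ifPn => [h|_]; last by rewrite !mul0r subrr.
case: (f w) => a b; rewrite re_div_sqr//.
by rewrite gt_eqF// (lt_trans _ h)// mulr_gt0.
Qed.

Lemma im_beurling_trunc e z : 0 < e ->
  complex.Im (beurling_trunc f z e) =
  conv (truncated_re e) fm z + conv (truncated_im e) fr z.
Proof.
move=> e0; rewrite /kernel_op -RintegralD//; last 2 first.
- exact: integrable_tr_re.
- exact: integrable_tr_im.
transitivity (\int[mu]_(w in [set w | e < cabs (toC z - toC w)])
  complex.Im (f w / (toC z - toC w) ^+ 2)) => //.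
rewrite Rintegral_mkcond; apply: eq_Rintegral => w _.
rewrite patchE /convolution_kernel /truncated_re /truncated_im /truncated.
rewrite (_ : (w \in _) = (e * e < (z.1 - w.1) * (z.1 - w.1) +
    (z.2 - w.2) * (z.2 - w.2))); last first.
  by rewrite -[RHS](lt_cabs (toC z - toC w) e0); apply/idP/idP; rewrite in_setE.
case: ifPn => [h|_]; last by rewrite !mul0r addr0.
case: (f w) => a b; rewrite im_div_sqr//.
by rewrite gt_eqF// (lt_trans _ h)// mulr_gt0.
Qed.

End complex_kernel.

(** * The weighted bound for the Beurling transform *)
Section weighted_beurling.
Variables (R : realType) (t : R) (N : nat) (P : 'I_N -> dyadic) (c : R).
Local Notation plane := (plane R).
Local Notation mu := (area R).
Local Notation conv k := (kernel_op mu (convolution_kernel k)).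
Local Notation A := (@cubes_union R N P).
Local Notation w := (weight t P).
Hypothesis t0 : 0 < t.
Hypothesis t2 : t < 2.
Hypothesis disjoint : forall i j : 'I_N, i != j ->
  dilate (3 : R) (P i) `&` dilate (3 : R) (P j) = set0.
Hypothesis pack : (pack_norm t P <= 1)%E.
Hypothesis c12 : 12 <= c.
Hypothesis compare : forall x y u v D : R, 0 < D ->
  D <= 5 / 2 * Num.max `|x| `|y| -> `|u - x| <= 1 -> `|v - y| <= 1 ->
  `|square_re x y * ((x * x + y * y)^-1 * (x * x + y * y)^-1) -
      smooth_re 1 u v| <= c * decay D /\
  `|square_im x y * ((x * x + y * y)^-1 * (x * x + y * y)^-1) -
      smooth_im 1 u v| <= c * decay D.

Lemma truncated_re_weighted (h : plane -> R) e : measurable_fun setT h ->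
  (\int[mu]_z (h z ^+ 2)%:E < +oo)%E -> 0 < e ->
  (forall i, e < side R (P i)) ->
  (\int[mu]_z (conv (truncated_re e) (fun v => \1_A v * h v)%R z ^+ 2 * w z)%:E
   <= (weighted_constant c t)%:E * \int[mu]_z (h z ^+ 2 * w z)%:E)%E.
Proof.
move=> mh h2 e0 el.
apply: (@weighted_truncated_L2 _ _ _ _ t0 t2 disjoint pack _ mh h2 (@square_re R)
  (smooth_re 1) e c) => //.
- exact: square_re_le.
- move=> x y; apply: le_trans (smooth_re_le _ _ _) _ => //.
  by apply: le_trans (rinv_le _ _ _) _ => //; rewrite mulr1 invr1.
- exact: kernel_measurable_truncated_re.
- exact: kernel_measurable_re.
- by move=> g gi; exact: truncated_re_L2.
- by move=> g gi; exact: smooth_re_L2.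
- by move=> x y u v D D0 h1 h3 h4; have [] := compare D0 h1 h3 h4.
Qed.

Lemma truncated_im_weighted (h : plane -> R) e : measurable_fun setT h ->
  (\int[mu]_z (h z ^+ 2)%:E < +oo)%E -> 0 < e ->
  (forall i, e < side R (P i)) ->
  (\int[mu]_z (conv (truncated_im e) (fun v => \1_A v * h v)%R z ^+ 2 * w z)%:E
   <= (weighted_constant c t)%:E * \int[mu]_z (h z ^+ 2 * w z)%:E)%E.
Proof.
move=> mh h2 e0 el.
apply: (@weighted_truncated_L2 _ _ _ _ t0 t2 disjoint pack _ mh h2 (@square_im R)
  (smooth_im 1) e c) => //.
- exact: square_im_le.
- move=> x y; apply: le_trans (smooth_im_le _ _ _) _ => //.
  by apply: le_trans (rinv_le _ _ _) _ => //; rewrite mulr1 invr1.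
- exact: kernel_measurable_truncated_im.
- exact: kernel_measurable_im.
- by move=> g gi; exact: truncated_im_L2.
- by move=> g gi; exact: smooth_im_L2.
- by move=> x y u v D D0 h1 h3 h4; have [] := compare D0 h1 h3 h4.
Qed.

Lemma weight_ge0 z : 0 <= w z.
Proof.
by apply: sumr_ge0 => i _; rewrite mulr_ge0 ?powR_ge0// ind_ge0.
Qed.

Lemma measurable_weight : measurable_fun setT w.
Proof.
apply: measurable_sum => i; apply: measurable_funM => //.
exact: measurable_ind.
Qed.

Lemma weighted_sum_le (U V W : plane -> R) (a b : \bar R) :
  measurable_fun setT U -> measurable_fun setT V ->
  (forall z, W z ^+ 2 <= 2 * U z ^+ 2 + 2 * V z ^+ 2) ->
  (\int[mu]_z (U z ^+ 2 * w z)%:E <= a)%E ->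
  (\int[mu]_z (V z ^+ 2 * w z)%:E <= b)%E ->
  (\int[mu]_z (W z ^+ 2 * w z)%:E <= 2%:E * (a + b))%E.
Proof.
move=> mU mV WUV Ua Vb.
have p0 (F : plane -> R) z : 0 <= F z ^+ 2 * w z.
  by rewrite mulr_ge0 ?sqr_ge0 ?weight_ge0.
have mp (F : plane -> R) : measurable_fun setT F ->
    measurable_fun setT (fun z => (F z ^+ 2 * w z)%:E).
  move=> mF; apply/measurable_EFinP; apply: measurable_funM.
    exact: measurable_funX.
  exact: measurable_weight.
apply: (@le_trans _ _ (\int[mu]_z (2%:E * ((U z ^+ 2 * w z)%:E +
    (V z ^+ 2 * w z)%:E)))%E).
  apply: ge0_le_integralT => z; first by rewrite lee_fin.
  rewrite -EFinD -EFinM lee_fin -mulrDl mulrA mulrDr.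
  by rewrite ler_wpM2r ?weight_ge0.
rewrite ge0_integralZl_EFin//; last 2 first.
- by move=> z _; rewrite -EFinD lee_fin addr_ge0.
- by apply: emeasurable_funD; exact: mp.
rewrite ge0_integralD//; [|by move=> z _; rewrite lee_fin|exact: mp|
  by move=> z _; rewrite lee_fin|exact: mp].
by rewrite lee_wpmul2l// ?lee_fin// leeD.
Qed.

Section one_complex_function.
Variable f : plane -> R[i].
Local Notation fr := (fun v => complex.Re (f v)).
Local Notation fm := (fun v => complex.Im (f v)).
Hypothesis mfr : measurable_fun setT fr.
Hypothesis mfm : measurable_fun setT fm.
Hypothesis fr2 : (\int[mu]_z (fr z ^+ 2)%:E < +oo)%E.
Hypothesis fm2 : (\int[mu]_z (fm z ^+ 2)%:E < +oo)%E.
Local Notation Af := (restrict_to A f).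

Let Af_re v : complex.Re (Af v) = \1_A v * fr v.
Proof. by rewrite /restrict_to; case: (f v) => a b /=; rewrite mul0r subr0. Qed.

Let Af_im v : complex.Im (Af v) = \1_A v * fm v.
Proof. by rewrite /restrict_to; case: (f v) => a b /=; rewrite mul0r addr0. Qed.

Let ind01 (z : plane) : 0 <= (\1_A : plane -> R) z <= 1.
Proof. by rewrite indicE ler0n lern1 leq_b1. Qed.

Let iAf_re : mu.-integrable setT (EFin \o (fun v => complex.Re (Af v))).
Proof.
rewrite (_ : (fun v => _) = (fun v => \1_A v * fr v)); last first.
  by apply/funext => v.
exact: (@integrable_restrict_L2 _ _ mfr fr2 \1_A (integrable_ind_union R P) ind01).
Qed.

Let iAf_im : mu.-integrable setT (EFin \o (fun v => complex.Im (Af v))).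
Proof.
rewrite (_ : (fun v => _) = (fun v => \1_A v * fm v)); last first.
  by apply/funext => v.
exact: (@integrable_restrict_L2 _ _ mfm fm2 \1_A (integrable_ind_union R P) ind01).
Qed.

Let mconv_re e h : mu.-integrable setT (EFin \o h) ->
  measurable_fun setT (conv (truncated_re e) h).
Proof.
move=> hi; apply: measurable_kernel_op.
  exact: kernel_measurable_truncated_re.
by apply/measurable_EFinP; exact: measurable_int hi.
Qed.

Let mconv_im e h : mu.-integrable setT (EFin \o h) ->
  measurable_fun setT (conv (truncated_im e) h).
Proof.
move=> hi; apply: measurable_kernel_op.
  exact: kernel_measurable_truncated_im.
by apply/measurable_EFinP; exact: measurable_int hi.
Qed.

Let energy : \bar R := (\int[mu]_z (cabs (f z) ^+ 2 * w z)%:E)%E.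

Let energyE : energy = (\int[mu]_z (fr z ^+ 2 * w z)%:E +
  \int[mu]_z (fm z ^+ 2 * w z)%:E)%E.
Proof.
rewrite -ge0_integralD//; last 4 first.
- by move=> z _; rewrite lee_fin mulr_ge0 ?sqr_ge0 ?weight_ge0.
- apply/measurable_EFinP; apply: measurable_funM; last exact: measurable_weight.
  exact: measurable_funX.
- by move=> z _; rewrite lee_fin mulr_ge0 ?sqr_ge0 ?weight_ge0.
- apply/measurable_EFinP; apply: measurable_funM; last exact: measurable_weight.
  exact: measurable_funX.
by apply: eq_integral => z _; rewrite cabsE mulrDl EFinD.
Qed.

Let M : R := weighted_constant c t.

Lemma weighted_constant_ge0 : 0 <= M.
Proof.
by rewrite /M /weighted_constant addr_ge0// mulr_ge0 ?sqr_ge0// mulr_ge0// sqr_ge0.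
Qed.

Lemma measurable_re_trunc e : 0 < e ->
  measurable_fun setT (fun z => complex.Re (beurling_trunc Af z e)).
Proof.
move=> e0; rewrite (_ : (fun z => _) = (fun z =>
  conv (truncated_re e) (fun v => complex.Re (Af v)) z -
  conv (truncated_im e) (fun v => complex.Im (Af v)) z)); last first.
  by apply/funext => z; exact: (re_beurling_trunc iAf_re iAf_im).
by apply: measurable_funB; [exact: mconv_re|exact: mconv_im].
Qed.

Lemma measurable_im_trunc e : 0 < e ->
  measurable_fun setT (fun z => complex.Im (beurling_trunc Af z e)).
Proof.
move=> e0; rewrite (_ : (fun z => _) = (fun z =>
  conv (truncated_re e) (fun v => complex.Im (Af v)) z +
  conv (truncated_im e) (fun v => complex.Re (Af v)) z)); last first.
  by apply/funext => z; exact: (im_beurling_trunc iAf_re iAf_im).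
by apply: measurable_funD; [exact: mconv_re|exact: mconv_im].
Qed.

Lemma re_trunc_weighted e : 0 < e -> (forall i, e < side R (P i)) ->
  (\int[mu]_z (complex.Re (beurling_trunc Af z e) ^+ 2 * w z)%:E <=
   2%:E * (M%:E * energy))%E.
Proof.
move=> e0 el; rewrite energyE ge0_muleDr; last 2 first.
- by apply: integral_ge0 => z _; rewrite lee_fin mulr_ge0 ?sqr_ge0 ?weight_ge0.
- by apply: integral_ge0 => z _; rewrite lee_fin mulr_ge0 ?sqr_ge0 ?weight_ge0.
apply: (@weighted_sum_le (conv (truncated_re e) (fun v => complex.Re (Af v)))
  (conv (truncated_im e) (fun v => complex.Im (Af v)))).
- exact: mconv_re.
- exact: mconv_im.
- move=> z; rewrite (re_beurling_trunc iAf_re iAf_im)//; set a := kernel_op _ _ _ _.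
  set b := kernel_op _ _ _ _.
  by have := sqr_ge0 (a + b); rewrite !expr2; lra.
- rewrite (_ : (fun v => complex.Re (Af v)) = (fun v => \1_A v * fr v)).
    exact: truncated_re_weighted.
  by apply/funext => v.
- rewrite (_ : (fun v => complex.Im (Af v)) = (fun v => \1_A v * fm v)).
    exact: truncated_im_weighted.
  by apply/funext => v.
Qed.

Lemma im_trunc_weighted e : 0 < e -> (forall i, e < side R (P i)) ->
  (\int[mu]_z (complex.Im (beurling_trunc Af z e) ^+ 2 * w z)%:E <=
   2%:E * (M%:E * energy))%E.
Proof.
move=> e0 el; rewrite energyE addeC ge0_muleDr; last 2 first.
- by apply: integral_ge0 => z _; rewrite lee_fin mulr_ge0 ?sqr_ge0 ?weight_ge0.
- by apply: integral_ge0 => z _; rewrite lee_fin mulr_ge0 ?sqr_ge0 ?weight_ge0.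
apply: (@weighted_sum_le (conv (truncated_re e) (fun v => complex.Im (Af v)))
  (conv (truncated_im e) (fun v => complex.Re (Af v)))).
- exact: mconv_re.
- exact: mconv_im.
- move=> z; rewrite (im_beurling_trunc iAf_re iAf_im)//; set a := kernel_op _ _ _ _.
  set b := kernel_op _ _ _ _.
  by have := sqr_ge0 (a - b); rewrite !expr2; lra.
- rewrite (_ : (fun v => complex.Im (Af v)) = (fun v => \1_A v * fm v)).
    exact: truncated_re_weighted.
  by apply/funext => v.
- rewrite (_ : (fun v => complex.Re (Af v)) = (fun v => \1_A v * fr v)).
    exact: truncated_im_weighted.
  by apply/funext => v.
Qed.

(** Truncation radii below all the side lengths. *)
Let eps (k : nat) : R := (2^-1 * \prod_(i < N) side R (P i)) * harmonic k.

Let eps_gt0 k : 0 < eps k.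
Proof.
rewrite !mulr_gt0 ?invr_gt0//; first by apply: prodr_gt0 => i _; exact: side_gt0.
Qed.

Let eps_lt k i : eps k < side R (P i).
Proof.
have l0 := side_gt0 R (P i).
have pl : \prod_(i < N) side R (P i) <= side R (P i).
  rewrite (bigD1 i)//= ler_piMr ?(ltW l0)// prodr_ile1// => j _.
  by rewrite side_le1 ltW// side_gt0.
have p0 : 0 < \prod_(i < N) side R (P i).
  by apply: prodr_gt0 => j _; exact: side_gt0.
have h1 : harmonic k <= (1 : R) by rewrite invf_le1 ?ler1n.
apply: (@le_lt_trans _ _ (2^-1 * \prod_(i < N) side R (P i))).
  by rewrite ler_piMr// mulr_ge0 ?invr_ge0 ?(ltW p0).
lra.
Qed.

Let eps_cvg : eps k @[k --> \oo] --> (0 : R).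
Proof.
rewrite -(mulr0 (2^-1 * \prod_(i < N) side R (P i))).
by apply: cvgMr; exact: cvg_harmonic.
Qed.

(** Fatou's lemma for the two components separately. Each of them has real and
    imaginary part a combination of two real transforms; this accounts for the
    factor 4, and the prefactor of the transform for pi^2. *)
Lemma beurling_energy :
  (\int[mu]_z (cabs (beurling Af z) ^+ 2 * w z)%:E <=
   (4 * M / pi ^+ 2)%:E * energy)%E.
Proof.
pose re z e := complex.Re (beurling_trunc Af z e).
pose im z e := complex.Im (beurling_trunc Af z e).
pose seq (u : plane -> R -> R) k z : \bar R := (u z (eps k) ^+ 2 * w z)%:E.
have m_seq u : (forall k, measurable_fun setT (u^~ (eps k))) ->
    forall k, measurable_fun setT (seq u k).
  move=> mu' k; apply/measurable_EFinP; apply: measurable_funM.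
    exact: measurable_funX.
  exact: measurable_weight.
have seq_ge0 u k z : (0 <= seq u k z)%E.
  by rewrite lee_fin mulr_ge0 ?sqr_ge0 ?weight_ge0.
have m_re k : measurable_fun setT (re^~ (eps k)) by exact: measurable_re_trunc.
have m_im k : measurable_fun setT (im^~ (eps k)) by exact: measurable_im_trunc.
have B_re := fatou_bound (m_seq _ m_re) (seq_ge0 re)
  (fun k => re_trunc_weighted (eps_gt0 k) (eps_lt k)).
have B_im := fatou_bound (m_seq _ m_im) (seq_ge0 im)
  (fun k => im_trunc_weighted (eps_gt0 k) (eps_lt k)).
have lim_ge0 u z : (0 <= limn_einf (fun k => seq u k z))%E.
  by apply: limn_einf_ge0 => k.
have pi0 : 0 < (pi : R) by exact: pi_gt0.
have piV : 0 <= (pi ^+ 2)^-1 :> R by rewrite invr_ge0 sqr_ge0.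
apply: (@le_trans _ _ (\int[mu]_z (((pi ^+ 2)^-1)%:E *
  (limn_einf (fun k => seq re k z) + limn_einf (fun k => seq im k z))))%E).
  apply: ge0_le_integralT => z.
    by rewrite lee_fin mulr_ge0 ?sqr_ge0 ?weight_ge0.
  have h1 := sqr_lim_le (re z) (weight_ge0 z) eps_gt0 eps_cvg.
  have h2 := sqr_lim_le (im z) (weight_ge0 z) eps_gt0 eps_cvg.
  apply: (@le_trans _ _ (((pi ^+ 2)^-1)%:E *
    ((lim (re z x @[x --> 0^'+]) ^+ 2 * w z)%:E +
     (lim (im z x @[x --> 0^'+]) ^+ 2 * w z)%:E)))%E; last first.
    apply: lee_wpmul2l; first by rewrite lee_fin.
    by apply: leeD; [exact: h1|exact: h2].
  rewrite -EFinD -EFinM lee_fin -mulrDl mulrA ler_wpM2r ?weight_ge0//.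
  by rewrite /beurling sqr_cabs_scale// gt_eqF.
rewrite ge0_integralZl_EFin//; last 2 first.
- by move=> z _; rewrite adde_ge0.
- by apply: emeasurable_funD; apply: measurable_limn_einf; exact: m_seq.
rewrite ge0_integralD//; [|by apply: measurable_limn_einf; exact: m_seq
  |by apply: measurable_limn_einf; exact: m_seq].
apply: le_trans (lee_wpmul2l _ (leeD B_re B_im)) _ => //.
have en0 : (0 <= energy)%E.
  by apply: integral_ge0 => z _; rewrite lee_fin mulr_ge0 ?sqr_ge0 ?weight_ge0.
have M0 := weighted_constant_ge0.
rewrite [(2%:E * _)%E]muleA -EFinM -ge0_muleDl ?lee_fin ?mulr_ge0// -EFinD.
rewrite muleA -EFinM (_ : _ * (_ + _) = 4 * M / pi ^+ 2)//; ring.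
Qed.

End one_complex_function.
End weighted_beurling.

(** * Dependence of the constant on the dimension *)
Section constant.
Variables (R : realType) (c : R).
Hypothesis c12 : 12 <= c.

Lemma powR2_lt (s t : R) : s < t -> 2 `^ s < 2 `^ t :> R.
Proof.
by move=> st; rewrite /powR gt_eqF// ltr_expR ltr_pM2r// ln_gt0// ltr1n.
Qed.

Lemma column_constant_lt (s t : R) : s < t -> t < 2 ->
  0 < column_constant s /\ column_constant s < column_constant t.
Proof.
move=> st t2; have h1 : 2 `^ (s - 2) < 2 `^ (t - 2) :> R.
  by apply: powR2_lt; rewrite ltrD2r.
have h2 : 2 `^ (t - 2) < 1 :> R.
  by rewrite -[ltRHS](powRr0 2); apply: powR2_lt; rewrite subr_lt0.
have h3 : 0 < 1 - 2 `^ (t - 2) :> R by rewrite subr_gt0.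
have h4 : 0 < 1 - 2 `^ (s - 2) :> R by rewrite subr_gt0 (lt_trans h1).
split; first by rewrite divr_gt0.
by rewrite ltr_pM2l// ltf_pV2 ?posrE// ltrD2l ltrN2.
Qed.

Definition beurling_constant (u : R) : R :=
  Num.sqrt (4 * weighted_constant c u / pi ^+ 2).

Lemma weighted_constant_gt0 u : 0 < weighted_constant c u.
Proof.
have p := pi_gt0 R.
rewrite /weighted_constant ltr_pwDl// ?mulr_gt0 ?exprn_gt0//.
by rewrite mulr_ge0 ?sqr_ge0// mulr_ge0 ?sqr_ge0.
Qed.

Lemma beurling_constant_gt0 u : 0 < beurling_constant u.
Proof.
have p := pi_gt0 R; have w := weighted_constant_gt0 u.
by rewrite sqrtr_gt0 divr_gt0 ?mulr_gt0 ?exprn_gt0.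
Qed.

Lemma beurling_constant_lt (s t : R) : s < t -> t < 2 ->
  beurling_constant s < beurling_constant t.
Proof.
move=> st t2; have [c0 cc] := column_constant_lt st t2.
have p := pi_gt0 R; have w := weighted_constant_gt0 t.
have c1 : 0 < c by apply: lt_le_trans c12.
rewrite ltr_sqrt; last by rewrite divr_gt0 ?mulr_gt0 ?exprn_gt0.
rewrite ltr_pM2r ?invr_gt0 ?exprn_gt0// ltr_pM2l//.
rewrite ltrD2l ltr_pM2l ?mulr_gt0 ?exprn_gt0// ltrXn2r//.
  by rewrite mulr_ge0 ?(ltW c0).
by rewrite ltr_pM2l.
Qed.

End constant.

Lemma inL2_components (R : realType) (f : plane R -> R[i]) : inL2 f ->
  [/\ measurable_fun setT (fun v => complex.Re (f v)),
      measurable_fun setT (fun v => complex.Im (f v)),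
      (\int[area R]_z (complex.Re (f z) ^+ 2)%:E < +oo)%E
    & (\int[area R]_z (complex.Im (f z) ^+ 2)%:E < +oo)%E].
Proof.
move=> [[mr mi]]; rewrite /l2norm => f2.
have fin : (\int[area R]_z (cabs (f z) ^+ 2)%:E < +oo)%E.
  rewrite ltey; apply/negP => /eqP; rewrite /area /= => E; move: f2.
  by under eq_integral do rewrite mulr1; rewrite E poweRyr// gt_eqF.
split=> //; apply: le_lt_trans fin; apply: ge0_le_integralT => z.
- by rewrite lee_fin sqr_ge0.
- by rewrite lee_fin cabsE lerDl sqr_ge0.
- by rewrite lee_fin sqr_ge0.
- by rewrite lee_fin cabsE lerDr sqr_ge0.
Qed.

Lemma l2norm_le (R : realType) (w : plane R -> R) (f g : plane R -> R[i]) (K : R) :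
  0 <= K -> (forall z, 0 <= w z) ->
  (\int[(@lebesgue_measure R \x @lebesgue_measure R)%E]_z
     (cabs (g z) ^+ 2 * w z)%:E <=
   K%:E * \int[(@lebesgue_measure R \x @lebesgue_measure R)%E]_z
     (cabs (f z) ^+ 2 * w z)%:E)%E ->
  (l2norm w g <= (Num.sqrt K)%:E * l2norm w f)%E.
Proof.
move=> K0 w0 B.
have I0 (h : plane R -> R[i]) :
    (0 <= \int[(@lebesgue_measure R \x @lebesgue_measure R)%E]_z
       (cabs (h z) ^+ 2 * w z)%:E)%E.
  by apply: integral_ge0 => z _; rewrite lee_fin mulr_ge0 ?sqr_ge0.
rewrite /l2norm -powR12_sqrt// -poweR_EFin -poweRM//.
apply: gt0_ler_poweR => //.
- by rewrite in_itv /= leey andbT; exact: I0.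
- by rewrite in_itv /= leey andbT mule_ge0 ?lee_fin//; exact: I0.
Qed.

Unset Implicit Arguments.
Theorem proposition2p5 (R : realType) :
  exists C : R -> R,
    [/\ forall t : R, 0 < t < 2 -> 0 < C t,
        forall s t : R, 0 < s -> s < t -> t < 2 -> C s < C t
      & forall (t : R) (N : nat) (P : 'I_N -> dyadic),
          0 < t < 2 ->
          (forall i j : 'I_N, i != j ->
             dilate (3 : R) (P i) `&` dilate (3 : R) (P j) = set0) ->
          (pack_norm t P <= 1)%E ->
          forall f : plane R -> R[i],
            inL2 f ->
            (l2norm (weight t P) (beurling (restrict_to (cubes_union P) f))
             <= (C t)%:E * l2norm (weight t P) f)%E].
Proof.
have [c c12 compare] := kernel_compare R.
exists (beurling_constant c); split.
- by move=> t _; exact: beurling_constant_gt0.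
- by move=> s t _ st t2; exact: beurling_constant_lt.
move=> t N P /andP[t0 t2] disjoint pack f /inL2_components[mr mi fr2 fi2].
have B := beurling_energy t0 t2 disjoint pack c12 compare mr mi fr2 fi2.
have K0 : 0 <= 4 * weighted_constant c t / pi ^+ 2.
  by rewrite divr_ge0 ?sqr_ge0// mulr_ge0// ltW// weighted_constant_gt0.
apply: l2norm_le => // z; exact: weight_ge0.
Qed.
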